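(* Let $P=\mathbb{CP}^n$ or $\mathbb{HP}^n$, with the Hopf normalization, and correspondingly $\mathbb K=\mathbb C$ or $\mathbb H$. Let $F:\Sigma\to P$ be a closed connected immersed hypersurface. If $$r_f(F,P)=\frac{\pi}{4},$$ then $F$ is locally congruent to a projective Clifford hypersurface. More precisely, after an isometry of $P$, the local model is $$\left\{[u:v]\in\mathbb P_{\mathbb K}(\mathbb K^{k+1}\oplus\mathbb K^{n-k}):\|u\|=\|v\|\right\}$$ for some $0\le k\le n-1$. Equivalently, it is the tube of radius $\pi/4$ around a totally geodesic $\mathbb{KP}^k\subset\mathbb{KP}^n$. For a one-sided immersion, $r_f$ is understood on the two-sided normal cover.
   Context: Hopf normalization: the metric on $\mathbb{CP}^n$ (resp. $\mathbb{HP}^n$) is the quotient metric making the Hopf fibration $S^{2n+1}(1)\to\mathbb{CP}^n$ (resp. $S^{4n+3}(1)\to\mathbb{HP}^n$), with fibre $S^1$ (resp. $S^3$), from the unit round sphere a Riemannian submersion. $\mathbb P_{\mathbb K}(\mathbb K^{n+1})$ denotes $\mathbb{KP}^n$. The tube of radius $\pi/4$ around $L$ is the set of points at distance $\pi/4$ from $L$. Focal radius: for a two-sided immersion $F:\Sigma\to P$ with unit normal field $\nu$, put $\Phi_t(x)=\exp_{F(x)}(t\nu_x)$. Then $r_f(F,P)=\sup\{r>0:\Phi_t\text{ is nonsingular (an immersion) for every }|t|<r\}$. For a one-sided immersion, the two-sided normal cover is the double cover $\{(x,n):x\in\Sigma,\ n\text{ a unit normal of }F\text{ at }x\}$ of $\Sigma$,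 on which $F$ lifts to a two-sided immersion. ''Closed'' means compact without boundary. $F$ is locally congruent to a model hypersurface if every point of $\Sigma$ has a neighbourhood whose image is carried by an isometry of $P$ onto an open piece of the model. *)

(* Defs.v *)
From HB Require Import structures.
From mathcomp Require Import all_boot all_order all_algebra.
From mathcomp Require Import generic_quotient.
From mathcomp Require Import all_classical all_reals all_analysis.
From mathcomp Require Import ring.
Set Implicit Arguments.
Unset Strict Implicit.
Unset Printing Implicit Defensive.
Import Order.TTheory GRing.Theory Num.Theory.
Import numFieldNormedType.Exports.

Local Open Scope classical_set_scope.
Local Open Scope ring_scope.
Local Open Scope quotient_scope.

Variant scalars := Complexes | Quaternions.

Definition kdim (K : scalars) : nat := if K is Complexes then 2 else 4.

Section Scalars.
Context {R : realType} {K : scalars}.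
Local Notation KK := 'rV[R]_(kdim K).
Implicit Types a b c : KK.

Definition kcoord a (i : nat) : R := oapp (a 0) 0 (insub i).

(* Hamilton's product in the basis 1, i, j, k; the complex numbers are the
   subalgebra spanned by 1 and i. *)
Definition hamilton (a b : nat -> R) : seq R :=
  let: (a0, a1, a2, a3) := (a 0, a 1, a 2, a 3)%N in
  let: (b0, b1, b2, b3) := (b 0, b 1, b 2, b 3)%N in
  [:: a0 * b0 - a1 * b1 - a2 * b2 - a3 * b3;
      a0 * b1 + a1 * b0 + a2 * b3 - a3 * b2;
      a0 * b2 - a1 * b3 + a2 * b0 + a3 * b1;
      a0 * b3 + a1 * b2 - a2 * b1 + a3 * b0].

Definition kmul a b : KK := \row_(j < kdim K) (hamilton (kcoord a) (kcoord b))`_j.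

Definition kone : KK := \row_(j < kdim K) (val j == 0%N)%:R.

Definition kconj a : KK := \row_(j < kdim K) (if val j == 0%N then a 0 j else - a 0 j).

End Scalars.

(* Real Euclidean inner product; 'M[R]_(m, kdim K) is the right vector space
   K^m, with the entries of a vector as rows. *)
Definition inner {R : realType} {m p : nat} (x y : 'M[R]_(m, p)) : R :=
  \sum_i \sum_j x i j * y i j.

Definition enorm {R : realType} {m p : nat} (x : 'M[R]_(m, p)) : R :=
  Num.sqrt (inner x x).

Definition kscale {R : realType} {K : scalars} {m : nat}
    (z : 'M[R]_(m, kdim K)) (l : 'rV[R]_(kdim K)) : 'M[R]_(m, kdim K) :=
  \matrix_(i, j) kmul (row i z) l 0 j.

Section ScalarTheory.
Context {R : realType} {K : scalars}.
Local Notation KK := 'rV[R]_(kdim K).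
Implicit Types a b c : KK.

Lemma kcoordE a (j : 'I_(kdim K)) : a 0 j = kcoord a j.
Proof. by rewrite /kcoord valK. Qed.

Lemma kcoordM a b i : (i < 4)%N ->
  kcoord (kmul a b) i = (hamilton (kcoord a) (kcoord b))`_i.
Proof.
move=> i4; rewrite {1}/kcoord; case: insubP => [j _ <-|] /=; first by rewrite mxE.
case: K a b => /= a b; last by rewrite i4.
have c2 (x : 'rV[R]_(kdim Complexes)) : kcoord x 2 = 0 by rewrite /kcoord insubF.
have c3 (x : 'rV[R]_(kdim Complexes)) : kcoord x 3 = 0 by rewrite /kcoord insubF.
by move: i i4 => [|[|[|[|]]]] //= _ _; rewrite !c2 !c3 !(mulr0, mul0r, addr0, subr0).
Qed.

Lemma kcoord1 i : kcoord (kone : KK) i = (i == 0%N)%:R.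
Proof.
rewrite /kcoord; case: insubP => [j _ <-|] /=; first by rewrite mxE.
by case: i => //; case: K.
Qed.

Lemma kcoordC a i : kcoord (kconj a) i = if i == 0%N then kcoord a i else - kcoord a i.
Proof.
rewrite /kcoord; case: insubP => [j _ <-|] /=; first by rewrite mxE.
by rewrite oppr0 if_same.
Qed.

Lemma kcoordP a b : (forall i, (i < 4)%N -> kcoord a i = kcoord b i) -> a = b.
Proof.
move=> ab; apply/rowP => j; rewrite !kcoordE ab //.
by apply: leq_trans (ltn_ord j) _; case: K.
Qed.

Lemma inner_kcoord a b : inner a b =
  kcoord a 0 * kcoord b 0 + kcoord a 1 * kcoord b 1
  + kcoord a 2 * kcoord b 2 + kcoord a 3 * kcoord b 3.
Proof.
rewrite /inner big_ord1; under eq_bigr do rewrite !kcoordE.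
case: K a b => /= a b.
  have c2 (x : 'rV[R]_(kdim Complexes)) : kcoord x 2 = 0 by rewrite /kcoord insubF.
  have c3 (x : 'rV[R]_(kdim Complexes)) : kcoord x 3 = 0 by rewrite /kcoord insubF.
  by rewrite !big_ord_recl big_ord0 /= /bump /= !c2 !c3; ring.
by rewrite !big_ord_recl big_ord0 /= /bump /=; ring.
Qed.

Local Lemma lt4P (P : nat -> Prop) : P 0 -> P 1 -> P 2 -> P 3 ->
  forall i, (i < 4)%N -> P i.
Proof. by move=> ? ? ? ? [|[|[|[|]]]]. Qed.

Lemma kmulA a b c : kmul (kmul a b) c = kmul a (kmul b c).
Proof.
by apply: kcoordP; apply: lt4P; rewrite !kcoordM //= !kcoordM //=; ring.
Qed.

Lemma kmulr1 a : kmul a kone = a.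
Proof.
by apply: kcoordP; apply: lt4P; rewrite !kcoordM //= !kcoord1 /=; ring.
Qed.

Lemma kmul_conj a : kmul a (kconj a) = inner a a *: kone.
Proof.
have kZ (x : R) (y : KK) i : kcoord (x *: y) i = x * kcoord y i.
  by rewrite /kcoord; case: insubP => /= [j _ _|_]; rewrite ?mxE ?mulr0.
apply: kcoordP; apply: lt4P;
  by rewrite kcoordM //= !kcoordC /= kZ kcoord1 inner_kcoord /=; ring.
Qed.

Lemma inner_kconj a : inner (kconj a) (kconj a) = inner a a.
Proof. by rewrite !inner_kcoord !kcoordC /=; ring. Qed.

Lemma inner_kmul a b : inner (kmul a b) (kmul a b) = inner a a * inner b b.
Proof. by rewrite !inner_kcoord !kcoordM //=; ring. Qed.

Lemma inner_kone : inner (kone : KK) kone = 1.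
Proof. by rewrite inner_kcoord !kcoord1 /=; ring. Qed.

Context {m : nat}.
Implicit Types z : 'M[R]_(m, kdim K).

Lemma row_kscale z a i : row i (kscale z a) = kmul (row i z) a.
Proof. by apply/rowP => j; rewrite !mxE. Qed.

Lemma kscale1 z : kscale z kone = z.
Proof. by apply/row_matrixP => i; rewrite row_kscale kmulr1. Qed.

Lemma kscaleA z a b : kscale (kscale z a) b = kscale z (kmul a b).
Proof. by apply/row_matrixP => i; rewrite !row_kscale kmulA. Qed.

Lemma kscaleK z a : inner a a = 1 -> kscale (kscale z a) (kconj a) = z.
Proof. by move=> a1; rewrite kscaleA kmul_conj a1 scale1r kscale1. Qed.

End ScalarTheory.

Section Hopf.
Context (R : realType) (K : scalars) (n : nat).
Local Notation V := 'M[R]_(n.+1, kdim K).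

Definition sphere : set V := [set z | inner z z = 1].

(* Orthogonality to z K, that is, to z and to the tangent space z (Im K) of the
   fibre through z. *)
Definition horizontal (z v : V) : Prop :=
  forall j, inner v (kscale z (delta_mx 0 j)) = 0.

(* Orthogonal projection onto the horizontal space: for a unit vector z the
   vectors z e_j are orthonormal. *)
Definition hproj (z w : V) : V :=
  w - \sum_j inner w (kscale z (delta_mx 0 j)) *: kscale z (delta_mx 0 j).

Definition horizontal_bundle : set (V * V) :=
  [set zv | sphere zv.1 /\ horizontal zv.1 zv.2].

Definition hopf_rel (z w : sphere) : bool :=
  `[< exists2 l : 'rV[R]_(kdim K), inner l l = 1 & val w = kscale (val z) l >].

Definition horizontal_rel (z w : horizontal_bundle) : bool :=
  `[< exists2 l : 'rV[R]_(kdim K), inner l l = 1 &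
        val w = (kscale (val z).1 l, kscale (val z).2 l) >].

Fact hopf_rel_refl : reflexive hopf_rel.
Proof.
by move=> z; apply/asboolP; exists kone; rewrite ?inner_kone ?kscale1.
Qed.

Fact hopf_rel_sym : symmetric hopf_rel.
Proof.
by move=> z w; apply/asboolP/asboolP => -[l l1 ->]; exists (kconj l);
  rewrite ?inner_kconj ?kscaleK.
Qed.

Fact hopf_rel_trans : transitive hopf_rel.
Proof.
move=> w z x /asboolP[l l1 wE] /asboolP[k k1 xE]; apply/asboolP.
by exists (kmul l k); rewrite ?inner_kmul ?l1 ?k1 ?mulr1 // xE wE kscaleA.
Qed.

Canonical hopf_equiv := EquivRel hopf_rel hopf_rel_refl hopf_rel_sym hopf_rel_trans.

Fact horizontal_rel_refl : reflexive horizontal_rel.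
Proof.
move=> z; apply/asboolP; exists kone; rewrite ?inner_kone ?kscale1 //.
by case: (val z).
Qed.

Fact horizontal_rel_sym : symmetric horizontal_rel.
Proof.
by move=> z w; apply/asboolP/asboolP => -[l l1 ->]; exists (kconj l);
  rewrite ?inner_kconj //= !kscaleK //; case: (val _).
Qed.

Fact horizontal_rel_trans : transitive horizontal_rel.
Proof.
move=> w z x /asboolP[l l1 wE] /asboolP[k k1 xE]; apply/asboolP.
by exists (kmul l k); rewrite ?inner_kmul ?l1 ?k1 ?mulr1 // xE wE /= !kscaleA.
Qed.

Canonical horizontal_equiv := EquivRel horizontal_rel
  horizontal_rel_refl horizontal_rel_sym horizontal_rel_trans.

Definition KP := quotient_topology {eq_quot hopf_rel}.

Definition hopf (z : sphere) : KP := \pi_({eq_quot hopf_rel})%qT z.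

(* The tangent bundle of KP.  The class of (z, v) is the tangent vector
   d(hopf)_z(v) at hopf z; since hopf is a Riemannian submersion, its length is
   the Euclidean length of the horizontal vector v. *)
Definition TKP := {eq_quot horizontal_rel}.

Definition tvec (zv : horizontal_bundle) : TKP := \pi_(TKP)%qT zv.

Fact hbase_subproof (zv : horizontal_bundle) : (val zv).1 \in sphere.
Proof. by rewrite inE; case: (set_valP zv). Qed.

Definition hbase (zv : horizontal_bundle) : sphere :=
  exist (fun z => z \in sphere) _ (hbase_subproof zv).

Definition foot (X : TKP) : KP := hopf (hbase (repr X)).

Fact hscale_subproof (t : R) (zv : horizontal_bundle) :
  ((val zv).1, t *: (val zv).2) \in horizontal_bundle.
Proof.
rewrite inE; case: (set_valP zv) => /= zS zv0; split => //= j.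
rewrite -[RHS](mulr0 t) -(zv0 j) /inner mulr_sumr; apply: eq_bigr => i _.
by rewrite mulr_sumr; apply: eq_bigr => ? _; rewrite mxE mulrA.
Qed.

Definition tscale (t : R) (X : TKP) : TKP :=
  tvec (exist (fun zv => zv \in horizontal_bundle) _ (hscale_subproof t (repr X))).

(* The distance of the quotient metric: the distance between the fibres for the
   angular distance of the unit sphere. *)
Definition dist (p q : KP) : R :=
  inf [set acos (inner (val z) (val w)) | z in [set z | hopf z = p]
                                        & w in [set w | hopf w = q]].

Definition isometry (T : KP -> KP) : Prop :=
  (forall p q, dist (T p) (T q) = dist p q) /\ (forall q, exists p, T p = q).

(* The velocity at time 0 is d(hopf)(g'(0)) for any local lift g of the curve. *)
Definition has_velocity (c : R -> KP) (X : TKP) : Prop :=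
  exists g : R -> sphere,
  [/\ \forall t \near 0, c t = hopf (g t),
      derivable (fun t => val (g t)) 0 1 &
      exists zv : horizontal_bundle,
        [/\ tvec zv = X, (val zv).1 = val (g 0)
          & (val zv).2 = hproj (val (g 0)) ('D_1 (fun t => val (g t)) 0)]].

(* Geodesics are the locally minimizing curves of constant speed. *)
Definition geodesic (c : R -> KP) : Prop :=
  exists l : R, forall s, exists2 e, 0 < e & forall t u,
    `|t - s| < e -> `|u - s| < e -> dist (c t) (c u) = l * `|t - u|.

Definition exp_map (X : TKP) : KP :=
  xget (foot X) [set q | exists c, [/\ geodesic c, has_velocity c X & c 1 = q]].

Definition tangent_to (L : set KP) (X : TKP) : Prop :=
  exists c, has_velocity c X /\ \forall t \near 0, L (c t).

Definition totally_geodesic (L : set KP) : Prop :=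
  forall X, tangent_to L X -> forall t, L (exp_map (tscale t X)).

Definition tube (r : R) (L : set KP) : set KP :=
  [set p | inf [set dist p q | q in L] = r].

(* The components u and v of z = (u, v) in K^(k+1) (+) K^(n-k). *)
Definition upart (k : nat) (z : V) : V :=
  \matrix_(i, j) (if (i <= k)%N then z i j else 0).
Definition vpart (k : nat) (z : V) : V :=
  \matrix_(i, j) (if (i <= k)%N then 0 else z i j).

Definition clifford (k : nat) : set KP :=
  [set p | exists2 z : sphere, hopf z = p &
             enorm (upart k (val z)) = enorm (vpart k (val z))].

Definition projective_subspace (k : nat) : set KP :=
  [set p | exists2 z : sphere, hopf z = p & vpart k (val z) = 0].

End Hopf.

Arguments sphere R K n _ : clear implicits.
Arguments horizontal_bundle R K n _ : clear implicits.
Arguments clifford R K n k _ : clear implicits.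
Arguments projective_subspace R K n k _ : clear implicits.

(* Smoothness on an open subset of a finite-dimensional space. *)
Fixpoint Cn {R : realType} {E W : normedModType R} (k : nat)
    (U : set E) (f : E -> W) : Prop :=
  if k is k'.+1 then
    (forall x, U x -> differentiable f x) /\ (forall h, Cn k' U ('D_h f))
  else forall x, U x -> {for x, continuous f}.

Definition smooth {R : realType} {E W : normedModType R}
    (U : set E) (f : E -> W) : Prop := forall k, Cn k U f.

Record chart (R : realType) (T : topologicalType) (m : nat) := Chart {
  cdom : set T;
  cmap : T -> 'rV[R]_m;
  cinv : 'rV[R]_m -> T }.

Definition cimg {R : realType} {T : topologicalType} {m : nat}
  (a : chart R T m) : set 'rV[R]_m := cmap a @` cdom a.

Definition is_chart {R : realType} {T : topologicalType} {m : nat}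
    (a : chart R T m) : Prop :=
  [/\ open (cdom a), open (cimg a),
      forall x, cdom a x -> cinv a (cmap a x) = x,
      forall x, cdom a x -> {for x, continuous (cmap a)} &
      forall y, cimg a y -> {for y, continuous (cinv a)}].

Definition is_atlas {R : realType} {T : topologicalType} {m : nat}
    (A : set (chart R T m)) : Prop :=
  [/\ forall a, A a -> is_chart a,
      forall x, exists2 a, A a & cdom a x &
      forall a b, A a -> A b ->
        smooth (cmap a @` (cdom a `&` cdom b)) (cmap b \o cinv a)].

Record manifold (R : realType) (m : nat) := Manifold {
  carrier :> topologicalType;
  atlas : set (chart R carrier m);
  atlasP : is_atlas atlas;
  manifold_hausdorff : hausdorff_space carrier;
  manifold_second_countable : @second_countable carrier }.

Definition closed_manifold {R : realType} {m : nat} (M : manifold R m) : Prop :=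
  compact [set: M].

Definition smooth_between {R : realType} {m p : nat}
    {M : manifold R m} {N : manifold R p} (U : set M) (f : M -> N) : Prop :=
  forall x, U x -> exists a b W,
    [/\ @atlas _ _ M a, @atlas _ _ N b, cdom a x & W (cmap a x)] /\
    [/\ open W, W `<=` cimg a, (forall y, W y -> cdom b (f (cinv a y))) &
        smooth W (fun y => cmap b (f (cinv a y)))].

Definition local_diffeo {R : realType} {m : nat} {M N : manifold R m}
    (f : M -> N) : Prop :=
  forall x, exists U (g : N -> M),
    [/\ open U, U x, open (f @` U) & forall y, U y -> g (f y) = y] /\
    smooth_between U f /\ smooth_between (f @` U) g.

Section Immersions.
Context {R : realType} {K : scalars} {n m : nat} {M : manifold R m}.
Implicit Types (F : M -> KP R K n) (X : M -> TKP R K n).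

(* hopf is a surjective submersion, so that a map into KP is smooth when it has
   smooth local lifts to the sphere.  Here g lifts F in the chart a around x. *)
Definition local_lift F (x : M) (a : chart R M m) (W : set 'rV[R]_m)
    (g : 'rV[R]_m -> sphere R K n) : Prop :=
  [/\ atlas a, cdom a x & W (cmap a x)] /\
  [/\ open W, W `<=` cimg a, (forall y, W y -> F (cinv a y) = hopf (g y)) &
      smooth W (fun y => val (g y))].

(* With g as above, dF_x h is represented by hproj (g y) ('D_h g y). *)
Definition immersion F : Prop :=
  forall x, exists a W g, local_lift F x a W g /\
    forall h, hproj (val (g (cmap a x))) ('D_h (fun y => val (g y)) (cmap a x)) = 0 ->
              h = 0.

(* N is a unit vector at F x, orthogonal to the image of dF_x. *)
Definition is_unit_normal F (x : M) (N : TKP R K n) : Prop :=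
  exists a W g, local_lift F x a W g /\
  exists zv : horizontal_bundle R K n,
    [/\ tvec zv = N, (val zv).1 = val (g (cmap a x)), enorm (val zv).2 = 1 &
        forall h, inner (val zv).2 ('D_h (fun y => val (g y)) (cmap a x)) = 0].

Definition smooth_field X : Prop :=
  forall x, exists a W (G : 'rV[R]_m -> horizontal_bundle R K n),
    [/\ atlas a, cdom a x & W (cmap a x)] /\
    [/\ open W, W `<=` cimg a, (forall y, W y -> X (cinv a y) = tvec (G y)) &
        smooth W (fun y => val (G y))].

Definition unit_normal_field F (nu : M -> TKP R K n) : Prop :=
  smooth_field nu /\ forall x, is_unit_normal F x (nu x).

Definition two_sided F : Prop := exists nu, unit_normal_field F nu.

Definition normal_exp (nu : M -> TKP R K n) (t : R) (x : M) : KP R K n :=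
  exp_map (tscale t (nu x)).

(* The immersion itself is the foot of nu, so that nu determines Phi_t. *)
Definition focal_radius (nu : M -> TKP R K n) : \bar R :=
  ereal_sup [set r%:E | r in [set r : R | 0 < r /\
    forall t, `|t| < r -> immersion (normal_exp nu t)]].

Definition locally_congruent F (C : set (KP R K n)) : Prop :=
  forall x : M, exists U T (O : set (KP R K n)), [/\ nbhs x U, isometry T, open O &
    T @` (F @` U) = C `&` O].

End Immersions.

(* M' with the projection pr is the double cover {(x, N)} of M by the unit
   normals of F, with its tautological unit normal field nu. *)
Definition normal_cover {R : realType} {K : scalars} {n m : nat}
    {M : manifold R m} (F : M -> KP R K n)
    {M' : manifold R m} (pr : M' -> M) (nu : M' -> TKP R K n) : Prop :=
  [/\ local_diffeo pr, unit_normal_field (F \o pr) nu &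
      forall x N, is_unit_normal F x N -> exists! x', pr x' = x /\ nu x' = N].

Definition has_focal_radius {R : realType} {K : scalars} {n m : nat}
    {M : manifold R m} (F : M -> KP R K n) (r : \bar R) : Prop :=
  (exists2 nu, unit_normal_field F nu & focal_radius nu = r) \/
  (~ two_sided F /\
   exists (M' : manifold R m) (pr : M' -> M) (nu : M' -> TKP R K n),
     normal_cover F pr nu /\ focal_radius nu = r).

(* Main.v *)
From HB Require Import structures.
Require Import Defs.
From mathcomp Require Import all_boot all_order all_algebra.
From mathcomp Require Import generic_quotient ring lra.
From mathcomp Require Import all_classical all_reals all_analysis.
Import Order.TTheory GRing.Theory Num.Theory.
Import numFieldNormedType.Exports.
Local Open Scope classical_set_scope.
Local Open Scope ring_scope.
Set Implicit Arguments.
Unset Strict Implicit.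
Unset Printing Implicit Defensive.

(* Lift the hypersurface to the unit sphere of K^(n+1), with position vector z and
   unit normal v, and extend minus its shape operator to a symmetric operator T of
   K^(n+1) by T dz = - dv, T (z l) = - v l for l in K, and T v = - z.  Geodesics are
   projections of horizontal great circles, so that the parallel hypersurfaces lift
   to cos t z + sin t v, and an eigenvalue mu of T with |mu| > 1 would be a focal
   point at distance arctan (1 / |mu|) < pi / 4.  Hence T is a contraction.  As it
   is isometric on z K, it satisfies T (v l) = - z l, that is,
   <v l, dv> = <z l, dz>.  Differentiating this identity and antisymmetrizing gives
   <dv l, dv> = <dz l, dz> for imaginary l, so that T R_l T = R_l for the right
   multiplication R_l; together with the contraction property this makes T a
   K-linear involution.  The derivative of T is then a symmetric tensor with an
   antisymmetric contraction, so T is locally constant, and the lifted hypersurface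
   lies in the quadric <T z, z> = 0.  By connectedness one T serves for the whole
   hypersurface, and diagonalizing T over K turns the quadric into |u| = |v|. *)

(** * Linear algebra over K *)

(** All equations are written in the flat space K^(n+1), where no curvature terms appear and the
    structure equations are derivatives of the relations between z and v. The extension T v = - z is
    forced: T z = - v and symmetry give <z, T v> = -1, which a contraction allows only for T v = -
    z. The equality case of the contraction bound does most of the work: on z K it gives T^2 = 1,
    and once T R_l T = R_l is known it leaves no room for strict inequality anywhere. Two obstacles
    shape the rest. T is chosen at each point separately, so nothing is known at first about its
    dependence on the point; only the numbers <T u, w> are differentiated, by letting u move with
    the frame. And local congruence asks for an open piece of the model, not just for inclusion in
    it: a nearby point w of the quadric is reached by maximizing |<z, w>| over a piece of the
    hypersurface, where an interior maximum must lie on the fibre of w. *)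

Section LinearFunction.
Context {R : nzRingType} {U V : lmodType R} (f : U -> V).
Hypothesis fl : linear f.

Lemma linear_add u w : f (u + w) = f u + f w.
Proof. by have := fl 1 u w; rewrite !scale1r. Qed.

Lemma linear_zero : f 0 = 0.
Proof. by apply: (addrI (f 0)); rewrite -linear_add !addr0. Qed.

Lemma linear_scale a u : f (a *: u) = a *: f u.
Proof. by have := fl a u 0; rewrite linear_zero !addr0. Qed.

Lemma linear_opp u : f (- u) = - f u.
Proof. by rewrite -scaleN1r linear_scale scaleN1r. Qed.

End LinearFunction.

Section Inner.
Context {R : realType} {m p : nat}.
Implicit Types x y z : 'M[R]_(m, p).

Lemma innerC x y : inner x y = inner y x.
Proof.
by rewrite /inner; apply: eq_bigr => i _; apply: eq_bigr => j _; rewrite mulrC.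
Qed.

Lemma innerDl x y z : inner (x + y) z = inner x z + inner y z.
Proof.
rewrite /inner -big_split; apply: eq_bigr => i _ /=; rewrite -big_split.
by apply: eq_bigr => j _; rewrite mxE mulrDl.
Qed.

Lemma innerZl a x y : inner (a *: x) y = a * inner x y.
Proof.
rewrite /inner mulr_sumr; apply: eq_bigr => i _; rewrite mulr_sumr.
by apply: eq_bigr => j _; rewrite mxE mulrA.
Qed.

Lemma innerDr x y z : inner z (x + y) = inner z x + inner z y.
Proof. by rewrite innerC innerDl !(innerC z). Qed.

Lemma innerZr a x y : inner y (a *: x) = a * inner y x.
Proof. by rewrite innerC innerZl innerC. Qed.

Lemma innerNl x y : inner (- x) y = - inner x y.
Proof. by rewrite -scaleN1r innerZl mulN1r. Qed.

Lemma innerNr x y : inner y (- x) = - inner y x.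
Proof. by rewrite innerC innerNl innerC. Qed.

Lemma inner0l x : inner 0 x = 0.
Proof. by have := innerZl 0 0 x; rewrite scale0r mul0r. Qed.

Lemma inner0r x : inner x 0 = 0.
Proof. by rewrite innerC inner0l. Qed.

Definition innerE := (innerDl, innerDr, innerNl, innerNr, innerZl, innerZr).

Lemma inner_ge0 x : 0 <= inner x x.
Proof. by apply: sumr_ge0 => i _; apply: sumr_ge0 => j _; rewrite -expr2 sqr_ge0. Qed.

Lemma inner_eq0 x : (inner x x == 0) = (x == 0).
Proof.
apply/eqP/eqP => [|->]; last exact: inner0l.
have s_ge0 i : 0 <= \sum_j x i j * x i j.
  by apply: sumr_ge0 => j _; rewrite -expr2 sqr_ge0.
move/(psumr_eq0P (fun i _ => s_ge0 i)) => x0; apply/matrixP => i j.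
have x2 (k : 'I_p) : true -> 0 <= x i k * x i k by rewrite -expr2 sqr_ge0.
have /eqP := psumr_eq0P x2 (x0 i isT) isT (i := j).
by rewrite mulf_eq0 orbb mxE => /eqP.
Qed.

Lemma inner_eq0P x : inner x x = 0 -> x = 0.
Proof. by move/eqP; rewrite inner_eq0 => /eqP. Qed.

Lemma inner_gt0 x : x != 0 -> 0 < inner x x.
Proof. by move=> x0; rewrite lt_def inner_eq0 x0 inner_ge0. Qed.

Lemma inner_inj x y : (forall z, inner x z = inner y z) -> x = y.
Proof.
move=> xy; apply/eqP; rewrite -subr_eq0 -inner_eq0; apply/eqP.
by rewrite innerDl innerNl xy subrr.
Qed.

Lemma cauchy_schwarz x y : inner x y ^+ 2 <= inner x x * inner y y.
Proof.
have [->|y0] := eqVneq y 0; first by rewrite !inner0r expr0n mulr0.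
have yy := inner_gt0 y0.
rewrite -(ler_pM2l yy).
have := inner_ge0 (inner y y *: x - inner x y *: y).
rewrite !innerE (innerC y x) => H.
rewrite -subr_ge0; apply: le_trans H _; rewrite le_eqVlt; apply/orP; left; apply/eqP.
ring.
Qed.

Lemma enorm_ge0 x : 0 <= enorm x.
Proof. exact: sqrtr_ge0. Qed.

Lemma enorm_sqr x : enorm x ^+ 2 = inner x x.
Proof. by rewrite sqr_sqrtr ?inner_ge0. Qed.

Lemma inner_normalize x : x != 0 ->
  inner ((enorm x)^-1 *: x) ((enorm x)^-1 *: x) = 1.
Proof.
move=> x0; have e0 : 0 < enorm x by rewrite sqrtr_gt0 inner_gt0.
by rewrite !innerE -enorm_sqr; field; exact: lt0r_neq0.
Qed.

Lemma inner_sum (I : Type) (r : seq I) (f : I -> 'M[R]_(m, p)) y :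
  inner (\sum_(i <- r) f i) y = \sum_(i <- r) inner (f i) y.
Proof. by elim/big_rec2: _ => [|i a b _ <-]; rewrite ?inner0l ?innerDl. Qed.

Lemma le_inner_enorm x y : inner x y <= enorm x * enorm y.
Proof.
rewrite /enorm -sqrtrM ?inner_ge0 //.
by apply: le_trans (ler_norm _) _; rewrite -sqrtr_sqr ler_wsqrtr // cauchy_schwarz.
Qed.

End Inner.

Section Scalar.
Context {R : realType} {K : scalars}.
Local Notation KK := 'rV[R]_(kdim K).
Implicit Types a b c : KK.

Lemma kcoordD a b i : kcoord (a + b) i = kcoord a i + kcoord b i.
Proof. by rewrite /kcoord; case: insubP => /= [j _ _|_]; rewrite ?mxE ?addr0. Qed.

Lemma kcoordZ (x : R) a i : kcoord (x *: a) i = x * kcoord a i.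
Proof. by rewrite /kcoord; case: insubP => /= [j _ _|_]; rewrite ?mxE ?mulr0. Qed.

Lemma all4P (P : nat -> Prop) : P 0%N -> P 1%N -> P 2%N -> P 3%N ->
  forall i, (i < 4)%N -> P i.
Proof. by move=> ? ? ? ? [|[|[|[|]]]]. Qed.

Local Ltac kring := apply: kcoordP; apply: all4P;
  rewrite ?(kcoordM, kcoordD, kcoordZ, kcoordC, kcoord1, inner_kcoord) //=;
  rewrite ?(kcoordM, kcoordD, kcoordZ, kcoordC, kcoord1, inner_kcoord) //=;
  rewrite ?(kcoordM, kcoordD, kcoordZ, kcoordC, kcoord1, inner_kcoord) //=; ring.

Lemma kmulDl a b c : kmul (a + b) c = kmul a c + kmul b c.
Proof. by kring. Qed.

Lemma kmulDr a b c : kmul c (a + b) = kmul c a + kmul c b.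
Proof. by kring. Qed.

Lemma kmulZl (x : R) a b : kmul (x *: a) b = x *: kmul a b.
Proof. by kring. Qed.

Lemma kmulZr (x : R) a b : kmul b (x *: a) = x *: kmul b a.
Proof. by kring. Qed.

Lemma kmul0l a : kmul 0 a = 0.
Proof. by have := kmulZl 0 0 a; rewrite !scale0r. Qed.

Lemma kmul0r a : kmul a 0 = 0.
Proof. by have := kmulZr 0 0 a; rewrite !scale0r. Qed.

Lemma kmul1r a : kmul kone a = a.
Proof. by kring. Qed.

Lemma kconjK : involutive (@kconj R K).
Proof. by move=> a; kring. Qed.

Lemma kconjD a b : kconj (a + b) = kconj a + kconj b.
Proof. by kring. Qed.

Lemma kconjZ (x : R) a : kconj (x *: a) = x *: kconj a.
Proof. by kring. Qed.

Lemma kconj0 : kconj (0 : KK) = 0.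
Proof. by have := kconjZ 0 (0 : KK); rewrite !scale0r. Qed.

Lemma kconj1 : kconj (kone : KK) = kone.
Proof. by apply/rowP => j; rewrite !mxE; case: eqP => // _; rewrite oppr0. Qed.

Lemma kmul_conjl a : kmul (kconj a) a = inner a a *: kone.
Proof. by rewrite -{2}(kconjK a) kmul_conj inner_kconj. Qed.

(** In this form the adjoint of a right multiplication is its opposite up to a real multiple of the
    identity, and that multiple drops out wherever two vectors are orthogonal. *)
Lemma kconj_inner1 a : kconj a = (2 * inner a kone) *: kone - a.
Proof.
rewrite -scaleN1r; kring.
Qed.

Lemma inner_kmull a b c : inner (kmul a b) c = inner a (kmul c (kconj b)).
Proof. by rewrite !inner_kcoord !kcoordM //= !kcoordC /=; ring. Qed.

Lemma inner_kmulr a b c : inner (kmul a b) c = inner b (kmul (kconj a) c).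
Proof. by rewrite !inner_kcoord !kcoordM //= !kcoordC /=; ring. Qed.

Lemma inner_kconj_adj a b : inner (kconj a) b = inner a (kconj b).
Proof. by rewrite !inner_kcoord !kcoordC /=; ring. Qed.

Lemma inner_delta a j : inner a (delta_mx 0 j) = a 0 j.
Proof.
rewrite /inner big_ord1 (bigD1 j) //= mxE !eqxx mulr1 big1 ?addr0 // => i ij.
by rewrite mxE eqxx (negPf ij) mulr0.
Qed.

Lemma exists_imaginary_unit : exists2 a : KK, inner a a = 1 & kconj a = - a.
Proof.
have d1 : (1 < kdim K)%N by case: K.
exists (delta_mx 0 (Ordinal d1)); first by rewrite inner_delta mxE !eqxx.
by apply/rowP => j; rewrite !mxE; case: j => -[|[|j]] //= _; rewrite ?oppr0 // eqE /= ?eqxx.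
Qed.

End Scalar.

Section Scale.
Context {R : realType} {K : scalars} {m : nat}.
Local Notation KK := 'rV[R]_(kdim K).
Local Notation V := 'M[R]_(m, kdim K).
Implicit Types (a b c l : KK) (v w z : V).

Lemma rowD z w i : row i (z + w) = row i z + row i w.
Proof. by apply/rowP => j; rewrite !mxE. Qed.

Lemma rowZ (x : R) z i : row i (x *: z) = x *: row i z.
Proof. by apply/rowP => j; rewrite !mxE. Qed.

Lemma kscaleDl z w l : kscale (z + w) l = kscale z l + kscale w l.
Proof.
by apply/row_matrixP => i; rewrite rowD !row_kscale -kmulDl rowD.
Qed.

Lemma kscaleDr z a b : kscale z (a + b) = kscale z a + kscale z b.
Proof. by apply/row_matrixP => i; rewrite rowD !row_kscale -kmulDr. Qed.

Lemma kscaleZl (x : R) z l : kscale (x *: z) l = x *: kscale z l.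
Proof.
by apply/row_matrixP => i; rewrite rowZ !row_kscale -kmulZl rowZ.
Qed.

Lemma kscaleZr (x : R) z l : kscale z (x *: l) = x *: kscale z l.
Proof. by apply/row_matrixP => i; rewrite rowZ !row_kscale -kmulZr. Qed.

Lemma kscaleNl z l : kscale (- z) l = - kscale z l.
Proof. by rewrite -scaleN1r kscaleZl scaleN1r. Qed.

Lemma kscaleNr z l : kscale z (- l) = - kscale z l.
Proof. by rewrite -scaleN1r kscaleZr scaleN1r. Qed.

Lemma kscale0l l : kscale (0 : V) l = 0.
Proof. by have := kscaleZl 0 0 l; rewrite !scale0r. Qed.

Lemma kscale0r z : kscale z 0 = 0.
Proof. by have := kscaleZr 0 z 0; rewrite !scale0r. Qed.

Definition kscaleE := (kscaleDl, kscaleDr, kscaleNl, kscaleNr, kscaleZl, kscaleZr).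

Lemma inner_rows v w : inner v w = \sum_i inner (row i v) (row i w).
Proof.
by apply: eq_bigr => i _; rewrite /inner big_ord1; apply: eq_bigr => j _; rewrite !mxE.
Qed.

Lemma inner_kscale_adj z w l : inner (kscale z l) w = inner z (kscale w (kconj l)).
Proof.
by rewrite !inner_rows; apply: eq_bigr => i _; rewrite !row_kscale inner_kmull.
Qed.

Lemma inner_kscalel z a b : inner (kscale z a) (kscale z b) = inner z z * inner a b.
Proof.
rewrite !inner_rows mulr_suml; apply: eq_bigr => i _; rewrite !row_kscale.
by rewrite inner_kmulr -kmulA kmul_conjl kmulZl kmul1r innerZr.
Qed.

Lemma inner_kscaler z w a : inner (kscale z a) (kscale w a) = inner a a * inner z w.
Proof. by rewrite inner_kscale_adj kscaleA kmul_conj kscaleZr kscale1 innerZr. Qed.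

Lemma kscale_eq0 z l : inner z z = 1 -> kscale z l = 0 -> l = 0.
Proof.
by move=> z1 zl; apply: inner_eq0P; rewrite -[LHS]mul1r -z1 -inner_kscalel zl inner0l.
Qed.

(** The K-valued Hermitian product, conjugate-linear in z. As a map of w it is the real adjoint of l
    |-> z l, so that horizontality at z is its vanishing. *)
Definition kdot z w : KK := \row_j inner w (kscale z (delta_mx 0 j)).

Lemma inner_kdot z w l : inner l (kdot z w) = inner w (kscale z l).
Proof.
rewrite {2}(row_sum_delta l) /kdot.
have -> : kscale z (\sum_j l 0 j *: delta_mx 0 j) =
    \sum_j l 0 j *: kscale z (delta_mx 0 j).
  elim/big_rec2: _ => [|j x y _ <-]; first exact: kscale0r.
  by rewrite kscaleDr kscaleZr.
rewrite [RHS]innerC inner_sum {1}/inner big_ord1; apply: eq_bigr => j _.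
by rewrite innerZl mxE innerC.
Qed.

Lemma kdotP z w a : (forall l, inner l a = inner w (kscale z l)) -> kdot z w = a.
Proof. by move=> H; apply: inner_inj => l; rewrite innerC inner_kdot -H innerC. Qed.

Lemma kdotDr z v w : kdot z (v + w) = kdot z v + kdot z w.
Proof. by apply: kdotP => l; rewrite !innerE !inner_kdot. Qed.

Lemma kdotZr (x : R) z w : kdot z (x *: w) = x *: kdot z w.
Proof. by apply: kdotP => l; rewrite !innerE !inner_kdot. Qed.

Lemma kdotNr z w : kdot z (- w) = - kdot z w.
Proof. by apply: kdotP => l; rewrite !innerE !inner_kdot. Qed.

Lemma kdotDl z v w : kdot (v + w) z = kdot v z + kdot w z.
Proof. by apply: kdotP => l; rewrite kscaleDl !innerE !inner_kdot. Qed.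

Lemma kdotZl (x : R) z w : kdot (x *: w) z = x *: kdot w z.
Proof. by apply: kdotP => l; rewrite kscaleZl !innerE !inner_kdot. Qed.

Lemma kdotNl z w : kdot (- w) z = - kdot w z.
Proof. by apply: kdotP => l; rewrite kscaleNl !innerE !inner_kdot. Qed.

Definition kdotE := (kdotDl, kdotDr, kdotNl, kdotNr, kdotZl, kdotZr).

Lemma kdot_kscalel z w l : kdot (kscale z l) w = kmul (kconj l) (kdot z w).
Proof. by apply: kdotP => a; rewrite kscaleA -inner_kdot -{2}(kconjK l) innerC inner_kmulr
  innerC kconjK. Qed.

Lemma kdot_kscaler z w l : kdot z (kscale w l) = kmul (kdot z w) l.
Proof.
apply: kdotP => a; rewrite inner_kscale_adj kscaleA -inner_kdot innerC [RHS]innerC.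
by rewrite inner_kmull.
Qed.

Lemma kdot_self z : kdot z z = inner z z *: kone.
Proof. by apply: kdotP => l; rewrite innerZr -inner_kscalel kscale1 innerC. Qed.

Lemma kdotC z w : kdot z w = kconj (kdot w z).
Proof.
apply: kdotP => l; rewrite innerC inner_kconj_adj innerC inner_kdot innerC.
by rewrite inner_kscale_adj kconjK innerC.
Qed.

End Scale.

(** * The Hopf fibration *)

Section Horizontal.
Context {R : realType} {K : scalars} {m : nat}.
Local Notation KK := 'rV[R]_(kdim K).
Implicit Types l : KK.

(** With k = [kdot z w], the real inequality for w and z k reads |k|^4 <= |z|^2 |w|^2 |k|^2, and
    |k|^2 cancels. *)
Lemma kdot_le (z w : 'M[R]_(m, kdim K)) :
  inner (kdot z w) (kdot z w) <= inner z z * inner w w.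
Proof.
have := cauchy_schwarz w (kscale z (kdot z w)).
rewrite -inner_kdot -[kdot z w in X in _ <= _ * X]kscale1 inner_kscalel.
rewrite kscale1 expr2; set d := inner (kdot z w) _ => H.
have := inner_ge0 (kdot z w); rewrite -/d le_eqVlt => /orP[/eqP <-|d0].
  by rewrite mulr_ge0 ?inner_ge0.
by rewrite -(ler_pM2r d0) (le_trans H) // mulrA (mulrC (inner w w)).
Qed.

(** The conjugate phase of l: a lift is moved along its fibre by it until its Hermitian product with
    another lift is real and nonnegative. *)
Lemma kmul_enorm l : exists2 a : KK, inner a a = 1 & kmul l a = enorm l *: kone.
Proof.
have [->|l0] := eqVneq l 0.
  exists kone; first exact: inner_kone.
  by rewrite kmulr1 /enorm inner0l sqrtr0 scale0r.
have ll := inner_gt0 l0; have el : 0 < enorm l by rewrite sqrtr_gt0.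
exists ((enorm l)^-1 *: kconj l).
  rewrite !innerE inner_kconj -enorm_sqr; field; exact: lt0r_neq0.
rewrite kmulZr kmul_conj -enorm_sqr scalerA; congr (_ *: _).
by field; exact: lt0r_neq0.
Qed.

Lemma enorm_kmul (a b : KK) : enorm (kmul a b) = enorm a * enorm b.
Proof. by rewrite /enorm inner_kmul sqrtrM ?inner_ge0. Qed.

Lemma enorm_kconj (a : KK) : enorm (kconj a) = enorm a.
Proof. by rewrite /enorm inner_kconj. Qed.

Lemma enorm1P (p q : nat) (x : 'M[R]_(p, q)) : enorm x = 1 <-> inner x x = 1.
Proof.
rewrite -enorm_sqr; split=> [->|/eqP]; first by rewrite expr1n.
by rewrite sqrf_eq1 => /orP[/eqP //|/eqP H]; have := enorm_ge0 x; rewrite H; lra.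
Qed.

Lemma enormZ (p q : nat) (a : R) (x : 'M[R]_(p, q)) : enorm (a *: x) = `|a| * enorm x.
Proof.
by rewrite /enorm innerZl innerZr mulrA -expr2 sqrtrM ?sqr_ge0 // sqrtr_sqr.
Qed.

End Horizontal.

Section Projective.
Context {R : realType} {K : scalars} {n : nat}.
Local Notation KK := 'rV[R]_(kdim K).
Local Notation V := 'M[R]_(n.+1, kdim K).
Implicit Types (l : KK) (v w z : V).

Lemma hprojE z w : hproj z w = w - kscale z (kdot z w).
Proof.
rewrite /hproj [in RHS](row_sum_delta (kdot z w)); congr (_ - _).
elim/big_rec2: _ => [|j x y _ ->]; first by rewrite kscale0r.
by rewrite kscaleDr kscaleZr mxE.
Qed.

Lemma horizontalP z v : horizontal z v <-> kdot z v = 0.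
Proof.
split=> [H|H j]; first by apply/rowP => j; rewrite !mxE.
by have /rowP/(_ j) := H; rewrite !mxE.
Qed.

Lemma horizontal_inner z v l : horizontal z v -> inner v (kscale z l) = 0.
Proof. by move/horizontalP => H; rewrite -inner_kdot H inner0r. Qed.

Lemma horizontal_kscale z v l : inner l l = 1 ->
  horizontal z v -> horizontal (kscale z l) (kscale v l).
Proof.
move=> l1 /horizontalP H; apply/horizontalP.
by rewrite kdot_kscalel kdot_kscaler H kmul0l kmul0r.
Qed.

Lemma kdot_hproj z w : inner z z = 1 -> kdot z (hproj z w) = 0.
Proof.
move=> z1; rewrite hprojE kdotDr kdotNr kdot_kscaler kdot_self z1 scale1r.
by rewrite kmul1r subrr.
Qed.

Lemma hproj_eq0 z w : inner z z = 1 -> (hproj z w = 0 <-> exists l, w = kscale z l).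
Proof.
move=> z1; rewrite hprojE; split=> [/eqP|[l ->]].
  by rewrite subr_eq0 => /eqP ->; eexists.
by rewrite kdot_kscaler kdot_self z1 scale1r kmul1r subrr.
Qed.

Definition to_sphere z (h : inner z z = 1) : sphere R K n :=
  exist (fun z => z \in sphere R K n) z (mem_set (h : sphere R K n z)).

Lemma sphereP (z : sphere R K n) : inner (val z) (val z) = 1.
Proof. exact: (set_valP z). Qed.

Definition to_horizontal z v (h : inner z z = 1) (h' : horizontal z v) :
    horizontal_bundle R K n :=
  exist (fun zv => zv \in horizontal_bundle R K n) (z, v)
    (mem_set (conj h h' : horizontal_bundle R K n (z, v))).

Lemma hbundleP (zv : horizontal_bundle R K n) :
  inner (val zv).1 (val zv).1 = 1 /\ horizontal (val zv).1 (val zv).2.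
Proof. exact: (set_valP zv). Qed.

Lemma hopfP (z w : sphere R K n) :
  hopf z = hopf w <-> exists2 l : KK, inner l l = 1 & val w = kscale (val z) l.
Proof.
split; first by move=> /eqquotP /asboolP.
by move=> H; apply/eqquotP/asboolP.
Qed.

Lemma tvecP (x y : horizontal_bundle R K n) :
  tvec x = tvec y <-> exists2 l : KK, inner l l = 1 &
    val y = (kscale (val x).1 l, kscale (val x).2 l).
Proof.
split; first by move=> /eqquotP /asboolP.
by move=> H; apply/eqquotP/asboolP.
Qed.

Lemma hopf_surj (p : KP R K n) : exists z : sphere R K n, hopf z = p.
Proof. by exists (repr p); exact: reprK. Qed.

Lemma inner_sphere_bound (z w : sphere R K n) : -1 <= inner (val z) (val w) <= 1.
Proof.
have := cauchy_schwarz (val z) (val w); rewrite !sphereP mulr1.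
by rewrite -ler_norml -[1 in X in _ -> X]sqrtr1 -sqrtr_sqr => ?; apply: ler_wsqrtr.
Qed.

Lemma kdot_sphere_bound (z w : sphere R K n) : 0 <= enorm (kdot (val z) (val w)) <= 1.
Proof.
rewrite enorm_ge0 /= -[leRHS]sqrtr1; apply: ler_wsqrtr.
by apply: le_trans (kdot_le _ _) _; rewrite !sphereP mulr1.
Qed.

Lemma ler_acos (x y : R) : -1 <= x <= 1 -> -1 <= y <= 1 -> x <= y -> acos y <= acos x.
Proof.
move=> hx hy; apply: contraTT; rewrite -!ltNge => xy.
have ix : acos x \in `[0, pi] by rewrite in_itv /= acos_ge0 ?acos_lepi.
have iy : acos y \in `[0, pi] by rewrite in_itv /= acos_ge0 ?acos_lepi.
by move: xy; rewrite -(ltr_cos ix iy) !acosK ?in_itv.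
Qed.

Lemma inf_min (S : set R) (a : R) : S a -> (forall x, S x -> a <= x) -> inf S = a.
Proof.
move=> Sa aS; apply/eqP; rewrite eq_le; apply/andP; split.
  by apply: ge_inf => //; exists a.
by apply: lb_le_inf => //; exists a.
Qed.

Lemma inner_le_kdot z w : inner z w <= enorm (kdot z w).
Proof.
rewrite innerC -[z in inner _ z]kscale1 -inner_kdot.
apply: le_trans (le_inner_enorm _ _) _.
by rewrite /enorm inner_kone sqrtr1 mul1r.
Qed.

Lemma enorm_kdot_kscale z w a b : inner a a = 1 -> inner b b = 1 ->
  enorm (kdot (kscale z a) (kscale w b)) = enorm (kdot z w).
Proof.
move=> /enorm1P a1 /enorm1P b1; rewrite kdot_kscaler kdot_kscalel !enorm_kmul.
by rewrite enorm_kconj a1 b1 mulr1 mul1r.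
Qed.

(** Real products of lifts are bounded by the modulus of [kdot], which no phase changes, and
    rotating w by the right phase attains the bound; so the infimum is a minimum. *)
Lemma dist_hopf (z w : sphere R K n) :
  dist (hopf z) (hopf w) = acos (enorm (kdot (val z) (val w))).
Proof.
have /andP[d0 d1] := kdot_sphere_bound z w.
apply: inf_min.
  have [a a1 aE] := kmul_enorm (kdot (val z) (val w)).
  have wa : inner (kscale (val w) a) (kscale (val w) a) = 1.
    by rewrite inner_kscaler a1 mul1r sphereP.
  exists z => //; exists (to_sphere wa).
    by apply/esym/hopfP; exists a.
  congr acos; rewrite /= innerC -[val z]kscale1 -inner_kdot kdot_kscaler kscale1 aE.
  by rewrite innerZr inner_kone mulr1.
move=> _ [z' /hopfP[a a1 zE] [w' /hopfP[b b1 wE] <-]].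
apply: ler_acos; first exact: inner_sphere_bound.
  by rewrite (le_trans _ d0) //; lra.
by rewrite zE wE enorm_kdot_kscale // inner_le_kdot.
Qed.

End Projective.

Lemma cvg_near_eq (T : Type) (F : set_system T) {FF : Filter F} (U : topologicalType)
    (f g : T -> U) (l : U) :
  (\forall t \near F, f t = g t) -> f @ F --> l -> g @ F --> l.
Proof.
move=> fg; apply: cvg_trans; apply: near_eq_cvg; apply: filterS fg => t ->.
by [].
Qed.

(** * Derivatives of bilinear expressions *)

Section DirectionalDerivative.
Context {R : realType} {E W : normedModType R}.

Lemma is_deriveP (f : E -> W) x v df : is_derive x v f df <->
  (fun h : R => h^-1 *: (f (h *: v + x) - f x)) @ 0^' --> df.
Proof.
split=> [[fd <-]|H]; first exact: fd.
by split; [apply/cvg_ex; exists df|apply/cvg_lim].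
Qed.

Lemma derivable_line_continuous (f : E -> W) x v : derivable f x v ->
  f (h *: v + x) @[h --> (0 : R)] --> f x.
Proof.
move=> /derivable1P /derivable1_diffP /differentiable_continuous fc.
by have -> : f x = f ((0 : R) *: v + x) by rewrite scale0r add0r.
Qed.

Lemma is_derive_mxP (m p : nat) (f : E -> 'M[R]_(m, p)) x v df :
  is_derive x v f df <-> forall i j, is_derive x v (fun y => f y i j) (df i j).
Proof.
split=> [[fd fE] i j|H].
  have /derivable_mxP/(_ i j) fij := fd.
  by split=> //; rewrite -fE derive_mx // mxE.
have fd : derivable f x v by apply/derivable_mxP => i j; have [] := H i j.
split=> //; rewrite derive_mx //; apply/matrixP => i j; rewrite mxE.
by have [] := H i j.
Qed.

End DirectionalDerivative.

Section Bilinear.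
Context {R : realType} {m p m' p' : nat} {W : normedModType R}.
Local Notation X := 'M[R]_(m, p).
Local Notation Y := 'M[R]_(m', p').
Variable B : X -> Y -> W.
Hypotheses (BDl : forall x x' y, B (x + x') y = B x y + B x' y)
  (BDr : forall x y y', B x (y + y') = B x y + B x y')
  (BZl : forall a x y, B (a *: x) y = a *: B x y)
  (BZr : forall a x y, B x (a *: y) = a *: B x y).

Lemma bilinear_mx_expand x y : B x y =
  \sum_i \sum_j \sum_k \sum_q (x i j * y k q) *: B (delta_mx i j) (delta_mx k q).
Proof.
have B0l y' : B 0 y' = 0 by have := BZl 0 0 y'; rewrite !scale0r.
have B0r x' : B x' 0 = 0 by have := BZr 0 x' 0; rewrite !scale0r.
have Bsl (I : finType) (f : I -> X) y' : B (\sum_i f i) y' = \sum_i B (f i) y'.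
  by elim/big_rec2: _ => // i a b _ <-.
have Bsr (I : finType) (f : I -> Y) x' : B x' (\sum_i f i) = \sum_i B x' (f i).
  by elim/big_rec2: _ => // i a b _ <-.
rewrite {1}(matrix_sum_delta x) Bsl; apply: eq_bigr => i _.
rewrite Bsl; apply: eq_bigr => j _.
rewrite {1}(matrix_sum_delta y) Bsr; apply: eq_bigr => k _.
rewrite Bsr; apply: eq_bigr => q _.
by rewrite BZl BZr scalerA.
Qed.

Lemma bilinear_mx_cvg (T : Type) (F : set_system T) {FF : Filter F}
    (f : T -> X) (g : T -> Y) (a : X) (b : Y) :
  f @ F --> a -> g @ F --> b -> B (f t) (g t) @[t --> F] --> B a b.
Proof.
move=> fa gb; rewrite bilinear_mx_expand.
under eq_cvg do rewrite bilinear_mx_expand.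
apply: (cvg_big (P := predT)) => [|i _]; first exact: add_continuous.
apply: (cvg_big (P := predT)) => [|j _]; first exact: add_continuous.
apply: (cvg_big (P := predT)) => [|k _]; first exact: add_continuous.
apply: (cvg_big (P := predT)) => [|q _]; first exact: add_continuous.
apply: cvgZr_tmp; apply: cvgM.
  exact: (cvg_comp _ _ fa (@coord_continuous _ _ _ i j a)).
exact: (cvg_comp _ _ gb (@coord_continuous _ _ _ k q b)).
Qed.

Lemma is_derive_bilinear_mx (E : normedModType R) (f : E -> X) (g : E -> Y) x v df dg :
  is_derive x v f df -> is_derive x v g dg ->
  is_derive x v (fun y => B (f y) (g y)) (B df (g x) + B (f x) dg).
Proof.
move=> fd gd; apply/is_deriveP.
have gc : g (h *: v + x) @[h --> 0^'] --> g x.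
  apply: cvg_trans (derivable_line_continuous (@ex_derive _ _ _ _ _ _ _ gd)).
  by apply: cvg_app; exact: nbhs_dnbhs.
have /is_deriveP fc := fd; have /is_deriveP gc' := gd.
have fxc : f x @[h --> (0:R)^'] --> f x by exact: cvg_cst.
apply: cvg_trans (cvgD (bilinear_mx_cvg fc gc) (bilinear_mx_cvg fxc gc')).
apply: near_eq_cvg; near=> h.
rewrite fctE /= BZl BZr -scalerDr; congr (_ *: _).
rewrite -[- f x]scaleN1r -[- g x]scaleN1r BDl BDr BZl BZr !scaleN1r.
by rewrite addrA subrK.
Unshelve. all: by end_near. Qed.

End Bilinear.

Section ProductRules.
Context {R : realType} {m p : nat} {E : normedModType R} (x v : E).

Lemma is_derive_inner (f g : E -> 'M[R]_(m, p)) df dg :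
  is_derive x v f df -> is_derive x v g dg ->
  is_derive x v (fun y => inner (f y) (g y)) (inner df (g x) + inner (f x) dg).
Proof.
apply: (@is_derive_bilinear_mx R m p m p R^o (fun x y => inner x y)) => *;
  [exact: innerDl|exact: innerDr|exact: innerZl|exact: innerZr].
Qed.

Lemma is_derive_kscale (K : scalars) (f : E -> 'M[R]_(m, kdim K))
    (g : E -> 'rV[R]_(kdim K)) df dg :
  is_derive x v f df -> is_derive x v g dg ->
  is_derive x v (fun y => kscale (f y) (g y)) (kscale df (g x) + kscale (f x) dg).
Proof.
apply: (@is_derive_bilinear_mx _ _ _ _ _ _ (fun x y => kscale x y)) => *;
  [exact: kscaleDl|exact: kscaleDr|exact: kscaleZl|exact: kscaleZr].
Qed.

Lemma is_derive_kdot (K : scalars) (f g : E -> 'M[R]_(m, kdim K)) df dg :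
  is_derive x v f df -> is_derive x v g dg ->
  is_derive x v (fun y => kdot (f y) (g y)) (kdot df (g x) + kdot (f x) dg).
Proof.
apply: (@is_derive_bilinear_mx _ _ _ _ _ _ (fun x y => kdot x y)) => *;
  [exact: kdotDl|exact: kdotDr|exact: kdotZl|exact: kdotZr].
Qed.

Lemma is_derive_scalev (f : E -> R) (g : E -> 'M[R]_(m, p)) df dg :
  is_derive x v f df -> is_derive x v g dg ->
  is_derive x v (fun y => f y *: g y) (df *: g x + f x *: dg).
Proof.
move=> fd /is_derive_mxP gd; apply/is_derive_mxP => i j; rewrite !mxE.
rewrite (_ : (fun y => _) = (f * (fun y => g y i j))); last first.
  by apply/funext => y; rewrite !mxE.
by apply: is_derive_eq (is_deriveM fd (gd i j)) _; rewrite addrC; congr (_ + _);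
  exact: mulrC.
Qed.

End ProductRules.

Section InnerContinuous.
Context {R : realType} {m p : nat} {T : Type} {F : set_system T} {FF : Filter F}.

Lemma cvg_inner (f g : T -> 'M[R]_(m, p)) a b :
  f @ F --> a -> g @ F --> b -> inner (f t) (g t) @[t --> F] --> inner a b.
Proof.
apply: (@bilinear_mx_cvg _ _ _ _ _ _ (fun x y => inner x y)) => *;
  [exact: innerDl|exact: innerDr|exact: innerZl|exact: innerZr].
Qed.

Lemma cvg_kdot (K : scalars) (f g : T -> 'M[R]_(m, kdim K)) a b :
  f @ F --> a -> g @ F --> b -> kdot (f t) (g t) @[t --> F] --> kdot a b.
Proof.
apply: (@bilinear_mx_cvg _ _ _ _ _ _ (fun x y => kdot x y)) => *;
  [exact: kdotDl|exact: kdotDr|exact: kdotZl|exact: kdotZr].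
Qed.

End InnerContinuous.

(** * Geodesics and the exponential map *)

Section Great.
Context {R : realType} {K : scalars} {n : nat}.
Local Notation KK := 'rV[R]_(kdim K).
Local Notation V := 'M[R]_(n.+1, kdim K).
Implicit Types (l : KK) (a b v w z : V) (t s : R).

Fact unit_vector_subproof :
  inner (\matrix_(i, j) ((i == 0) && (val j == 0%N))%:R : V)
    (\matrix_(i, j) ((i == 0) && (val j == 0%N))%:R) = 1.
Proof.
rewrite inner_rows (bigD1 0) //= big1 ?addr0 => [|i i0]; last first.
  apply: etrans (inner0l (0 : KK)); congr inner; apply/rowP => j;
    by rewrite !mxE (negPf i0).
apply: etrans (inner_kone (R := R) (K := K)).
by congr inner; apply/rowP => j; rewrite !mxE eqxx.
Qed.

(* [hp] and [tv] extend [hopf] and [tvec] by junk values outside the sphere and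
   the horizontal bundle. *)
Definition hp z : KP R K n := hopf (insubd (to_sphere unit_vector_subproof) z).

Fact horizontal0 z : horizontal z 0.
Proof. by apply/horizontalP/kdotP => l; rewrite inner0l inner0r. Qed.

Definition tv z v : TKP R K n :=
  tvec (insubd (to_horizontal unit_vector_subproof (horizontal0 _)) (z, v)).

Lemma hp_val (z : sphere R K n) : hp (val z) = hopf z.
Proof. by rewrite /hp valKd. Qed.

Lemma to_sphereK z (h : inner z z = 1) : hopf (to_sphere h) = hp z.
Proof. by rewrite -hp_val. Qed.

Lemma hp_eq z w : inner z z = 1 -> inner w w = 1 ->
  (hp z = hp w <-> exists2 l, inner l l = 1 & w = kscale z l).
Proof.
by move=> z1 w1; rewrite -(to_sphereK z1) -(to_sphereK w1); apply: hopfP.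
Qed.

Lemma hp_kscale z l : inner z z = 1 -> inner l l = 1 -> hp (kscale z l) = hp z.
Proof.
move=> z1 l1; apply/esym/hp_eq => //; last by exists l.
by rewrite inner_kscaler l1 mul1r.
Qed.

Lemma hp_surj (p : KP R K n) : exists2 z, inner z z = 1 & hp z = p.
Proof.
by have [z <-] := hopf_surj p; exists (val z); [exact: sphereP|exact: hp_val].
Qed.

Lemma tv_val (x : horizontal_bundle R K n) : tv (val x).1 (val x).2 = tvec x.
Proof. by rewrite /tv -surjective_pairing valKd. Qed.

Lemma to_horizontalK z v (h : inner z z = 1) (h' : horizontal z v) :
  tvec (to_horizontal h h') = tv z v.
Proof. by rewrite -tv_val. Qed.

Lemma tv_eq z v z' v' : inner z z = 1 -> horizontal z v ->
  inner z' z' = 1 -> horizontal z' v' ->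
  (tv z v = tv z' v' <->
   exists2 l, inner l l = 1 & z' = kscale z l /\ v' = kscale v l).
Proof.
move=> z1 zv z1' zv'; rewrite -(to_horizontalK z1 zv) -(to_horizontalK z1' zv').
split; first by move=> /tvecP[l l1 /= [-> ->]]; exists l.
by move=> [l l1 [zE vE]]; apply/tvecP; exists l => //=; rewrite zE vE.
Qed.

Lemma dist_hp z w : inner z z = 1 -> inner w w = 1 ->
  dist (hp z) (hp w) = acos (enorm (kdot z w)).
Proof.
by move=> z1 w1; rewrite -(to_sphereK z1) -(to_sphereK w1) dist_hopf.
Qed.

Lemma hprojD z v w : hproj z (v + w) = hproj z v + hproj z w.
Proof. by rewrite !hprojE kdotDr kscaleDr opprD addrACA. Qed.

Lemma hprojZ z (x : R) v : hproj z (x *: v) = x *: hproj z v.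
Proof. by rewrite !hprojE kdotZr kscaleZr scalerBr. Qed.

Lemma hproj_fibre z l : inner z z = 1 -> hproj z (kscale z l) = 0.
Proof. by move=> z1; apply/hproj_eq0 => //; exists l. Qed.

Lemma hproj_horizontal z v : horizontal z v -> hproj z v = v.
Proof. by move/horizontalP => H; rewrite hprojE H kscale0r subr0. Qed.

Lemma horizontal_hproj z v : inner z z = 1 -> horizontal z (hproj z v).
Proof. by move=> z1; apply/horizontalP/kdot_hproj. Qed.

Lemma hproj_kscale z w l : inner l l = 1 ->
  hproj (kscale z l) (kscale w l) = kscale (hproj z w) l.
Proof.
move=> l1; rewrite !hprojE kdot_kscalel kdot_kscaler kscaleA -kmulA.
rewrite -[in X in X = _]kmulA kmul_conj l1 scale1r kmul1r.
by rewrite -kscaleA kscaleDl kscaleNl.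
Qed.

Lemma hproj_lift z w l k : inner z z = 1 -> inner l l = 1 ->
  hproj (kscale z l) (kscale w l + kscale z k) = kscale (hproj z w) l.
Proof.
move=> z1 l1; rewrite hprojD hproj_kscale //.
have -> : kscale z k = kscale (kscale z l) (kmul (kconj l) k).
  by rewrite kscaleA -kmulA kmul_conj l1 scale1r kmul1r.
by rewrite hproj_fibre ?addr0 // inner_kscaler l1 mul1r.
Qed.

(** The great circle with initial point z and initial velocity b. For b = 0 the last summand
    vanishes whatever the value of the quotient, and the curve is constant. *)
Definition great z b t : V :=
  cos (enorm b * t) *: z + (sin (enorm b * t) / enorm b) *: b.

Definition dgreat z b t : V :=
  (- (enorm b * sin (enorm b * t))) *: z + cos (enorm b * t) *: b.

Lemma great0 z b : great z b 0 = z.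
Proof. by rewrite /great mulr0 cos0 sin0 mul0r scale0r addr0 scale1r. Qed.

Lemma great_kscale z b l t : inner l l = 1 ->
  great (kscale z l) (kscale b l) t = kscale (great z b t) l.
Proof.
move=> l1; rewrite /great !kscaleE.
by have -> : enorm (kscale b l) = enorm b by rewrite /enorm inner_kscaler l1 mul1r.
Qed.

Lemma great_unit z a t : inner z z = 1 -> inner a a = 1 -> inner z a = 0 ->
  inner (cos t *: z + sin t *: a) (cos t *: z + sin t *: a) = 1.
Proof.
move=> z1 a1 za; rewrite !innerE (innerC a z) z1 a1 za.
by rewrite !mulr0 !mulr1 addr0 add0r -!expr2 cos2Dsin2.
Qed.

Lemma horizontal_orth z b : horizontal z b -> inner z b = 0.
Proof. by move=> H; rewrite innerC -{1}[z]kscale1 horizontal_inner. Qed.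

(** Polar decomposition of b, separating constant geodesics from those with a unit direction. *)
Lemma scale_direction z b : exists2 a : V, b = enorm b *: a &
  (b = 0 /\ a = 0) \/ [/\ 0 < enorm b, inner a a = 1 & horizontal z b -> horizontal z a].
Proof.
have [->|b0] := eqVneq b 0; first by exists 0; [rewrite scaler0|left].
have e0 : 0 < enorm b by rewrite sqrtr_gt0 inner_gt0.
exists ((enorm b)^-1 *: b); first by rewrite scalerA mulfV ?gt_eqF // scale1r.
right; split=> //; first by rewrite !innerE -enorm_sqr; field; rewrite gt_eqF.
by move=> /horizontalP H; apply/horizontalP; rewrite kdotZr H scaler0.
Qed.

Lemma enorm0 : enorm (0 : V) = 0.
Proof. by rewrite /enorm inner0l sqrtr0. Qed.

Lemma great_const z t : great z 0 t = z.
Proof. by rewrite /great enorm0 mul0r cos0 scale1r scaler0 addr0. Qed.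

Lemma greatE z a (x : R) t : inner a a = 1 ->
  great z (x *: a) t = cos (x * t) *: z + sin (x * t) *: a.
Proof.
move=> a1; rewrite /great enormZ (enorm1P _).2 // mulr1.
have [x0|x0|->] := ltgtP x 0.
- rewrite ltr0_norm // mulNr cosN sinN scalerA; congr (_ + _ *: _).
  by field; rewrite lt_eqF.
- rewrite gtr0_norm // scalerA; congr (_ + _ *: _).
  by field; rewrite gt_eqF.
- by rewrite normr0 !mul0r sin0 mul0r scale0r scale0r.
Qed.

Lemma dgreatE z a (x : R) t : inner a a = 1 ->
  dgreat z (x *: a) t = x *: ((- sin (x * t)) *: z + cos (x * t) *: a).
Proof.
move=> a1; rewrite /dgreat enormZ (enorm1P _).2 // mulr1 scalerDr !scalerA mulrN.
have [x0|x0|->] := ltgtP x 0.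
- by rewrite ltr0_norm // (mulNr x t) cosN sinN; congr (_ *: _ + _ *: _); ring.
- by rewrite gtr0_norm //; congr (_ + _ *: _); ring.
- by rewrite normr0; congr (_ *: _ + _ *: _); ring.
Qed.

Lemma inner_great z b t : inner z z = 1 -> horizontal z b ->
  inner (great z b t) (great z b t) = 1.
Proof.
move=> z1 zb; have [a bE [[-> _]|[_ a1 /(_ zb) za]]] := scale_direction z b.
  by rewrite great_const.
by rewrite bE greatE // great_unit // horizontal_orth.
Qed.

(** Horizontality of b kills the mixed terms, so the product is real: any two points of the circle
    are aligned up to sign, and its projection has speed |b|. *)
Lemma kdot_great z b t s : inner z z = 1 -> horizontal z b ->
  kdot (great z b t) (great z b s) = cos (enorm b * (s - t)) *: kone.
Proof.
move=> z1 zb; have [a bE [[-> _]|[_ a1 /(_ zb) za]]] := scale_direction z b.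
  by rewrite !great_const kdot_self z1 enorm0 mul0r cos0.
have /horizontalP za' := za; rewrite bE !greatE // enormZ ((enorm1P a).2 a1) mulr1.
rewrite ger0_norm ?enorm_ge0 //.
rewrite !kdotE !kdot_self z1 a1 (kdotC a z) za' mulrBr cosB.
rewrite kconj0 !scaler0 addr0 add0r !scalerA -scalerDl; congr (_ *: _); ring.
Qed.

Lemma horizontal_dgreat z b t : inner z z = 1 -> horizontal z b ->
  horizontal (great z b t) (dgreat z b t).
Proof.
move=> z1 zb; have [a bE [[-> _]|[_ a1 /(_ zb) za]]] := scale_direction z b.
  by rewrite /dgreat enorm0 !mul0r oppr0 scale0r scaler0 addr0; exact: horizontal0.
have /horizontalP za' := za; rewrite bE greatE // dgreatE //; apply/horizontalP.
rewrite !kdotE !kdot_self z1 a1 (kdotC a z) za'.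
rewrite kconj0 !scaler0 addr0 add0r !scalerA -scalerDl.
by rewrite [X in X *: _](_ : _ = 0) ?scale0r //; ring.
Qed.

Lemma great_flow z b t s : inner z z = 1 -> horizontal z b ->
  great (great z b s) (dgreat z b s) t = great z b (s + t).
Proof.
move=> z1 zb; have [a bE [[-> _]|[_ a1 /(_ zb) za]]] := scale_direction z b.
  rewrite !great_const /dgreat enorm0 !mul0r oppr0 scale0r scaler0 addr0.
  by rewrite great_const.
rewrite bE !(greatE, dgreatE) //; last first.
  rewrite !innerE (innerC a z) (horizontal_orth za) z1 a1.
  rewrite !mulr0 !mulr1 addr0 add0r -(cos2Dsin2 (enorm b * s)); ring.
rewrite mulrDr cosD sinD !scalerDr !scalerA.
rewrite addrACA -!scalerDl; congr (_ *: _ + _ *: _); ring.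
Qed.

Lemma is_derive_great z b t : is_derive t 1 (great z b) (dgreat z b t).
Proof.
have md : is_derive t 1 (fun t => enorm b * t) (enorm b).
  by have := is_deriveZ (enorm b) (is_derive_id t 1); rewrite [_ *: _]mulr1.
have cd := is_derive1_comp (is_derive_cos _) md.
have sd := is_derive1_comp (is_derive_sin _) md.
have sd' := is_deriveZ (enorm b)^-1 sd.
have := is_deriveD (is_derive_scalev cd (is_derive_cst z t 1))
  (is_derive_scalev sd' (is_derive_cst b t 1)).
rewrite !scaler0 !addr0 => H.
apply: (is_derive_eq (near_eq_is_derive _ H)).
  by near=> s; rewrite fctE /great /= [_ *: (sin _)]mulrC.
congr (_ *: _ + _); first by rewrite mulNr mulrC.
have [->|b0] := eqVneq b 0; first by rewrite !scaler0.
have e0 : 0 < enorm b by rewrite sqrtr_gt0 inner_gt0.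
congr (_ *: _); rewrite /GRing.scale /=; field; exact: lt0r_neq0.
Unshelve. all: by end_near. Qed.

End Great.

Section ExpMap.
Context {R : realType} {K : scalars} {n : nat}.
Local Notation KK := 'rV[R]_(kdim K).
Local Notation V := 'M[R]_(n.+1, kdim K).
Implicit Types (l : KK) (a b v w z : V) (t s : R) (X : TKP R K n).

Lemma has_velocityP (c : R -> KP R K n) X : has_velocity c X <->
  exists g : R -> V, [/\ forall t, inner (g t) (g t) = 1,
    \forall t \near 0, c t = hp (g t), derivable g 0 1 &
    X = tv (g 0) (hproj (g 0) ('D_1 g 0))].
Proof.
split=> [[g [cg gd [zv [<- z1 z2]]]]|[g [g1 cg gd ->]]].
  exists (fun t => val (g t)); split => //; first by move=> t; exact: sphereP.
    by near=> t; rewrite hp_val; near: t.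
  by rewrite -tv_val z1 z2.
exists (fun t => to_sphere (g1 t)); split => //.
  by near=> t; rewrite to_sphereK; near: t.
exists (to_horizontal (g1 0) (horizontal_hproj ('D_1 g 0) (g1 0))); split => //.
exact: to_horizontalK.
Unshelve. all: by end_near. Qed.

(** Two lifts of one curve differ by the phase <g1, g2>, which is differentiable along with them.
    Its derivative adds only a vertical vector, which [hproj] removes, and its value at 0 identifies
    the two tangent vectors. *)
Lemma velocity_unique (g1 g2 : R -> V) :
  (forall t, inner (g1 t) (g1 t) = 1) -> (forall t, inner (g2 t) (g2 t) = 1) ->
  derivable g1 0 1 -> derivable g2 0 1 ->
  (\forall t \near 0, hp (g1 t) = hp (g2 t)) ->
  tv (g1 0) (hproj (g1 0) ('D_1 g1 0)) = tv (g2 0) (hproj (g2 0) ('D_1 g2 0)).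
Proof.
move=> g11 g21 /derivableP d1 /derivableP d2 g12.
pose l t := kdot (g1 t) (g2 t).
have lE t : hp (g1 t) = hp (g2 t) -> g2 t = kscale (g1 t) (l t) /\ inner (l t) (l t) = 1.
  move=> /hp_eq => /(_ (g11 t) (g21 t)) [a a1 aE].
  by rewrite /l aE kdot_kscaler kdot_self g11 scale1r kmul1r.
have [g20 l1] := lE 0 (nbhs_singleton g12).
have := is_derive_kscale d1 (is_derive_kdot d1 d2); set k := kdot _ _ + _ => d.
have {}d : is_derive (0 : R) (1 : R) g2 (kscale ('D_1 g1 0) (l 0) + kscale (g1 0) k).
  by apply: near_eq_is_derive d; near=> t; apply/esym/(lE t _).1; near: t.
rewrite (@derive_val _ _ _ _ _ _ _ d) g20 hproj_lift //.
apply/tv_eq => //; [exact: horizontal_hproj| |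
  by apply: horizontal_kscale => //; exact: horizontal_hproj|by exists (l 0)].
by rewrite inner_kscaler l1 mul1r.
Unshelve. all: by end_near. Qed.

Lemma great_velocity z b : inner z z = 1 -> horizontal z b ->
  has_velocity (fun t => hp (great z b t)) (tv z b).
Proof.
move=> z1 zb; apply/has_velocityP; exists (great z b).
have d := is_derive_great z b 0.
split; [by move=> t; exact: inner_great|by near=> t|exact: ex_derive|].
rewrite (@derive_val _ _ _ _ _ _ _ d) great0 /dgreat mulr0 sin0 cos0 mulr0 oppr0.
by rewrite scale0r add0r scale1r hproj_horizontal.
Unshelve. all: by end_near. Qed.

(** Both circles are restarted at time s. Equal germs have equal velocities there, so one phase
    carries the initial data of one circle to those of the other, hence the whole circle. *)
Lemma great_agree z b z' b' s : inner z z = 1 -> horizontal z b ->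
  inner z' z' = 1 -> horizontal z' b' ->
  (\forall t \near s, hp (great z b t) = hp (great z' b' t)) ->
  forall t, hp (great z b t) = hp (great z' b' t).
Proof.
move=> z1 zb z1' zb' H t.
have u1 := inner_great s z1 zb; have h1 := horizontal_dgreat s z1 zb.
have u2 := inner_great s z1' zb'; have h2 := horizontal_dgreat s z1' zb'.
have D0 (w c : V) : hproj w c = c -> hproj (great w c 0) ('D_1 (great w c) 0) = c.
  move=> wc; have d := is_derive_great w c 0.
  rewrite (@derive_val _ _ _ _ _ _ _ d) great0 /dgreat mulr0 sin0 cos0 mulr0 oppr0.
  by rewrite scale0r add0r scale1r wc.
suff tvE : tv (great z b s) (dgreat z b s) = tv (great z' b' s) (dgreat z' b' s).
  have [l l1 [zE bE]] := (tv_eq u1 h1 u2 h2).1 tvE.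
  have -> : t = s + (t - s) by rewrite addrC subrK.
  rewrite -(great_flow _ _ z1 zb) -(great_flow _ _ z1' zb') zE bE great_kscale //.
  by rewrite hp_kscale //; exact: (inner_great _ u1 h1).
have := @velocity_unique (great (great z b s) (dgreat z b s))
  (great (great z' b' s) (dgreat z' b' s)).
rewrite (D0 _ _ (hproj_horizontal h1)) (D0 _ _ (hproj_horizontal h2)).
rewrite (great0 (great z b s)) (great0 (great z' b' s)); apply.
- by move=> u; exact: (inner_great u u1 h1).
- by move=> u; exact: (inner_great u u2 h2).
- exact: (@ex_derive _ _ _ _ _ _ _ (is_derive_great _ _ _)).
- exact: (@ex_derive _ _ _ _ _ _ _ (is_derive_great _ _ _)).
have {}H : \forall u \near 0, hp (great z b (s + u)) = hp (great z' b' (s + u)).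
  by move: H; rewrite (near_shift 0) /=; apply: filterS => u; rewrite subr0 addrC.
near=> u; rewrite (great_flow _ _ z1 zb) (great_flow _ _ z1' zb').
by near: u.
Unshelve. all: by end_near. Qed.

Lemma acos_inj_cos (x y : R) : -1 <= x <= 1 -> acos x = y -> x = cos y.
Proof. by move=> hx <-; rewrite acosK // in_itv. Qed.

Lemma enorm_kdot_bound z w : inner z z = 1 -> inner w w = 1 ->
  -1 <= enorm (kdot z w) <= 1.
Proof.
move=> z1 w1; have := kdot_sphere_bound (to_sphere z1) (to_sphere w1) => /=.
move=> /andP[d0 ->]; rewrite andbT; apply: le_trans d0; lra.
Qed.

Lemma dist_ge0 (p q : KP R K n) : 0 <= dist p q.
Proof.
have [z z1 <-] := hp_surj p; have [w w1 <-] := hp_surj q.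
by rewrite dist_hp // acos_ge0 // enorm_kdot_bound.
Qed.

Lemma aligned_lift z (q : KP R K n) : inner z z = 1 -> exists w,
  [/\ inner w w = 1, hp w = q & kdot z w = cos (dist (hp z) q) *: kone].
Proof.
move=> z1; have [w w1 <-] := hp_surj q; have [a a1 aE] := kmul_enorm (kdot z w).
exists (kscale w a); split; [by rewrite inner_kscaler a1 mul1r|exact: hp_kscale|].
by rewrite kdot_kscaler aE dist_hp // acosK // in_itv /= enorm_kdot_bound.
Qed.

Lemma unit_eq z w : inner z z = 1 -> inner w w = 1 -> kdot z w = kone -> w = z.
Proof.
move=> z1 w1 zw; apply/eqP; rewrite -subr_eq0 -inner_eq0; apply/eqP.
have : inner w z = 1 by rewrite -{1}[z]kscale1 -inner_kdot zw inner_kone.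
by rewrite !innerE (innerC z w) z1 w1 => ->; ring.
Qed.

(** Lifts aligned with a lift z of [c 0] have the form cos(l|t|) z + sin(l|t|) a(t) with a(t) unit
    and horizontal. For t < 0 < u the distance l|t| + l|u| is the largest that the triangle
    inequality allows, which forces a(t) = - a(u); so a(t) depends only on the sign of t. *)
Lemma geodesic_local (c : R -> KP R K n) (l e : R) : 0 < e ->
  (forall t u, `|t| < e -> `|u| < e -> dist (c t) (c u) = l * `|t - u|) ->
  exists z b, [/\ inner z z = 1, horizontal z b &
    \forall t \near 0, c t = hp (great z b t)].
Proof.
move=> e0 cd; have [z z1 zc] := hp_surj (c 0).
have l0 : 0 <= l.
  have e2 : `|e / 2| < e by rewrite ger0_norm; lra.
  have e2' : `|0 : R| < e by rewrite normr0.
  have := dist_ge0 (c (e / 2)) (c 0); rewrite cd // subr0.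
  by rewrite pmulr_lge0 // normr_gt0; lra.
(* The second bound gives l |t| < pi / 4, so that the sine is positive for l > 0 and t nonzero; l +
   1 avoids dividing by zero speed. *)
pose e' := Num.min e (pi / 4 / (l + 1)).
have pi0 := @pi_gt0 R.
have e'0 : 0 < e' by rewrite lt_min e0 /= !divr_gt0 //; lra.
have e'e t : `|t| < e' -> `|t| < e by rewrite lt_min => /andP[].
have le' t : `|t| < e' -> l * `|t| < pi / 4.
  rewrite lt_min ltr_pdivlMr => [/andP[_ H]|]; last by lra.
  by apply: le_lt_trans H; rewrite mulrC ler_wpM2l //; lra.
have wP t : exists w, `|t| < e' ->
    [/\ inner w w = 1, hp w = c t & kdot z w = cos (l * `|t|) *: kone].
  have [te|te] := boolP (`|t| < e'); last by exists z.
  have [w [w1 wc wd]] := aligned_lift (c t) z1; exists w => _; split => //.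
  by rewrite wd zc cd ?e'e ?normr0 // sub0r normrN.
have [w {}wP] := choice wP.
have near_e' : \forall t \near (0 : R), `|t| < e' by exact: (@nbhs0_lt _ R^o).
have [l00|l_gt0] := leP l 0.
  exists z, 0; split => //; first exact: horizontal0.
  near=> t; have te : `|t| < e' by near: t; exact: near_e'.
  have [w1 <- wd] := wP t te; rewrite great_const; congr hp; apply: unit_eq => //.
  have l_eq0 : l = 0 by apply/eqP; rewrite eq_le l00.
  by rewrite wd l_eq0 mul0r cos0 scale1r.
pose a t := (sin (l * `|t|))^-1 *: (w t - cos (l * `|t|) *: z).
have aP t : t != 0 -> `|t| < e' -> [/\ 0 < sin (l * `|t|), inner (a t) (a t) = 1,
    horizontal z (a t) & w t = cos (l * `|t|) *: z + sin (l * `|t|) *: a t].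
  move=> t0 te; have [w1 wc wd] := wP t te.
  have s0 : 0 < sin (l * `|t|).
    apply: sin_gt0_pi; have := le' t te.
    have : 0 < l * `|t| by rewrite mulr_gt0 // normr_gt0.
    by move=> -> /= H; lra.
  have wz : inner (w t) z = cos (l * `|t|).
    by rewrite -[z in inner _ z]kscale1 -inner_kdot wd innerZr inner_kone mulr1.
  split => //.
  - rewrite /a !innerE (innerC z (w t)) w1 wz z1.
    have := cos2Dsin2 (l * `|t|).
    set C := cos _; set S := sin _ => CS.
    have -> : S^-1 * (S^-1 * (1 + - (C * C)) + - (C * (S^-1 * (C + - (C * 1))))) =
       (1 - C ^+ 2) / S ^+ 2 by field; exact: lt0r_neq0.
    have -> : 1 - C ^+ 2 = S ^+ 2 by lra.
    by rewrite divff // expf_neq0 // lt0r_neq0.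
  - apply/horizontalP; rewrite kdotZr kdotDr kdotNr kdotZr wd kdot_self z1 scale1r.
    by rewrite subrr scaler0.
  - by rewrite /a scalerA divff ?lt0r_neq0 // scale1r addrC subrK.
clearbody a.
have aN t u : t < 0 < u -> `|t| < e' -> `|u| < e' -> a t = - a u.
  move=> /andP[t0 u0] te ue.
  have [st at1 /horizontal_orth zat wt] := aP t (ltr0_neq0 t0) te.
  have [su au1 /horizontal_orth zau wu] := aP u (lt0r_neq0 u0) ue.
  have [wt1 ctE _] := wP t te; have [wu1 cuE _] := wP u ue.
  have := cd t u (e'e t te) (e'e u ue); rewrite -ctE -cuE dist_hp // => /acos_inj_cos.
  move=> /(_ (enorm_kdot_bound wt1 wu1)) dtu.
  have := inner_le_kdot (w t) (w u); rewrite dtu.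
  have -> : l * `|t - u| = l * `|t| + l * `|u|.
    rewrite -mulrDr; congr (_ * _).
    by rewrite ltr0_norm ?subr_lt0 ?(lt_trans t0) // ltr0_norm // gtr0_norm //; ring.
  rewrite cosD wt wu !innerE (innerC (a t) z) zat zau z1.
  set S := sin _ in st *; set S' := sin _ in su *; set C := cos _; set C' := cos _.
  rewrite !mulr0 !mulr1 !addr0 add0r => H.
  have {}H : S * S' * (1 + inner (a t) (a u)) <= 0 by lra.
  rewrite pmulr_rle0 ?mulr_gt0 // in H.
  have : inner (a t + a u) (a t + a u) <= 0.
    rewrite !innerE at1 au1 (innerC (a u)); lra.
  move=> {}H; apply/eqP; rewrite -addr_eq0 -inner_eq0 eq_le H; exact: inner_ge0.
have e2 : `|e' / 2| < e' by rewrite ger0_norm; lra.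
have e20 : 0 < e' / 2 by lra.
exists z, (l *: a (e' / 2)).
have [_ a1 za _] := aP _ (lt0r_neq0 e20) e2.
split => //; first by apply/horizontalP; rewrite kdotZr ((horizontalP _ _).1 za) scaler0.
near=> t; have te : `|t| < e' by near: t; exact: near_e'.
have [wt1 <- _] := wP t te; congr hp; rewrite greatE //.
have [t0|t0|t0] := ltgtP t 0.
- have [_ _ _ ->] := aP t (ltr0_neq0 t0) te.
  rewrite (aN t (e' / 2)) ?t0 // ltr0_norm // mulrN cosN sinN.
  by rewrite scalerN scaleNr opprK.
- have [_ _ _ ->] := aP t (lt0r_neq0 t0) te.
  rewrite gtr0_norm //; congr (_ + _ *: _).
  (* Two directions on the same side of 0 are compared through one on the other side, with two sign
     changes. *)
  have Ne2 : `|- (e' / 2)| < e' by rewrite normrN.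
  have Ne20 : - (e' / 2) < 0 by lra.
  apply: oppr_inj; rewrite -(aN (- (e' / 2))) ?Ne20 //.
  by rewrite (aN _ (e' / 2)) ?Ne20.
- rewrite t0 mulr0 cos0 sin0 scale0r addr0 scale1r.
  have [w1 _ wd] := wP t te; rewrite -t0; apply: unit_eq => //.
  by rewrite wd t0 normr0 mulr0 cos0 scale1r.
Unshelve. all: by end_near. Qed.

End ExpMap.

Section ExpMapFormula.
Context {R : realType} {K : scalars} {n : nat}.
Local Notation KK := 'rV[R]_(kdim K).
Local Notation V := 'M[R]_(n.+1, kdim K).
Implicit Types (l : KK) (a b v w z : V) (t s : R) (X : TKP R K n).

Lemma cos_norm (x : R) : cos `|x| = cos x.
Proof. by case: (ger0P x) => // _; rewrite cosN. Qed.

Lemma enorm_kone : enorm (kone : KK) = 1.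
Proof. by apply/enorm1P; exact: inner_kone. Qed.

Lemma great_geodesic z b : inner z z = 1 -> horizontal z b ->
  geodesic (fun t => hp (great z b t)).
Proof.
move=> z1 zb; exists (enorm b) => s; have b0 := enorm_ge0 b; have pi0 := @pi_gt0 R.
have b1 : 0 < enorm b + 1 by lra.
(* Two times in this window are separated by an angle below pi / 2, where the cosine is nonnegative
   and [acos] inverts it. *)
exists (pi / 4 / (enorm b + 1)) => [|t u]; first by rewrite !divr_gt0 //; lra.
rewrite !ltr_pdivlMr // => ts us.
rewrite dist_hp ?inner_great // kdot_great // enormZ enorm_kone mulr1.
have tu : enorm b * `|t - u| < pi / 2.
  have := ler_normD (t - s) (s - u); rewrite addrA subrK (distrC s u) => H.
  have := ler_wpM2l b0 H.
  have := normr_ge0 (t - s); have := normr_ge0 (u - s); nra.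
have bt0 : 0 <= enorm b * `|t - u| by rewrite mulr_ge0.
rewrite -cos_norm normrM (ger0_norm b0) distrC ger0_norm ?cosK //.
  by rewrite in_itv /= bt0 /=; lra.
by apply: cos_ge0_pihalf; apply/andP; split; lra.
Qed.

(** Connectedness of the line through calculus: the real-valued indicator of P has zero derivative
    everywhere. *)
Lemma locally_constant_prop (P : R -> Prop) :
  (forall s, \forall t \near s, P t <-> P s) -> P 0 -> forall t, P t.
Proof.
move=> Ploc P0 t; pose f s : R := `[< P s >]%:R.
have f0 s : is_derive s (1 : R) f (0 : R).
  apply: near_eq_is_derive (is_derive_cst (f s) s 1).
  near=> u; rewrite /f /cst; congr ((nat_of_bool _)%:R).
  by apply: asbool_equiv_eq; apply: iff_sym; near: u; exact: Ploc.
have : f t = f 0 by exact: is_derive_0_is_cst.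
rewrite /f (asboolT P0); case: asboolP => // _ /eqP.
by rewrite eq_sym oner_eq0.
Unshelve. all: by end_near. Qed.

(** Near each time c follows a great circle. The circles of two nearby times agree on an open
    interval, hence everywhere; so the circle is locally constant in time and therefore the same for
    all times. *)
Lemma geodesic_great (c : R -> KP R K n) : geodesic c ->
  exists z b, [/\ inner z z = 1, horizontal z b & forall t, c t = hp (great z b t)].
Proof.
move=> [l cl].
have loc s : exists zb : V * V, [/\ inner zb.1 zb.1 = 1, horizontal zb.1 zb.2 &
    \forall t \near s, c t = hp (great zb.1 zb.2 t)].
  have [e e0 ce] := cl s.
  have [|z [b [z1 zb czb]]] := @geodesic_local _ _ _ (fun t => c (t + s)) l e e0.
    move=> t u te ue; rewrite ce ?addrK //.
    by congr (_ * `|_|); rewrite opprD addrACA subrr addr0.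
  exists (great z b (- s), dgreat z b (- s)); split => /=.
  - exact: inner_great.
  - exact: horizontal_dgreat.
  move: czb; rewrite (near_shift s) /=; apply: filterS => t /=.
  by rewrite great_flow // sub0r subrK (addrC t).
have [f fP] := choice loc.
have [z1 zb c0] := fP 0.
exists (f 0).1, (f 0).2; split => // t.
have [_ _ /nbhs_singleton ->] := fP t.
apply: (@locally_constant_prop (fun s => forall t,
  hp (great (f s).1 (f s).2 t) = hp (great (f 0).1 (f 0).2 t)) _ _ t t) => // s.
have [fs1 fsb cs] := fP s.
near=> u; have [fu1 fub cu] := fP u.
have su : forall t, hp (great (f s).1 (f s).2 t) = hp (great (f u).1 (f u).2 t).
  apply: (great_agree (s := u)) => //.
  have cs' : \forall t \near u, c t = hp (great (f s).1 (f s).2 t).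
    by near: u; exact: nbhs_interior.
  by near=> r; rewrite -(near cu r) // -(near cs' r).
by split=> H r; [rewrite su H|rewrite -su H].
Unshelve. all: by end_near. Qed.

(** [exp_map] selects an endpoint by choice. A great circle is one candidate, and any other
    candidate is also a great circle, whose initial data agree with (z, b) up to a phase because the
    velocities coincide. *)
Lemma exp_map_tv z b : inner z z = 1 -> horizontal z b ->
  exp_map (tv z b) = hp (great z b 1).
Proof.
move=> z1 zb; apply: xget_unique => /=.
  exists (fun t => hp (great z b t)); split => //.
    exact: great_geodesic.
  exact: great_velocity.
move=> q [c [/geodesic_great[z' [b' [z1' zb' cE]]] cv <-]].
rewrite cE; have {cE}cE : c = (fun t => hp (great z' b' t)) by apply/funext.
have : tv z b = tv z' b'.
  have /has_velocityP[g [g1 cg gd ->]] := cv.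
  have /has_velocityP[h [h1 ch hd ->]] := great_velocity z1' zb'.
  apply: velocity_unique => //; rewrite cE in cg.
  by near=> t; rewrite -(near ch t) // -(near cg t).
move/(tv_eq z1 zb z1' zb') => [k k1 [-> ->]].
by rewrite great_kscale // hp_kscale // inner_great.
Unshelve. all: by end_near. Qed.

Lemma tscale_tv t z v : inner z z = 1 -> horizontal z v ->
  tscale t (tv z v) = tv z (t *: v).
Proof.
move=> z1 zv; rewrite /tscale -tv_val /=.
set r := repr _; have [r1 rh] := hbundleP r.
have : tv z v = tv (val r).1 (val r).2 by rewrite tv_val /tvec reprK.
move/(tv_eq z1 zv r1 rh) => [k k1 [-> ->]].
have sc (a : V) : horizontal z a -> horizontal z (t *: a).
  by move=> /horizontalP h; apply/horizontalP; rewrite kdotZr h scaler0.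
apply/esym/tv_eq => //; first exact: sc.
- by rewrite inner_kscaler k1 mul1r.
- by rewrite -kscaleZl; apply: horizontal_kscale => //; exact: sc.
- by exists k; rewrite // kscaleZl.
Qed.

Lemma exp_map_tscale t z a : inner z z = 1 -> horizontal z a -> inner a a = 1 ->
  exp_map (tscale t (tv z a)) = hp (cos t *: z + sin t *: a).
Proof.
move=> z1 za a1; rewrite tscale_tv // exp_map_tv ?greatE ?mulr1 //.
by apply/horizontalP; rewrite kdotZr ((horizontalP _ _).1 za) scaler0.
Qed.

End ExpMapFormula.

(** * The model hypersurfaces *)

Section Model.
Context {R : realType} {K : scalars} {n : nat} (k : nat).
Local Notation KK := 'rV[R]_(kdim K).
Local Notation V := 'M[R]_(n.+1, kdim K).
Implicit Types (l : KK) (z w v : V).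

Lemma uvpartD z : upart k z + vpart k z = z.
Proof. by apply/matrixP => i j; rewrite !mxE; case: ifP; rewrite ?addr0 ?add0r. Qed.

Lemma upart_kscale z l : upart k (kscale z l) = kscale (upart k z) l.
Proof.
apply/row_matrixP => i; rewrite row_kscale.
have rowu w : row i (upart k w) = if (i <= k)%N then row i w else 0.
  by apply/rowP => j; rewrite !mxE; case: ifP; rewrite !mxE.
by rewrite !rowu row_kscale; case: ifP => // _; rewrite kmul0l.
Qed.

Lemma vpart_kscale z l : vpart k (kscale z l) = kscale (vpart k z) l.
Proof.
apply: (addrI (upart k (kscale z l))); rewrite uvpartD upart_kscale -kscaleDl.
by rewrite uvpartD.
Qed.

Lemma vpartD z w : vpart k (z + w) = vpart k z + vpart k w.
Proof. by apply/matrixP => i j; rewrite !mxE; case: ifP; rewrite ?addr0. Qed.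

Lemma vpartZ (x : R) z : vpart k (x *: z) = x *: vpart k z.
Proof. by apply/matrixP => i j; rewrite !mxE; case: ifP; rewrite ?mulr0. Qed.

Lemma inner_uv z w : inner (upart k z) (vpart k w) = 0.
Proof.
rewrite /inner big1 // => i _; rewrite big1 // => j _.
by rewrite !mxE; case: ifP; rewrite ?mulr0 ?mul0r.
Qed.

Lemma inner_uvpart z w :
  inner z w = inner (upart k z) (upart k w) + inner (vpart k z) (vpart k w).
Proof.
rewrite -{1}(uvpartD z) -{1}(uvpartD w) !innerE inner_uv (innerC (vpart k z)) inner_uv.
by rewrite !addr0 add0r.
Qed.

Lemma vpart_upart z : vpart k (upart k z) = 0.
Proof. by apply/matrixP => i j; rewrite !mxE; case: ifP => // ->. Qed.

Lemma upart_id z : vpart k z = 0 -> upart k z = z.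
Proof. by move=> z0; rewrite -[RHS]uvpartD z0 addr0. Qed.

Lemma clifford_hp z : inner z z = 1 ->
  (clifford R K n k (hp z) <->
   inner (upart k z) (upart k z) = inner (vpart k z) (vpart k z)).
Proof.
move=> z1; rewrite -(to_sphereK z1) /clifford /=; split.
  move=> [w /esym/hopfP[l l1 /= wE]]; rewrite wE upart_kscale vpart_kscale.
  move/(congr1 (fun x => x ^+ 2)); rewrite !enorm_sqr !inner_kscaler l1.
  by rewrite !mul1r.
by move=> H; exists (to_sphere z1) => //=; rewrite /enorm H.
Qed.

Lemma projective_subspace_hp z : inner z z = 1 ->
  (projective_subspace R K n k (hp z) <-> vpart k z = 0).
Proof.
move=> z1; rewrite -(to_sphereK z1) /projective_subspace /=; split.
  move=> [w /hopfP[l l1 /= zE] w0]; rewrite zE vpart_kscale w0 kscale0l //.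
by move=> H; exists (to_sphere z1).
Qed.

(** Against points of the subspace only the part u of z is seen, so [kdot] is bounded by |u|; the
    bound is attained at the normalized u. *)
Lemma dist_projective_subspace z : inner z z = 1 ->
  inf [set dist (hp z) q | q in projective_subspace R K n k] =
    acos (enorm (upart k z)).
Proof.
move=> z1.
have u1 : enorm (upart k z) <= 1.
  rewrite -[leRHS]sqrtr1; apply: ler_wsqrtr; rewrite -z1 (inner_uvpart z z).
  by rewrite lerDl inner_ge0.
have ub : -1 <= enorm (upart k z) <= 1.
  by rewrite u1 andbT (le_trans _ (enorm_ge0 _)) //; lra.
have kd w : vpart k w = 0 -> kdot z w = kdot (upart k z) w.
  move=> w0; apply: kdotP => l; rewrite inner_kdot [LHS]inner_uvpart [RHS]inner_uvpart.
  by rewrite w0 !inner0l !upart_kscale (upart_id (vpart_upart z)).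
apply: inf_min => /= [|_ [q Lq <-]]; last first.
  have [w w1 wE] := hp_surj q; rewrite -wE in Lq *.
  rewrite dist_hp //; apply: ler_acos => //; first exact: enorm_kdot_bound.
  rewrite kd; last exact/(projective_subspace_hp w1).
  rewrite /enorm; apply: ler_wsqrtr; apply: le_trans (kdot_le _ _) _.
  by rewrite w1 mulr1.
(* If u = 0, all points of the subspace are at distance acos 0, and a basis point serves. *)
have [u0|u0] := eqVneq (upart k z) 0.
  pose e : V := \matrix_(i, j) ((i == 0) && (val j == 0%N))%:R.
  have e1 : inner e e = 1 := unit_vector_subproof.
  have e0 : vpart k e = 0.
    apply/matrixP => i j; rewrite !mxE; case: ifPn => // ik.
    by case: eqP => // i0; move: ik; rewrite i0.
  exists (hp e); first exact/(projective_subspace_hp e1).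
  rewrite dist_hp // kd // u0; congr acos.
  by have := kdotZl 0 e 0; rewrite !scale0r => ->; rewrite /enorm !inner0l.
have eu0 : 0 < enorm (upart k z) by rewrite sqrtr_gt0 inner_gt0.
pose w := (enorm (upart k z))^-1 *: upart k z.
have w1 : inner w w = 1.
  by rewrite !innerE -enorm_sqr; field; exact: lt0r_neq0.
have w0 : vpart k w = 0 by rewrite vpartZ vpart_upart scaler0.
exists (hp w); first exact/(projective_subspace_hp w1).
rewrite dist_hp // kd // kdotZr kdot_self -enorm_sqr scalerA enormZ enorm_kone mulr1.
by congr acos; rewrite expr2 mulrA mulVf ?lt0r_neq0 // mul1r ger0_norm ?enorm_ge0.
Qed.

Lemma cos_pi4_sqr : cos (pi / 4) ^+ 2 = 1 / 2 :> R.
Proof.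
have := cosD (pi / 4) (pi / 4 : R); have := cos2Dsin2 (pi / 4 : R).
have -> : pi / 4 + pi / 4 = pi / 2 :> R by field.
rewrite cos_pihalf -!expr2 => *; lra.
Qed.

(** Since |u|^2 + |v|^2 = 1, the equation |u| = |v| means |u|^2 = 1 / 2 = cos^2 (pi / 4). *)
Lemma clifford_tube :
  clifford R K n k = tube (pi / 4) (projective_subspace R K n k).
Proof.
have pi0 := @pi_gt0 R.
apply/seteqP; split => p; have [z z1 <-] := hp_surj p; rewrite /tube /=.
  move/(clifford_hp z1) => uv; rewrite dist_projective_subspace //.
  rewrite -[RHS]cosK; last by rewrite in_itv /=; apply/andP; split; lra.
  congr acos; apply/eqP; rewrite -(eqrXn2 (ltn0Sn 1)) ?enorm_ge0 //; last first.
    by apply: cos_ge0_pihalf; apply/andP; split; lra.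
  rewrite enorm_sqr cos_pi4_sqr; apply/eqP.
  by have := inner_uvpart z z; rewrite z1 -uv; lra.
rewrite dist_projective_subspace // => up; apply/(clifford_hp z1).
have ub : -1 <= enorm (upart k z) <= 1.
  rewrite (le_trans _ (enorm_ge0 _)) /=; last by lra.
  rewrite -[leRHS]sqrtr1; apply: ler_wsqrtr; rewrite -z1 (inner_uvpart z z).
  by rewrite lerDl inner_ge0.
have := acos_inj_cos ub up => /(congr1 (fun x => x ^+ 2)).
rewrite enorm_sqr cos_pi4_sqr.
by have := inner_uvpart z z; rewrite z1; lra.
Qed.

(** The vanishing of the second component is a K-linear condition: it passes to derivatives, to
    horizontal projections and to the points of the great circle. *)
Lemma totally_geodesic_projective : totally_geodesic (projective_subspace R K n k).
Proof.
move=> X [c [/has_velocityP[g [g1 cg gd ->]] Lc]] t.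
have g0 : \forall s \near 0, vpart k (g s) = 0.
  by near=> s; apply/(projective_subspace_hp (g1 s)); rewrite -(near cg s) //; near: s.
have /derivableP/is_derive_mxP gij := gd.
have Dg0 : vpart k ('D_1 g 0) = 0.
  apply/matrixP => i j; rewrite !mxE; case: ifPn => // ik.
  have g0ij : \forall s \near 0, (cst 0 : R -> R) s = g s i j.
    near=> s; rewrite /cst.
    have /matrixP/(_ i j) : vpart k (g s) = 0 by near: s.
    by rewrite !mxE (negPf ik).
  have d0 := near_eq_is_derive g0ij (is_derive_cst (0 : R) (0 : R) (1 : R)).
  have e1 := @derive_val _ _ _ _ _ _ _ (gij i j).
  by rewrite -e1 (@derive_val _ _ _ _ _ _ _ d0).
have vg0 := nbhs_singleton g0; have g01 := g1 0.
have hh := horizontal_hproj ('D_1 g 0) g01.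
have th : horizontal (g 0) (t *: hproj (g 0) ('D_1 g 0)).
  by apply/horizontalP; rewrite kdotZr ((horizontalP _ _).1 hh) scaler0.
rewrite tscale_tv // exp_map_tv //.
apply/projective_subspace_hp; first exact: inner_great.
rewrite /great vpartD !vpartZ vg0 scaler0 add0r hprojE vpartD Dg0 add0r.
by rewrite -scaleN1r vpartZ vpart_kscale vg0 kscale0l !scaler0.
Unshelve. all: by end_near. Qed.

End Model.

(** * Diagonalization of K-linear symmetric involutions *)

Section Dimension.
Context {R : fieldType}.

Lemma linear_kernel (aT rT : vectType R) (f : aT -> rT) : linear f ->
  (dim rT < dim aT)%N -> exists2 v, v != 0 & f v = 0.
Proof.
move=> fl; pose g : {linear aT -> rT} := HB.pack f (GRing.isLinear.Build _ _ _ _ f fl).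
move=> rTaT; have := limg_ker_dim (linfun g) fullv.
rewrite dimvf capfv => kd.
have k0 : (0 < \dim (lker (linfun g)))%N.
  rewrite lt0n; apply/eqP => k0; have := dimvS (subvf (limg (linfun g))).
  by rewrite dimvf -[X in (X <= _)%N]add0n -k0 kd leqNgt rTaT.
have [v vk v0] : exists2 v, v \in lker (linfun g) & v != 0.
  exists (vpick (lker (linfun g))); first exact: memv_pick.
  by rewrite vpick0 -dimv_eq0 -lt0n.
by exists v => //; move: vk; rewrite memv_ker lfunE => /eqP.
Qed.

Lemma linear_surj (aT rT : vectType R) (f : aT -> rT) : linear f ->
  dim aT = dim rT -> (forall v, f v = 0 -> v = 0) -> forall w, exists v, f v = w.
Proof.
move=> fl; pose g : {linear aT -> rT} := HB.pack f (GRing.isLinear.Build _ _ _ _ f fl).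
move=> aTrT f0 w; have := limg_ker_dim (linfun g) fullv.
rewrite dimvf capfv.
have -> : lker (linfun g) = 0%VS.
  apply/eqP; rewrite -subv0; apply/subvP => v; rewrite memv_ker lfunE => /eqP /f0 ->.
  exact: mem0v.
rewrite dimv0 add0n => d.
have : w \in limg (linfun g).
  suff -> : limg (linfun g) = fullv by exact: memvf.
  by apply/eqP; rewrite eqEdim subvf d dimvf aTrT /=.
by move=> /memv_imgP[v _ ->]; exists v; rewrite lfunE.
Qed.

End Dimension.

Section Diagonalization.
Context {R : realType} {K : scalars} {n : nat}.
Local Notation KK := 'rV[R]_(kdim K).
Local Notation V := 'M[R]_(n.+1, kdim K).
Implicit Types (l : KK) (f u v w z : V) (s P Q : seq V).

Definition unitary (B : V -> V) : Prop :=
  [/\ forall z w, kdot (B z) (B w) = kdot z w,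
      forall z l, B (kscale z l) = kscale (B z) l & forall w, exists z, B z = w].

Definition orthonormal s : bool :=
  all (fun f => inner f f == 1) s && pairwise (fun f g => kdot f g == 0) s.

(** A real dimension count, valid for both choices of K: each vector of s imposes [kdim K] real
    equations. *)
Lemma exists_orthogonal s : (size s < n.+1)%N ->
  exists2 w : V, w != 0 & {in s, forall f, kdot f w = 0}.
Proof.
move=> sn; pose F (w : V) : 'M[R]_(size s, kdim K) :=
  \matrix_(i, j) kdot (nth 0 s i) w 0 j.
have Fl : linear F.
  by move=> a x y; apply/matrixP => i j; rewrite !mxE innerDl innerZl.
have dimlt : (dim 'M[R]_(size s, kdim K) < dim V)%N.
  by rewrite !dim_matrix ltn_pmul2r // ; case: (K).
have [w w0 Fw] := linear_kernel Fl dimlt.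
exists w => // f fs; apply/rowP => j.
have fi : (index f s < size s)%N by rewrite index_mem.
by have /matrixP/(_ (Ordinal fi) j) := Fw; rewrite !mxE /= nth_index.
Qed.

Lemma kdotC0 z w : kdot z w = 0 -> kdot w z = 0.
Proof. by rewrite kdotC => zw; rewrite -(kconjK (kdot w z)) zw kconj0. Qed.

Lemma kdot_rows z w : kdot z w = \sum_i kmul (kconj (row i z)) (row i w).
Proof.
apply: kdotP => l; rewrite innerC inner_sum [RHS]inner_rows; apply: eq_bigr => i _.
by rewrite row_kscale inner_kmulr kconjK.
Qed.

Section Operator.
Variable T : V -> V.
Hypotheses (Tl : linear T) (TK : forall z l, T (kscale z l) = kscale (T z) l)
  (Tsym : forall u v, inner (T u) v = inner u (T v)) (T2 : forall z, T (T z) = z).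

Lemma op_kdot z w : kdot (T z) w = kdot z (T w).
Proof. by apply: kdotP => l; rewrite inner_kdot Tsym TK. Qed.

Let TD := linear_add Tl.
Let T0 := linear_zero Tl.
Let TZ := linear_scale Tl.

(** A vector w orthogonal to the eigenvectors found so far has T w orthogonal to them as well.
    Either w + T w is a new eigenvector for 1, or it is zero and w is one for -1. *)
Lemma orthonormal_eigenvectors p : (p <= n.+1)%N -> exists P Q,
  [/\ (size P + size Q = p)%N, orthonormal (P ++ Q), {in P, forall f, T f = f} &
      {in Q, forall f, T f = - f}].
Proof.
elim: p => [|p IHp] pn; first by exists [::], [::].
have [P [Q [PQp /andP[un pw] TP TQ]]] := IHp (ltnW pn).
have [|w w0 wo] := @exists_orthogonal (P ++ Q); first by rewrite size_cat PQp.
have wo' : {in P ++ Q, forall f, kdot f (T w) = 0}.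
  move=> f fPQ; rewrite -op_kdot; move: (fPQ); rewrite mem_cat => /orP[/TP ->|/TQ ->].
    exact: wo.
  by rewrite kdotNl wo // oppr0.
have [v0|v0] := eqVneq (w + T w) 0.
  exists P, ((enorm w)^-1 *: w :: Q); split.
  - by rewrite /= addnS PQp.
  - move: un pw; rewrite /orthonormal !all_cat !pairwise_cat.
    move=> /andP[-> /= ->] /and3P[PQ -> ->].
    rewrite allrel_consr PQ inner_normalize // eqxx !andbT /=.
    apply/andP; split; apply/allP => f fPQ.
      by rewrite kdotZr wo ?scaler0 // mem_cat fPQ.
    by rewrite kdotZl (kdotC0 (wo f _)) ?scaler0 // mem_cat fPQ orbT.
  - by [].
  - move=> f; rewrite inE => /orP[/eqP ->|/TQ //].
    by rewrite TZ -scalerN; congr (_ *: _); apply/eqP; rewrite -addr_eq0 addrC v0.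
exists ((enorm (w + T w))^-1 *: (w + T w) :: P), Q; split.
- by rewrite /= addSn PQp.
- rewrite /orthonormal cat_cons pairwise_cons /= inner_normalize // eqxx un pw /=.
  rewrite andbT; apply/allP => f fPQ; rewrite kdotZl kdotDl (kdotC0 (wo f _)) ?(kdotC0 (wo' f _)) //.
  by rewrite addr0 scaler0.
- move=> f; rewrite inE => /orP[/eqP ->|/TP //].
  by rewrite TZ TD T2 addrC.
- by [].
Qed.

(** The rows of B z are the coordinates of z in an orthonormal eigenbasis that lists the eigenvalue
    1 first; the inverse C of B assembles a vector from its coordinates. The vectors a and b keep
    both blocks nonempty, which yields a valid k with k < n. *)
Lemma diagonalize a b : a != 0 -> T a = a -> b != 0 -> T b = - b ->
  exists (B : V -> V) (k : nat), [/\ (k < n)%N, unitary B &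
    forall z, inner (T z) z = inner (upart k (B z)) (upart k (B z)) -
                              inner (vpart k (B z)) (vpart k (B z))].
Proof.
move=> a0 Ta b0 Tb.
have [P [Q [PQn /andP[/allP un pw] TP TQ]]] := orthonormal_eigenvectors (leqnn n.+1).
pose f (i : 'I_n.+1) := nth 0 (P ++ Q) i.
have sPQ : size (P ++ Q) = n.+1 by rewrite size_cat.
have f1 i : inner (f i) (f i) = 1.
  by apply/eqP/un; rewrite mem_nth // sPQ.
have f0 i j : i != j -> kdot (f i) (f j) = 0.
  have lt0 (i' j' : 'I_n.+1) : (i' < j')%N -> kdot (f i') (f j') = 0.
    move=> ij; apply/eqP; have /(pairwiseP 0) := pw; apply => //;
    by rewrite inE sPQ ltn_ord.
  by rewrite neq_ltn => /orP[/lt0 //|/lt0 /kdotC0].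
pose C (w : V) : V := \sum_i kscale (f i) (row i w).
have kdot_suml (I : finType) (g : I -> V) z : kdot (\sum_i g i) z = \sum_i kdot (g i) z.
  elim/big_rec2: _ => [|i x y _ <-]; last by rewrite kdotDl.
  by have := kdotZl 0 z 0; rewrite !scale0r.
have kdot_sumr (I : finType) (g : I -> V) z : kdot z (\sum_i g i) = \sum_i kdot z (g i).
  elim/big_rec2: _ => [|i x y _ <-]; last by rewrite kdotDr.
  by have := kdotZr 0 z 0; rewrite !scale0r.
have fC i w : kdot (f i) (C w) = row i w.
  rewrite kdot_sumr (bigD1 i) //= big1 => [|j ji]; last first.
    by rewrite kdot_kscaler f0 ?kmul0l // eq_sym.
  by rewrite addr0 kdot_kscaler kdot_self f1 scale1r kmul1r.
have Cdot z w : kdot (C z) (C w) = kdot z w.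
  rewrite [C z]/C kdot_suml kdot_rows; apply: eq_bigr => i _.
  by rewrite kdot_kscalel fC.
have Cl : linear C.
  move=> x z w; rewrite /C scaler_sumr -big_split; apply: eq_bigr => i _ /=.
  by rewrite rowD rowZ kscaleDr kscaleZr.
have inner_kone_dot (z w : V) : inner z w = inner kone (kdot w z).
  by rewrite inner_kdot kscale1.
have Cinner z w : inner (C z) (C w) = inner z w by rewrite !inner_kone_dot Cdot.
have Csurj w : exists z, C z = w.
  apply: linear_surj => // z Cz; apply: inner_eq0P.
  by rewrite -Cinner Cz inner0l.
pose B (z : V) : V := \matrix_(i, j) kdot (f i) z 0 j.
have rowB i z : row i (B z) = kdot (f i) z by apply/rowP => j; rewrite !mxE.
have BC w : B (C w) = w by apply/row_matrixP => i; rewrite rowB fC.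
have CB z : C (B z) = z by have [w <-] := Csurj z; rewrite BC.
have TC w : T (C w) = \sum_(i < n.+1)
    (if (i < size P)%N then kscale (f i) (row i w) else - kscale (f i) (row i w)).
  have -> : T (C w) = \sum_i T (kscale (f i) (row i w)).
    by rewrite /C; elim/big_rec2: _ => // i x y _ <-; rewrite TD.
  apply: eq_bigr => i _; rewrite TK /f nth_cat; case: ifP => iP.
    by rewrite TP // mem_nth.
  rewrite TQ ?kscaleNl // mem_nth //.
  by rewrite ltn_subLR ?PQn // leqNgt iP.
have P0 : (0 < size P)%N.
  rewrite lt0n; apply: contra a0 => /eqP P0; rewrite -(CB a).
  have : T (C (B a)) = - C (B a).
    by rewrite TC P0 /= sumrN.
  by rewrite CB Ta => /eqP; rewrite -addr_eq0 -mulr2n -scaler_nat scaler_eq0 pnatr_eq0.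
have Pn : (size P < n.+1)%N.
  rewrite ltnNge; apply: contra b0 => Pn; rewrite -(CB b).
  have : T (C (B b)) = C (B b).
    by rewrite TC; apply: eq_bigr => i _; rewrite (leq_trans (ltn_ord i) Pn).
  rewrite CB Tb => /esym/eqP.
  by rewrite -addr_eq0 -mulr2n -scaler_nat scaler_eq0 pnatr_eq0.
(* [upart] keeps the indices up to k inclusive, hence the predecessor. *)
exists B, (size P).-1; split.
- by rewrite -ltnS prednK.
- split=> [z w|z l|w]; last by exists (C w).
    by rewrite -Cdot !CB.
  by apply/row_matrixP => i; rewrite rowB row_kscale rowB kdot_kscaler.
move=> z; set k := (size P).-1.
have -> : T z = C (upart k (B z) - vpart k (B z)).
  rewrite -{1}(CB z) TC /C; apply: eq_bigr => i _.
  have -> : (i < size P)%N = (i <= k)%N by rewrite -[in RHS]ltnS /k prednK.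
  case: ifPn => ik; rewrite -?kscaleNr; congr kscale; apply/rowP => j;
    by rewrite !mxE ?ik ?(negPf ik) ?subr0 ?sub0r.
rewrite -[X in inner _ X](CB z) Cinner -[X in inner _ X](uvpartD k (B z)).
rewrite !innerE inner_uv.
by rewrite (innerC (vpart k _) (upart k _)) inner_uv oppr0 !addr0 add0r.
Qed.

End Operator.
End Diagonalization.

(** * Symmetry of second derivatives *)

Section Schwarz.
Context {R : realType} {E : normedModType R}.

Lemma is_derive_line {W : normedModType R} (f : E -> W) (h y : E) (t : R) (d : W) :
  is_derive (t *: h + y) h f d -> is_derive t (1 : R) (fun s : R => f (s *: h + y)) d.
Proof.
move=> /is_deriveP H; apply/is_deriveP; apply: cvg_trans H.
apply: near_eq_cvg; near=> e; congr (_ *: (f _ - _)).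
by rewrite [e *: 1]mulr1 scalerDl addrA.
Unshelve. all: by end_near. Qed.

Lemma is_derive_continuous {W : normedModType R} (f : R -> W) (t : R) (d : W) :
  is_derive t (1 : R) f d -> {for t, continuous f}.
Proof. by move=> [fd _]; apply: differentiable_continuous; exact/derivable1_diffP. Qed.

Lemma mvt_line (f df : E -> R) (y h : E) (s : R) : 0 < s ->
  (forall t, 0 <= t <= s -> is_derive (t *: h + y) h f (df (t *: h + y))) ->
  exists2 t, 0 < t < s & f (s *: h + y) - f y = df (t *: h + y) * s.
Proof.
move=> s0 fd; pose g (t : R) := f (t *: h + y).
have gd t : 0 <= t <= s -> is_derive t (1 : R) g (df (t *: h + y)).
  by move=> /fd; exact: is_derive_line.
have [||c] := @MVT _ g (fun t => df (t *: h + y)) 0 s s0.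
- move=> t; rewrite in_itv /= => /andP[t0 ts]; apply: gd.
  by rewrite !ltW.
- apply: continuous_in_subspaceT => t; rewrite inE /= in_itv /= => ts.
  exact: is_derive_continuous (gd t ts).
rewrite in_itv /= subr0 => cs ge; exists c => //.
by rewrite -ge /g scale0r add0r.
Qed.

(** The mean value theorem, applied in direction h to the increment of f by s k and then in
    direction k to D1, turns the second difference into s^2 times D2 at a nearby point. *)
Lemma schwarz_aux (W : set E) (f D1 D2 : E -> R) (x h k : E) : open W -> W x ->
  (forall y, W y -> is_derive y h f (D1 y)) ->
  (forall y, W y -> is_derive y k D1 (D2 y)) ->
  {for x, continuous D2} -> forall e, 0 < e ->
  \forall s \near (0 : R)^'+, `|(f (s *: h + (s *: k + x)) - f (s *: h + x) -
       f (s *: k + x) + f x) / s ^+ 2 - D2 x| < e.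
Proof.
move=> Wo Wx fd fdd fc e e0.
have /nbhs_ballP[r /= r0 rW] : nbhs x (W `&` [set y | `|D2 y - D2 x| < e]).
  apply: filterI; first exact: open_nbhs_nbhs.
  have /cvgrPdist_lt/(_ e e0) := fc.
  by apply: filterS => y; rewrite /= distrC.
have hk0 : 0 < `|h| + `|k| + 1 by have := normr_ge0 h; have := normr_ge0 k; lra.
have near_small t u s : 0 <= t <= s -> 0 <= u <= s -> s < r / (`|h| + `|k| + 1) ->
    W (t *: h + (u *: k + x)) /\ `|D2 (t *: h + (u *: k + x)) - D2 x| < e.
  move=> /andP[t0 ts] /andP[u0 us]; rewrite ltr_pdivlMr // => sr.
  apply: rW; rewrite -ball_normE /ball_ /= addrA opprD addrCA subrr addr0 normrN.
  apply: le_lt_trans (ler_normD _ _) _; rewrite !normrZ !ger0_norm //.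
  have := ler_wpM2r (normr_ge0 h) ts; have := ler_wpM2r (normr_ge0 k) us.
  have : 0 <= s by lra.
  by lra.
near=> s.
have s0 : 0 < s by near: s; exact: nbhs_right_gt.
have sr : s < r / (`|h| + `|k| + 1).
  by near: s; apply: nbhs_right_lt; rewrite divr_gt0.
have s00 : 0 <= (0 : R) <= s by rewrite lexx ltW.
have sss : 0 <= s <= s by rewrite lexx ltW.
pose g (y : E) := f (s *: k + y) - f y.
have gd t : 0 <= t <= s -> is_derive (t *: h + x) h g
    (D1 (s *: k + (t *: h + x)) - D1 (t *: h + x)).
  move=> ts.
  have d1 : is_derive (t *: h + x) h f (D1 (t *: h + x)).
    apply/fd; have [] := near_small t 0 s ts s00 sr.
    by rewrite scale0r add0r.
  have d2 : is_derive (s *: k + (t *: h + x)) h f (D1 (s *: k + (t *: h + x))).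
    by apply/fd; rewrite addrCA; have [] := near_small t s s ts sss sr.
  apply/is_deriveP; have /is_deriveP c1 := d1; have /is_deriveP c2 := d2.
  apply: cvg_trans (cvgB c2 c1); apply: near_eq_cvg; near=> u.
  rewrite /g fctE -scalerBr; congr (_ *: _).
  rewrite [u *: h + (s *: k + _)]addrCA; ring.
have [t ts gE] := @mvt_line g (fun y => D1 (s *: k + y) - D1 y) _ _ _ s0 gd.
have ts' : 0 <= t <= s by case/andP: ts => *; rewrite !ltW.
have [u us DE] : exists2 u, 0 < u < s & D1 (s *: k + (t *: h + x)) - D1 (t *: h + x) =
    D2 (u *: k + (t *: h + x)) * s.
  apply: mvt_line => // u us; apply: fdd; rewrite addrCA.
  by have [] := near_small t u s ts' us sr.
have us' : 0 <= u <= s by case/andP: us => *; rewrite !ltW.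
have [_] := near_small t u s ts' us' sr; rewrite addrCA.
rewrite DE /g in gE.
have -> : f (s *: h + (s *: k + x)) - f (s *: h + x) - f (s *: k + x) + f x =
   f (s *: k + (s *: h + x)) - f (s *: h + x) - (f (s *: k + x) - f x).
  by rewrite addrCA; ring.
rewrite gE [X in `|X - _| < e -> _](_ : _ = D2 (u *: k + (t *: h + x)) * s * s / s ^+ 2) //.
by field; exact: lt0r_neq0.
Unshelve. all: by end_near. Qed.

Lemma near_right_ex2 (P Q : R -> Prop) : (\forall s \near (0 : R)^'+, P s) ->
  (\forall s \near (0 : R)^'+, Q s) -> exists s, P s /\ Q s.
Proof.
move=> HP HQ; near (0 : R)^'+ => s; exists s; split; near: s; [exact: HP|exact: HQ].
Unshelve. all: by end_near. Qed.

Lemma close_half (e a u v : R) :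
  `|a - u| < e / 2 -> `|a - v| < e / 2 -> `|u - v| <= 0 + e.
Proof.
rewrite (distrC a u) => au av; have := ler_normD (u - a) (a - v).
by rewrite addrA subrK; lra.
Qed.

(** The second difference is symmetric in h and k, so for one small s its quotient by s^2 is close
    to both mixed derivatives. *)
Lemma schwarz_real (W : set E) (f : E -> R) (x h k : E) : open W -> W x ->
  (forall y v, W y -> derivable f y v) ->
  (forall y v w, W y -> derivable ('D_v f) y w) ->
  (forall v w, {for x, continuous ('D_w ('D_v f))}) ->
  'D_k ('D_h f) x = 'D_h ('D_k f) x.
Proof.
move=> Wo Wx fd fdd fc; apply/eqP; rewrite -subr_eq0 -normr_le0; apply/ler_addgt0Pr => e e0.
have e2 : 0 < e / 2 by rewrite divr_gt0.
have H1 := schwarz_aux Wo Wx (fun y Wy => derivableP (fd y h Wy))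
  (fun y Wy => derivableP (fdd y h k Wy)) (fc h k) e2.
have H2 := schwarz_aux Wo Wx (fun y Wy => derivableP (fd y k Wy))
  (fun y Wy => derivableP (fdd y k h Wy)) (fc k h) e2.
have [s [s1 s2]] := near_right_ex2 H1 H2.
apply: (close_half s1).
move: s2.
have -> : f (s *: k + (s *: h + x)) - f (s *: k + x) - f (s *: h + x) + f x =
  f (s *: h + (s *: k + x)) - f (s *: h + x) - f (s *: k + x) + f x.
  by rewrite [s *: k + (s *: h + x)]addrCA; ring.
exact.
Qed.

End Schwarz.

Section SecondOrder.
Context {R : realType} {E : normedModType R} {m p : nat}.
Local Notation V := 'M[R]_(m, p).

Definition second_order (W : set E) (f : E -> V) (df : E -> E -> V)
    (ddf : E -> E -> E -> V) : Prop :=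
  [/\ forall y h, W y -> is_derive y h f (df y h),
      forall y, W y -> linear (df y),
      forall y h k, W y -> is_derive y k (fun x => df x h) (ddf y h k) &
      forall y h k, W y -> ddf y h k = ddf y k h].

Lemma is_derive_unique {W : normedModType R} (f : E -> W) y h a b :
  is_derive y h f a -> is_derive y h f b -> a = b.
Proof. by move=> [_ <-] [_ <-]. Qed.

Lemma near_continuous (T : topologicalType) (U : Type) (f g : E -> T) (x : E) :
  (\forall y \near x, f y = g y) -> {for x, continuous f} -> {for x, continuous g}.
Proof.
move=> fg fc; rewrite /prop_for /continuous_at -(nbhs_singleton fg).
apply: cvg_trans fc; apply: near_eq_cvg; exact: fg.
Qed.

Lemma smooth_differentiable {W' : normedModType R} (W : set E) (f : E -> W') y :
  smooth W f -> W y -> differentiable f y.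
Proof. by move=> fs Wy; have [fd _] := fs 1; exact: fd. Qed.

Lemma is_derive_linear {V1 V2 : normedModType R} (L : V1 -> V2) (f : E -> V1) y h d :
  linear L -> continuous L -> is_derive y h f d -> is_derive y h (L \o f) (L d).
Proof.
move=> Ll Lc /is_deriveP fd; apply/is_deriveP.
have LZ := linear_scale Ll.
have LB u w : L (u - w) = L u - L w by rewrite (linear_add Ll) (linear_opp Ll).
have := cvg_comp _ _ fd (Lc d); apply: cvg_trans; apply: near_eq_cvg.
by near=> t; rewrite /= LZ LB.
Unshelve. all: by end_near. Qed.

(** The map L extracts z or v from a single smooth lift of the normal field into the pairs (z,
    v). *)
Lemma smooth_second_order {V' : normedModType R} (W : set E) (f : E -> V') (L : V' -> V) :
  linear L -> continuous L -> open W -> smooth W f ->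
  second_order W (L \o f) (fun y h => L ('D_h f y)) (fun y h k => L ('D_k ('D_h f) y)).
Proof.
move=> Ll Lc Wo fs; have [fd1 /= fd2] := fs 2.
have f1 y h : W y -> is_derive y h (L \o f) (L ('D_h f y)).
  by move=> Wy; apply: is_derive_linear => //; apply/derivableP/diff_derivable/fd1.
have f2 y h k : W y -> is_derive y k (fun x => L ('D_h f x)) (L ('D_k ('D_h f) y)).
  move=> Wy; apply: (@is_derive_linear _ _ L ('D_h f)) => //.
  by apply/derivableP/diff_derivable/(fd2 h).1.
have fc y h k : W y -> {for y, continuous (fun x => L ('D_k ('D_h f) x))}.
  move=> Wy; have c := (fd2 h).2 k y Wy.
  exact: (cvg_comp _ _ c (Lc _)).
split=> [//|y Wy a h k|//|y h k Wy].
  by rewrite !deriveE ?linearP ?Ll //; exact: fd1.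
apply/matrixP => i j; pose fij x := L (f x) i j.
have g1 x v : W x -> is_derive x v fij (L ('D_v f x) i j).
  by move=> Wx; have /is_derive_mxP := f1 x v Wx; exact.
have g2 x v w : W x -> is_derive x w ('D_v fij) (L ('D_w ('D_v f) x) i j).
  move=> Wx; have /is_derive_mxP/(_ i j) := f2 x v w Wx; apply: near_eq_is_derive.
  have Wn : \forall u \near x, W u by exact: open_nbhs_nbhs.
  by near=> u; apply/esym; apply: (@derive_val _ _ _ _ _ _ _ (g1 u v _)); near: u.
have E1 := @derive_val _ _ _ _ _ _ _ (g2 y h k Wy).
have E2 := @derive_val _ _ _ _ _ _ _ (g2 y k h Wy).
suff S : 'D_k ('D_h fij) y = 'D_h ('D_k fij) y.
  exact: (etrans (esym E1) (etrans S E2)).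
apply: (@schwarz_real R E W fij y h k Wo Wy).
- by move=> x v /g1 H; exact: ex_derive.
- by move=> x v w /g2 H; exact: ex_derive.
move=> v w; have Wn : \forall u \near y, W u by exact: open_nbhs_nbhs.
apply: (@near_continuous _ R (fun x => L ('D_w ('D_v f) x) i j)).
  near=> u; apply/esym; apply: (@derive_val _ _ _ _ _ _ _ (g2 u v w _)).
  by near: u; exact: Wn.
exact: (cvg_comp _ _ (fc y v w Wy) (@coord_continuous _ _ _ i j _)).
Unshelve. all: by end_near. Qed.

End SecondOrder.

(** * The extended shape operator *)

Section Contraction.
Context {R : realType} {m p : nat}.
Local Notation V := 'M[R]_(m, p).
Variable T : V -> V.
Hypotheses (Tl : linear T) (Tsym : forall u v, inner (T u) v = inner u (T v)).

Let TD := linear_add Tl.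
Let T0 := linear_zero Tl.
Let TZ := linear_scale Tl.

Lemma linear_mx_continuous : continuous T.
Proof.
move=> x; have TE y : T y = \sum_i \sum_j y i j *: T (delta_mx i j).
  have Tsum (I : finType) (g : I -> V) : T (\sum_i g i) = \sum_i T (g i).
    by elim/big_rec2: _ => // i a b _ <-.
  rewrite {1}(matrix_sum_delta y) Tsum; apply: eq_bigr => i _.
  by rewrite Tsum; apply: eq_bigr => j _; rewrite TZ.
rewrite /continuous_at (TE x); under eq_cvg do rewrite TE.
have Vadd : continuous (fun x : V * V => x.1 + x.2) by exact: add_continuous.
apply: (@cvg_big _ _ _ _ predT Vadd _ _ _ _ _ (nbhs_filter x)) => i _.
apply: (@cvg_big _ _ _ _ predT Vadd _ _ _ _ _ (nbhs_filter x)) => j _.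
by apply: cvgZr_tmp; exact: coord_continuous.
Qed.

Lemma unit_sphere_compact : compact [set X : V | inner X X = 1].
Proof.
pose S := [set x : 'rV[R]_(m * p) | inner (vec_mx x) (vec_mx x) = 1].
have vc : continuous (@vec_mx R m p).
  move=> x A /= /nbhs_ballP[e e0 eA]; apply/nbhs_ballP; exists e => //= y [_ xy].
  by apply: eA; split=> // i j; rewrite !mxE; exact: xy.
suff cS : compact S.
  have -> : [set X : V | inner X X = 1] = vec_mx @` S.
    apply/seteqP; split => [X /= X1|_ /= [x xS <-] //].
    by exists (mxvec X); rewrite /S /= mxvecK.
  by apply: continuous_compact => //; exact: continuous_subspaceT.
apply: bounded_closed_compact.
  exists 1; split; first exact: num_real.
  move=> b b1 x; rewrite /S /= => x1; rewrite /Num.Def.normr /= mx_normrE.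
  apply: bigmax_le => [|[i k] _]; first by lra.
  rewrite (ord1 i) /=; case/mxvec_indexP: k => i' j'.
  have -> : x 0 (mxvec_index i' j') = vec_mx x i' j' by rewrite mxE.
  apply: le_trans (ltW b1); rewrite -[leRHS]sqrtr1 -sqrtr_sqr; apply: ler_wsqrtr.
  rewrite -x1 /inner (bigD1 i') //= (bigD1 j') //= -expr2 -addrA lerDl addr_ge0 //.
    by apply: sumr_ge0 => k _; rewrite -expr2 sqr_ge0.
  by apply: sumr_ge0 => k _; apply: sumr_ge0 => l _; rewrite -expr2 sqr_ge0.
have -> : S = (fun x => inner (vec_mx x) (vec_mx x)) @^-1` [set 1] by [].
apply: closed_comp => [x _|]; last exact: closed_eq.
exact: (cvg_inner (vc x) (vc x)).
Qed.

Lemma quadratic_ge0_linear0 (a b : R) :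
  (forall t, 0 <= 2 * t * a + t ^+ 2 * b) -> a = 0.
Proof.
move=> H; apply/eqP; rewrite -sqrf_eq0.
have b1 : 0 < `|b| + 1 by have := normr_ge0 b; lra.
(* At this t the polynomial equals a^2 times a negative number, whatever the sign of b. *)
have := H (- a / (`|b| + 1)); have bb := ler_norm b.
have -> : 2 * (- a / (`|b| + 1)) * a + (- a / (`|b| + 1)) ^+ 2 * b =
  a ^+ 2 * ((b - 2 * (`|b| + 1)) / (`|b| + 1) ^+ 2) by field; exact: lt0r_neq0.
move=> H'; rewrite eq_le sqr_ge0 andbT.
rewrite -(ler_nM2l (x := (b - 2 * (`|b| + 1)) / (`|b| + 1) ^+ 2)).
  by rewrite mulr0 mulrC.
rewrite ltr_pdivrMr ?exprn_gt0 // mul0r; lra.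
Qed.

(** At a maximum c of |T Y|^2 on the unit sphere, with value M, the first variation gives T^2 c = M
    c. If M > 1 and mu = sqrt M, then T c + mu c is an eigenvector for mu or zero, and in the latter
    case c is one for - mu. *)
Lemma symmetric_contraction :
  (forall mu X, 1 < `|mu| -> T X = mu *: X -> X = 0) ->
  forall X, inner (T X) (T X) <= inner X X.
Proof.
move=> noeig X.
have [->|X0] := eqVneq X 0; first by rewrite T0.
pose f (Y : V) := inner (T Y) (T Y).
have fc : continuous f.
  by move=> Y; exact: (cvg_inner (linear_mx_continuous (x := Y)) (linear_mx_continuous (x := Y))).
have [||c c1 cmax] := @compact_EVT_max _ _ f _ _ unit_sphere_compact.
- by exists ((enorm X)^-1 *: X); exact: inner_normalize.
- exact: continuous_subspaceT.
move: c1; rewrite inE /= => c1; set M := f c in cmax.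
have fM Y : f Y <= M * inner Y Y.
  have [->|Y0] := eqVneq Y 0; first by rewrite /f T0 !inner0l mulr0.
  have e0 : 0 < enorm Y by rewrite sqrtr_gt0 inner_gt0.
  have : f ((enorm Y)^-1 *: Y) <= M.
    by apply: cmax; rewrite inE /=; exact: inner_normalize.
  rewrite /f TZ !innerE mulrA -expr2 exprVn enorm_sqr mulrC ler_pdivrMr //.
  exact: inner_gt0.
have [M1|M1] := leP M 1.
  apply: le_trans (fM X) _; rewrite -[leRHS]mul1r ler_wpM2r //; exact: inner_ge0.
exfalso.
have T2c : T (T c) = M *: c.
  apply: inner_inj => Y; apply/eqP; rewrite -subr_eq0; apply/eqP/oppr_inj.
  rewrite oppr0; apply: (@quadratic_ge0_linear0 _ (M * inner Y Y - inner (T Y) (T Y))) => t.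
  have := fM (c + t *: Y); rewrite /f TD TZ !innerE c1 -/(f c) -/M.
  rewrite (innerC (T Y) (T c)) (innerC Y c) (Tsym (T c) Y).
  set a := inner (T c) (T Y); set b := inner (T Y) (T Y); set d := inner c Y.
  move=> H; lra.
pose mu := Num.sqrt M.
have mu1 : 1 < mu by rewrite -[ltLHS]sqrtr1 ltr_sqrt //; lra.
have muM : mu ^+ 2 = M by rewrite sqr_sqrtr //; lra.
have Y0 : T c + mu *: c = 0.
  apply: (noeig mu); first by rewrite ger0_norm //; lra.
  by rewrite TD TZ T2c -muM scalerDr scalerA -expr2 addrC.
have : c = 0.
  apply: (noeig (- mu)); first by rewrite normrN ger0_norm //; lra.
  by apply/eqP; rewrite scaleNr -addr_eq0 Y0.
by move=> c0; move: c1; rewrite c0 inner0l => /eqP; rewrite eq_sym oner_eq0.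
Qed.

(* |T^2 X - X|^2 = |T^2 X|^2 - 2 |T X|^2 + |X|^2. *)
Lemma contraction_isometric X : (forall Y, inner (T Y) (T Y) <= inner Y Y) ->
  inner (T X) (T X) = inner X X -> T (T X) = X.
Proof.
move=> Tc TX; apply/eqP; rewrite -subr_eq0 -inner_eq0 eq_le inner_ge0 andbT.
have := Tc (T X); have := Tsym (T X) X; rewrite !innerE (innerC X (T (T X))) TX.
by move=> ->; lra.
Qed.

End Contraction.

Section Frame.
Context {R : realType} {K : scalars} {n m : nat}.
Local Notation KK := 'rV[R]_(kdim K).
Local Notation V := 'M[R]_(n.+1, kdim K).
Local Notation E := 'rV[R]_m.
(** Codimension one in KP^n: the m tangent directions, the [kdim K] directions of z K and the normal
    v fill K^(n+1). *)
Hypothesis dim_m : (m + kdim K + 1 = n.+1 * kdim K)%N.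

(* The first-order data at a point of a local lift z of a hypersurface and of a
   lift v of its unit normal, with differentials dz and dv. *)
Definition normal_frame (z v : V) (dz dv : E -> V) : Prop :=
  [/\ inner z z = 1, inner v v = 1 & kdot z v = 0] /\
  [/\ linear dz, linear dv,
      forall h, [/\ inner z (dz h) = 0, inner v (dz h) = 0 & inner v (dv h) = 0],
      forall h l, inner (dv h) (kscale z l) + inner v (kscale (dz h) l) = 0 &
      forall h k, inner (dz h) (dv k) = inner (dz k) (dv h)].

(** The differential of the projected map is injective: no nonzero h is sent into z K. *)
Definition fibre_free (z : V) (dz : E -> V) : Prop :=
  forall h l, dz h = kscale z l -> h = 0.

(* T is minus the shape operator of the lifted hypersurface in the sphere,
   extended to the plane spanned by z and v. *)
Definition shape_like (T : V -> V) (z v : V) (dz dv : E -> V) : Prop :=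
  [/\ linear T, forall u w, inner (T u) w = inner u (T w),
      forall h, T (dz h) = - dv h, forall l, T (kscale z l) = - kscale v l & T v = - z].

Section Point.
Variables (z v : V) (dz dv : E -> V).
Hypothesis F : normal_frame z v dz dv.

Let z1 : inner z z = 1. Proof. by case: F => -[]. Qed.
Let v1 : inner v v = 1. Proof. by case: F => -[]. Qed.
Let zv : horizontal z v. Proof. by apply/horizontalP; case: F => -[]. Qed.
Let dzl : linear dz. Proof. by case: F => _ []. Qed.
Let dvl : linear dv. Proof. by case: F => _ []. Qed.
Let zdz h : inner z (dz h) = 0. Proof. by case: F => _ [_ _ H _ _]; have [] := H h. Qed.
Let vdz h : inner v (dz h) = 0. Proof. by case: F => _ [_ _ H _ _]; have [] := H h. Qed.
Let vdv h : inner v (dv h) = 0. Proof. by case: F => _ [_ _ H _ _]; have [] := H h. Qed.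
Let vzl l : inner v (kscale z l) = 0. Proof. exact: horizontal_inner. Qed.
Let zvl l : inner z (kscale v l) = 0.
Proof. by rewrite innerC inner_kscale_adj vzl. Qed.
Let dvz h : inner (dv h) z = 0.
Proof.
have [_ [_ _ _ /(_ h kone) + _]] := F.
by rewrite !kscale1 vdz addr0.
Qed.

(** In the differentiated relation <dv, z l> + <v, dz l> = 0, moving l across the second product and
    writing its conjugate as 2 Re l - l leaves - <dz, v l>, because <v, dz> = 0. *)
Lemma frame_dv_z h l : inner (dv h) (kscale z l) = inner (dz h) (kscale v l).
Proof.
have [_ [_ _ _ /(_ h l) + _]] := F.
rewrite [inner v _]innerC inner_kscale_adj kconj_inner1 kscaleDr kscaleNr kscaleZr.
by rewrite kscale1 innerDr innerNr innerZr (innerC _ v) vdz mulr0 add0r => /eqP;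
  rewrite subr_eq0 => /eqP.
Qed.

Hypothesis free : fibre_free z dz.

Let P := ('rV[R]_m * KK * 'rV[R]_1)%type.
Let phi (p : P) : V := dz p.1.1 + kscale z p.1.2 + p.2 0 0 *: v.
Let psi (p : P) : V := dv p.1.1 + kscale v p.1.2 + p.2 0 0 *: z.

Let phil : linear phi.
Proof.
move=> a [[h l] s] [[h' l'] s']; rewrite /phi /= dzl kscaleDr kscaleZr !mxE.
by rewrite scalerDl !scalerDr !scalerA [X in X + _ = _]addrACA [LHS]addrACA.
Qed.

Let psil : linear psi.
Proof.
move=> a [[h l] s] [[h' l'] s']; rewrite /psi /= dvl kscaleDr kscaleZr !mxE.
by rewrite scalerDl !scalerDr !scalerA [X in X + _ = _]addrACA [LHS]addrACA.
Qed.

Let dz0 := linear_zero dzl.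
Let dv0 := linear_zero dvl.

Let phi_inj p : phi p = 0 -> p = 0.
Proof.
case: p => -[h l] s; rewrite /phi /= => H.
have s0 : s 0 0 = 0.
  have := congr1 (inner v) H; rewrite !innerDr innerZr vdz vzl v1 inner0r.
  by rewrite !add0r mulr1.
move: H; rewrite s0 scale0r addr0 => H.
have h0 : h = 0.
  by apply: (free (l := - l)); rewrite kscaleNr; apply/eqP; rewrite -addr_eq0 H.
move: H; rewrite h0 dz0 add0r => /(kscale_eq0 z1) ->.
by congr (_, _, _); apply/rowP => j; rewrite (ord1 j) mxE s0.
Qed.

Let phi_surj X : exists p, phi p = X.
Proof.
apply: (linear_surj phil _ phi_inj).
have -> : dim P = (dim 'rV[R]_m + dim KK + dim 'rV[R]_1)%N by [].
by rewrite !dim_matrix !mul1r; exact: dim_m.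
Qed.

Lemma frame_span X : exists h l s, X = dz h + kscale z l + s *: v.
Proof.
by have [[[h l] s] <-] := phi_surj X; exists h, l, (s 0 0).
Qed.

(** T is - [psi] composed with the inverse of [phi], the decomposition into tangent, fibre and
    normal parts. It is symmetric because <dz h, dv k> is symmetric for two tangent parts, by
    [frame_dv_z] for a tangent and a fibre part, and by orthogonality relations otherwise. *)
Lemma exists_shape : exists T, shape_like T z v dz dv.
Proof.
have [g gP] := choice phi_surj.
have gphi p : g (phi p) = p.
  apply/eqP; rewrite -subr_eq0; apply/eqP/phi_inj.
  have := phil (-1) p (g (phi p)); rewrite !scaleN1r gP addNr => H.
  by rewrite addrC.
exists (fun X => - psi (g X)).
have Tl : linear (fun X => - psi (g X)).
  move=> a X Y; have -> : g (a *: X + Y) = a *: g X + g Y.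
    by rewrite -[X in LHS]gP -[Y in LHS]gP -phil gphi.
  by rewrite psil opprD scalerN.
have Tphi p : - psi (g (phi p)) = - psi p by rewrite gphi.
split => //.
- move=> u w; rewrite -{2}(gP u) -{1}(gP w); move: (g u) (g w) => [[h l] s] [[h' l'] s'].
  have dzdv : inner (dv h) (dz h') = inner (dz h) (dv h').
    by have [_ [_ _ _ _ ->]] := F; exact: innerC.
  have vldz : inner (kscale v l) (dz h') = inner (kscale z l) (dv h').
    by rewrite innerC -frame_dv_z innerC.
  have vv a b : inner (kscale v a) (kscale v b) = inner a b.
    by rewrite inner_kscalel v1 mul1r.
  have zz a b : inner (kscale z a) (kscale z b) = inner a b.
    by rewrite inner_kscalel z1 mul1r.
  have vz a b : inner (kscale v a) (kscale z b) = 0.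
    by rewrite inner_kscale_adj kscaleA vzl.
  have zv0 a b : inner (kscale z a) (kscale v b) = 0 by rewrite innerC vz.
  have dzz k : inner (dz k) z = 0 by rewrite innerC zdz.
  have dvv k : inner (dv k) v = 0 by rewrite innerC vdv.
  have vlv a : inner (kscale v a) v = inner a kone by rewrite -(vv a kone) kscale1.
  have zlz a : inner (kscale z a) z = inner a kone by rewrite -(zz a kone) kscale1.
  have vvl a : inner v (kscale v a) = inner a kone by rewrite innerC vlv.
  have zzl a : inner z (kscale z a) = inner a kone by rewrite innerC zlz.
  have zv00 : inner z v = 0 by exact: horizontal_orth.
  have vz00 : inner v z = 0 by rewrite innerC.
  rewrite /psi /phi /= !innerE dzdv vldz frame_dv_z !(vz, zv0, dzz, zdz, dvv, vdv).
  by rewrite vlv zlz vvl zzl zv00 vz00; ring.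
- move=> h; have -> : dz h = phi (h, 0, 0).
    by rewrite /phi /= kscale0r mxE scale0r !addr0.
  by rewrite Tphi /psi /= kscale0r mxE scale0r !addr0.
- move=> l; have -> : kscale z l = phi (0, l, 0).
    by rewrite /phi /= dz0 mxE scale0r addr0 add0r.
  by rewrite Tphi /psi /= dv0 mxE scale0r addr0 add0r.
- have -> : v = phi (0, 0, 1%:M).
    by rewrite /phi /= dz0 kscale0r mxE eqxx scale1r !add0r.
  by rewrite Tphi /psi /= dv0 kscale0r mxE eqxx scale1r !add0r.
Qed.

Section Shape.
Variable T : V -> V.
Hypothesis TS : shape_like T z v dz dv.

Let Tl : linear T. Proof. by case: TS. Qed.
Let Tsym u w : inner (T u) w = inner u (T w). Proof. by case: TS. Qed.
Let Tdz h : T (dz h) = - dv h. Proof. by case: TS. Qed.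
Let Tz l : T (kscale z l) = - kscale v l. Proof. by case: TS. Qed.
Let Tv : T v = - z. Proof. by case: TS. Qed.

Let TD := linear_add Tl.
Let TZ := linear_scale Tl.
Let TN := linear_opp Tl.

Let Tspan h l (s : R) :
  T (dz h + kscale z l + s *: v) = - (dv h + kscale v l + s *: z).
Proof. by rewrite !TD TZ Tdz Tz Tv scalerN !opprD. Qed.

(* An eigenvalue mu of T with |mu| > 1 is a focal point at distance
   arctan (1 / |mu|) < pi / 4. *)
Lemma shape_contraction :
  (forall t, `|t| < pi / 4 -> forall h l,
     cos t *: dz h + sin t *: dv h = kscale (cos t *: z + sin t *: v) l -> h = 0) ->
  forall X, inner (T X) (T X) <= inner X X.
Proof.
move=> nofocal; apply: symmetric_contraction => // mu X mu1 TX.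
have [h [l [s XE]]] := frame_span X.
move: TX; rewrite XE Tspan => TX.
have zkl : inner z (kscale z l) = inner l kone.
  by rewrite innerC -{2}[z]kscale1 inner_kscalel z1 mul1r.
have vkl : inner v (kscale v l) = inner l kone.
  by rewrite innerC -{2}[v]kscale1 inner_kscalel v1 mul1r.
have zv00 : inner z v = 0 by exact: horizontal_orth.
(* Pairing with z and v gives - s = mu Re l and - Re l = mu s, so that (mu^2 - 1) s = 0. *)
have := congr1 (inner v) TX; have := congr1 (inner z) TX.
rewrite !innerE zdz vdz vdv vzl zvl zkl vkl (innerC v z) zv00 z1 v1 (innerC z (dv h)) dvz.
rewrite !addr0 !add0r !mulr1 !mulr0 !addr0 => e1 e2.
have mu2 : 1 < mu ^+ 2 by rewrite -real_normK ?num_real // exprn_egt1 // ltW.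
have s0 : s = 0.
  have : (mu ^+ 2 - 1) * s = 0 by rewrite mulrBl expr2 -mulrA -e2 mulrN; lra.
  by move=> /eqP; rewrite mulf_eq0 subr_eq0 gt_eqF //= => /eqP.
have mu0 : mu != 0 by rewrite -normr_gt0; lra.
(* Then cos t = mu sin t, and sin t times the eigenvalue equation is the focal equation at t for h
   and - l. Negative mu gives negative t, on the other side of the hypersurface. *)
pose t := atan mu^-1.
have t4 : `|t| < pi / 4.
  have muV : `|mu^-1| < 1 by rewrite normfV invf_lt1 //; lra.
  rewrite -atan1 ltr_norml -atanN; apply/andP; split; apply: lt_atan.
    by move: muV; rewrite ltr_norml => /andP[].
  by move: muV; rewrite ltr_norml => /andP[].
have cm : cos t = mu * sin t.
  have ct : cos t != 0.
    apply: lt0r_neq0; apply: cos_gt0_pihalf; rewrite /t atan_gtNpi2 /=; exact: atan_ltpi2.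
  have := atanK mu^-1; rewrite -/t /tan => tE.
  have -> : sin t = mu^-1 * cos t by rewrite -tE mulfVK.
  by rewrite mulrA mulfV // mul1r.
move: TX; rewrite s0 !scale0r !addr0 => TX.
have h0 : h = 0.
  apply: (nofocal t t4 h (- l)); rewrite kscaleNr cm.
  rewrite -!(mulrC (sin t)) -!scalerA -!scalerDr kscaleZl -scalerN; congr (_ *: _).
  rewrite kscaleDl kscaleZl; apply/eqP; rewrite -subr_eq0 opprK addrACA -scalerDr.
  by rewrite -TX addNr.
move: TX; rewrite h0 dz0 dv0 !add0r.
move=> /(congr1 (inner (kscale z l))).
rewrite innerNr (innerC _ (kscale v l)) inner_kscale_adj kscaleA vzl oppr0 innerZr.
rewrite inner_kscalel z1 mul1r => /esym/eqP.
rewrite mulf_eq0 (negPf mu0) inner_eq0 /= => /eqP ->.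
by rewrite kscale0r.
Qed.

Hypothesis Tc : forall X, inner (T X) (T X) <= inner X X.

(** |T (z l)| = |v l| = |z l| is the equality case of the contraction, so T^2 fixes z l. *)
Lemma shape_flip l : T (kscale v l) = - kscale z l.
Proof.
apply: oppr_inj; rewrite opprK -[RHS](contraction_isometric Tsym Tc).
  by rewrite Tz TN.
by rewrite Tz innerNl innerNr opprK !inner_kscalel v1 z1.
Qed.

Lemma frame_dv_v l k : inner (kscale v l) (dv k) = inner (kscale z l) (dz k).
Proof.
apply: oppr_inj; rewrite -innerNr -Tdz -Tsym shape_flip innerNl //.
Qed.

(** The one ingredient that is not pointwise: it needs [frame_dv_v] at all nearby points, in order
    to differentiate it. *)
Hypothesis rot : forall l h k, kconj l = - l ->
  inner (kscale (dv h) l) (dv k) = inner (kscale (dz h) l) (dz k).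

(** Checked on the nine pairs of components in the frame decomposition. Only two tangent components
    need [rot]; the others follow from [frame_dv_z], [frame_dv_v] and orthogonality. *)
Lemma shape_rotation l X Y : kconj l = - l ->
  inner (kscale (T X) l) (T Y) = inner (kscale X l) Y.
Proof.
move=> lI; have [h [l0 [s ->]]] := frame_span X; have [k [l1 [s' ->]]] := frame_span Y.
rewrite !Tspan kscaleNl innerNl innerNr opprK.
have vv a b : inner (kscale v a) (kscale v b) = inner (kscale z a) (kscale z b).
  by rewrite !inner_kscalel v1 z1.
have vlv a : inner (kscale v a) v = inner (kscale z a) z.
  by rewrite -{2}[v]kscale1 vv kscale1.
have vz a b : inner (kscale v a) (kscale z b) = 0.
  by rewrite inner_kscale_adj kscaleA vzl.
have zv0 a b : inner (kscale z a) (kscale v b) = 0 by rewrite innerC vz.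
have vlz a : inner (kscale v a) z = 0 by rewrite -[z]kscale1 vz.
have zlv a : inner (kscale z a) v = 0 by rewrite -[v]kscale1 zv0.
have dvv a : inner (kscale (dv h) l) (kscale v a) = inner (kscale (dz h) l) (kscale z a).
  by rewrite !inner_kscale_adj !kscaleA innerC frame_dv_v innerC.
have dvz' : inner (kscale (dv h) l) z = inner (kscale (dz h) l) v.
  by rewrite !inner_kscale_adj frame_dv_z.
have zdv a : inner (kscale z a) (dv k) = inner (kscale v a) (dz k).
  by rewrite innerC frame_dv_z innerC.
rewrite !kscaleDl !kscaleZl !kscaleA.
rewrite !innerDr !innerDl; congr (_ + _ + _ + (_ + _ + _) + (_ + _ + _));
  rewrite ?innerZl ?innerZr.
- exact: rot.
- exact: frame_dv_v.
- by rewrite zdv.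
- exact: dvv.
- exact: vv.
- by rewrite zv0 vz.
- by rewrite dvz'.
- by rewrite vlz zlv.
- by rewrite vlv.
Qed.

Lemma shape_rotationK l X : kconj l = - l -> T (kscale (T X) l) = kscale X l.
Proof. by move=> lI; apply: inner_inj => Y; rewrite Tsym shape_rotation. Qed.

(** For a unit imaginary e, |X| = |X e| = |T ((T X) e)| <= |(T X) e| = |T X| <= |X|. So T is
    isometric, and the equality case of the contraction applies to every X. *)
Lemma shape_involutive X : T (T X) = X.
Proof.
apply: contraction_isometric => //.
have [e e1 eI] := @exists_imaginary_unit R K.
apply/eqP; rewrite eq_le Tc /=.
have := Tc (kscale (T X) e); rewrite shape_rotationK // !inner_kscaler e1.
by rewrite !mul1r.
Qed.

(** For imaginary a, [shape_rotationK] at T X together with T^2 = 1 is commutation with right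
    multiplication by a; the real part of l is covered by real linearity. *)
Lemma shape_kscale X l : T (kscale X l) = kscale (T X) l.
Proof.
have TI a : kconj a = - a -> T (kscale X a) = kscale (T X) a.
  by move=> aI; rewrite -{1}(shape_involutive X) shape_rotationK.
pose a := l - inner l kone *: kone.
have aI : kconj a = - a.
  rewrite /a kconjD -scaleN1r !kconjZ kconj1 kconj_inner1 mulrDl !mul1r scalerDl.
  by rewrite scaleN1r opprB addrAC addrK.
have lE : l = a + inner l kone *: kone by rewrite /a subrK.
clearbody a; rewrite lE !kscaleDr TD (TI a aI) !kscaleZr.
by rewrite !kscale1 TZ.
Qed.

End Shape.
End Point.
End Frame.

Section InnerRules.
Context {R : realType} {E : normedModType R} {m p : nat}.
Local Notation V := 'M[R]_(m, p).

Lemma derive_inner_eq (f1 g1 f2 g2 : E -> V) (y h : E) df1 dg1 df2 dg2 :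
  (\forall x \near y, inner (f1 x) (g1 x) = inner (f2 x) (g2 x)) ->
  is_derive y h f1 df1 -> is_derive y h g1 dg1 ->
  is_derive y h f2 df2 -> is_derive y h g2 dg2 ->
  inner df1 (g1 y) + inner (f1 y) dg1 = inner df2 (g2 y) + inner (f2 y) dg2.
Proof.
move=> fg f1d g1d f2d g2d; apply: is_derive_unique (is_derive_inner f2d g2d).
exact: near_eq_is_derive (is_derive_inner f1d g1d).
Qed.

Lemma derive_inner_cst (f g : E -> V) (c : R) (y h : E) df dg :
  (\forall x \near y, inner (f x) (g x) = c) ->
  is_derive y h f df -> is_derive y h g dg ->
  inner df (g y) + inner (f y) dg = 0.
Proof.
move=> fg fd gd; apply: is_derive_unique (is_derive_cst c y h).
by apply: near_eq_is_derive (is_derive_inner fd gd).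
Qed.

(** Meant for b = T x w, which the contraction property bounds before anything is known about its
    continuity in x. *)
Lemma cvg_inner_bounded (T : Type) (F : set_system T) {FF : Filter F} (a b : T -> V) (C : R) :
  a @ F --> (0 : V) -> (\forall t \near F, inner (b t) (b t) <= C) ->
  inner (a t) (b t) @[t --> F] --> (0 : R).
Proof.
move=> a0 bC.
have e0 : enorm (a t) * Num.sqrt C @[t --> F] --> (0 : R).
  have -> : (0 : R) = enorm (0 : V) * Num.sqrt C by rewrite /enorm inner0l sqrtr0 mul0r.
  apply: cvgM; last exact: cvg_cst.
  exact: (cvg_comp _ _ (cvg_inner a0 a0) (@sqrt_continuous R _)).
have Ne0 : - (enorm (a t) * Num.sqrt C) @[t --> F] --> (0 : R).
  by rewrite -oppr0; exact: cvgN.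
apply: (squeeze_cvgr _ Ne0 e0); near=> t.
have bt : enorm (b t) <= Num.sqrt C.
  by apply: ler_wsqrtr; near: t.
have ab : enorm (a t) * enorm (b t) <= enorm (a t) * Num.sqrt C.
  by apply: ler_wpM2l => //; exact: enorm_ge0.
rewrite (le_trans (le_inner_enorm _ _) ab) andbT lerNl -innerNl.
apply: le_trans (le_inner_enorm _ _) _.
by have -> : enorm (- a t) = enorm (a t) by rewrite /enorm innerNl innerNr opprK.
Unshelve. all: by end_near. Qed.

Lemma is_derive_kscalel (K : scalars) (f : E -> 'M[R]_(m, kdim K)) (y h : E) df l :
  is_derive y h f df -> is_derive y h (fun x => kscale (f x) l) (kscale df l).
Proof.
move=> fd; have := is_derive_kscale fd (is_derive_cst l y h).
by rewrite kscale0r addr0.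
Qed.

End InnerRules.

(** * Local constancy of the shape operator along a hypersurface *)

Section Involution.
Context {R : realType} {K : scalars} {n : nat}.
Local Notation V := 'M[R]_(n.+1, kdim K).

Definition kinvolution (T : V -> V) : Prop :=
  [/\ linear T, forall u w, inner (T u) w = inner u (T w),
      forall X, T (T X) = X & forall X l, T (kscale X l) = kscale (T X) l].

End Involution.

Section Hypersurface.
Context {R : realType} {K : scalars} {n m : nat}.
Local Notation V := 'M[R]_(n.+1, kdim K).
Local Notation E := 'rV[R]_m.
Hypothesis dim_m : (m + kdim K + 1 = n.+1 * kdim K)%N.
Variables (W : set E) (z v : E -> V) (dz dv : E -> E -> V) (ddz ddv : E -> E -> E -> V).
Hypotheses (Wo : open W) (zC : second_order W z dz ddz) (vC : second_order W v dv ddv).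
Hypotheses (z1 : forall y, W y -> inner (z y) (z y) = 1)
  (v1 : forall y, W y -> inner (v y) (v y) = 1)
  (zv : forall y, W y -> kdot (z y) (v y) = 0)
  (vdz : forall y h, W y -> inner (v y) (dz y h) = 0).
Hypothesis nofocal : forall y, W y -> forall t, `|t| < pi / 4 -> forall h l,
  cos t *: dz y h + sin t *: dv y h = kscale (cos t *: z y + sin t *: v y) l -> h = 0.

Let near_W y : W y -> \forall x \near y, W x.
Proof. by move=> Wy; exact: open_nbhs_nbhs. Qed.

Let zD y h : W y -> is_derive y h z (dz y h). Proof. by case: zC => H _ _ _; exact: H. Qed.
Let vD y h : W y -> is_derive y h v (dv y h). Proof. by case: vC => H _ _ _; exact: H. Qed.
Let zDD y h k : W y -> is_derive y k (fun x => dz x h) (ddz y h k).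
Proof. by case: zC => _ _ H _; exact: H. Qed.
Let vDD y h k : W y -> is_derive y k (fun x => dv x h) (ddv y h k).
Proof. by case: vC => _ _ H _; exact: H. Qed.
Let ddzC y h k : W y -> ddz y h k = ddz y k h. Proof. by case: zC => _ _ _ H; exact: H. Qed.
Let ddvC y h k : W y -> ddv y h k = ddv y k h. Proof. by case: vC => _ _ _ H; exact: H. Qed.

Lemma hypersurface_frame y : W y -> normal_frame (z y) (v y) (dz y) (dv y).
Proof.
move=> Wy; split; first by split; [exact: z1|exact: v1|exact: zv].
split.
- by case: zC => _ H _ _; exact: H.
- by case: vC => _ H _ _; exact: H.
- move=> h; split; last 2 first.
  + exact: vdz.
  + have : inner (dv y h) (v y) + inner (v y) (dv y h) = 0.
      apply: (@derive_inner_cst _ _ _ _ v v 1) (vD h Wy) (vD h Wy).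
      by apply: filterS (near_W Wy) => x; exact: v1.
    by rewrite innerC => H; lra.
  have : inner (dz y h) (z y) + inner (z y) (dz y h) = 0.
    apply: (@derive_inner_cst _ _ _ _ z z 1) (zD h Wy) (zD h Wy).
    by apply: filterS (near_W Wy) => x; exact: z1.
  by rewrite innerC => H; lra.
- move=> h l; apply: (@derive_inner_cst _ _ _ _ v (fun x => kscale (z x) l) 0) (vD h Wy)
    (is_derive_kscalel l (zD h Wy)).
  apply: filterS (near_W Wy) => x Wx; apply: horizontal_inner.
  by apply/horizontalP; exact: zv.
move=> h k.
(* The derivative of <v, dz h'> = 0 expresses <dv k', dz h'> by the second derivative of z, whose
   symmetry becomes that of the second fundamental form. *)
have vdz0 h' k' : inner (dv y k') (dz y h') + inner (v y) (ddz y h' k') = 0.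
  apply: (@derive_inner_cst _ _ _ _ v (fun x => dz x h') 0) (vD k' Wy) (zDD h' k' Wy).
  by apply: filterS (near_W Wy) => x Wx; exact: vdz.
have := vdz0 h k; have := vdz0 k h; rewrite (ddzC k h Wy) (innerC (dv y k)).
by rewrite (innerC (dv y h)) => e1 e2; lra.
Qed.

Lemma hypersurface_free y : W y -> fibre_free (z y) (dz y).
Proof.
move=> Wy h l zl; have pi4 : `|0 : R| < pi / 4 by rewrite normr0 divr_gt0 // pi_gt0.
apply: (@nofocal y Wy 0 pi4 h l).
by rewrite cos0 sin0 !scale0r !addr0 !scale1r.
Qed.

Let shapeW (T : E -> V -> V) := forall y, W y -> shape_like (T y) (z y) (v y) (dz y) (dv y).

(** The operators are chosen point by point, with no regularity; [shapes_derive] recovers it. *)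
Lemma exists_shapes : exists T, shapeW T.
Proof.
have : forall y, exists T, W y -> shape_like T (z y) (v y) (dz y) (dv y).
  move=> y; have [Wy|nWy] := pselect (W y); last by exists id.
  have [T TS] := exists_shape dim_m (hypersurface_frame Wy) (hypersurface_free Wy).
  by exists T.
by move=> /choice[T TS]; exists T => y Wy; exact: TS.
Qed.

Section Shapes.
Variable T : E -> V -> V.
Hypothesis TS : shapeW T.

Let Tc y : W y -> forall X, inner (T y X) (T y X) <= inner X X.
Proof.
move=> Wy; apply: (shape_contraction dim_m (hypersurface_frame Wy)
  (hypersurface_free Wy) (TS Wy)); exact: nofocal.
Qed.

Let dv_v y l k : W y ->
  inner (kscale (v y) l) (dv y k) = inner (kscale (z y) l) (dz y k).
Proof. by move=> Wy; exact: (frame_dv_v (hypersurface_frame Wy) (TS Wy) (Tc Wy)). Qed.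

(* Antisymmetrize in h, k the derivative along h of the identity dv_v. *)
Let rot y l h k : W y -> kconj l = - l ->
  inner (kscale (dv y h) l) (dv y k) = inner (kscale (dz y h) l) (dz y k).
Proof.
move=> Wy lI.
have D h' k' : inner (kscale (dv y h') l) (dv y k') + inner (kscale (v y) l) (ddv y k' h')
    = inner (kscale (dz y h') l) (dz y k') + inner (kscale (z y) l) (ddz y k' h').
  apply: (@derive_inner_eq _ _ _ _ (fun x => kscale (v x) l) (fun x => dv x k')
    (fun x => kscale (z x) l) (fun x => dz x k')).
  - by apply: filterS (near_W Wy) => x Wx; exact: dv_v.
  - exact: is_derive_kscalel (vD _ Wy).
  - exact: vDD.
  - exact: is_derive_kscalel (zD _ Wy).
  - exact: zDD.
have skew (a b : V) : inner (kscale a l) b = - inner (kscale b l) a.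
  by rewrite inner_kscale_adj lI kscaleNr innerNr innerC.
have := D h k; have := D k h; rewrite (ddvC k h Wy) (ddzC k h Wy).
rewrite (skew (dv y k)) (skew (dz y k)) => e1 e2; lra.
Qed.

Let Tl y : W y -> linear (T y). Proof. by move=> /TS[]. Qed.
Let Tsym y : W y -> forall u w, inner (T y u) w = inner u (T y w). Proof. by move=> /TS[]. Qed.
Let Tdz y : W y -> forall h, T y (dz y h) = - dv y h. Proof. by move=> /TS[]. Qed.
Let Tz y : W y -> forall l, T y (kscale (z y) l) = - kscale (v y) l. Proof. by move=> /TS[]. Qed.
Let Tv y : W y -> T y (v y) = - z y. Proof. by move=> /TS[]. Qed.

Let TD y : W y -> forall u w, T y (u + w) = T y u + T y w.
Proof. by move=> /Tl/linear_add. Qed.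
Let T0 y : W y -> T y 0 = 0. Proof. by move=> /Tl/linear_zero. Qed.
Let TZ y : W y -> forall (a : R) u, T y (a *: u) = a *: T y u.
Proof. by move=> /Tl/linear_scale. Qed.
Let TN y : W y -> forall u, T y (- u) = - T y u.
Proof. by move=> /Tl/linear_opp. Qed.

Lemma shapes_involutive y X : W y -> T y (T y X) = X.
Proof.
move=> Wy; apply: (shape_involutive dim_m (hypersurface_frame Wy)
  (hypersurface_free Wy) (TS Wy) (Tc Wy)) => l h k; exact: rot.
Qed.

Lemma shapes_kscale y X l : W y -> T y (kscale X l) = kscale (T y X) l.
Proof.
move=> Wy; apply: (shape_kscale dim_m (hypersurface_frame Wy)
  (hypersurface_free Wy) (TS Wy) (Tc Wy)) => l' h k; exact: rot.
Qed.

Let Tdv y h : W y -> T y (dv y h) = - dz y h.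
Proof.
by move=> Wy; rewrite -[dv y h]opprK -(Tdz Wy) (TN Wy) shapes_involutive.
Qed.

Let Tvl y l : W y -> T y (kscale (v y) l) = - kscale (z y) l.
Proof. by move=> Wy; rewrite shapes_kscale // (Tv Wy) kscaleNl. Qed.

Let Tiso y u w : W y -> inner (T y u) (T y w) = inner u w.
Proof. by move=> Wy; rewrite (Tsym Wy) shapes_involutive. Qed.

Let dv_iso y h k : W y -> inner (dv y h) (dv y k) = inner (dz y h) (dz y k).
Proof.
by move=> Wy; rewrite -[RHS](@Tiso y _ _ Wy) !(Tdz Wy) innerNl innerNr opprK.
Qed.

(* The derivative of T in the direction k, applied to dz h: a tensor symmetric in
   h, k whose contraction with dv j is antisymmetric in h, j, hence zero. *)
Lemma shape_parallel y h k : W y -> ddv y h k + T y (ddz y h k) = 0.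
Proof.
move=> Wy; pose N h' k' := ddv y h' k' + T y (ddz y h' k').
have NC h' k' : N h' k' = N k' h' by rewrite /N (ddvC h' k' Wy) (ddzC h' k' Wy).
have Ndv_anti h' k' j : inner (N h' k') (dv y j) = - inner (N j k') (dv y h').
  have D : inner (ddv y h' k') (dv y j) + inner (dv y h') (ddv y j k')
      = inner (ddz y h' k') (dz y j) + inner (dz y h') (ddz y j k').
    apply: (@derive_inner_eq _ _ _ _ (fun x => dv x h') (fun x => dv x j)
      (fun x => dz x h') (fun x => dz x j)).
    + by apply: filterS (near_W Wy) => x Wx; exact: dv_iso.
    + exact: vDD.
    + exact: vDD.
    + exact: zDD.
    + exact: zDD.
  rewrite /N !innerDl !(Tsym Wy) !Tdv // !innerNr (innerC (ddv y j k')).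
  by rewrite (innerC (ddz y j k')); lra.
(* Three antisymmetric exchanges, interleaved with symmetric ones, lead back to the same term with
   the opposite sign, as in the uniqueness of the Levi-Civita connection. *)
have Ndv j : inner (N h k) (dv y j) = 0.
  have : inner (N h k) (dv y j) = - inner (N h k) (dv y j).
    by rewrite {1}(Ndv_anti h k j) (NC j k) (Ndv_anti k j h) opprK (NC h j)
      (Ndv_anti j h k) (NC k h).
  by move=> e; lra.
have F := hypersurface_frame Wy.
have zdv a b : inner (dz y a) (dv y b) = inner (dz y b) (dv y a).
  by case: F => _ [_ _ _ _].
(* Differentiate <dv h, v l> = <dz h, z l>; the terms without second derivatives cancel, T being
   isometric and K-linear. *)
have Nv l : inner (N h k) (kscale (v y) l) = 0.
  have D : inner (ddv y h k) (kscale (v y) l) + inner (dv y h) (kscale (dv y k) l)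
      = inner (ddz y h k) (kscale (z y) l) + inner (dz y h) (kscale (dz y k) l).
    apply: (@derive_inner_eq _ _ _ _ (fun x => dv x h) (fun x => kscale (v x) l)
      (fun x => dz x h) (fun x => kscale (z x) l)).
    + apply: filterS (near_W Wy) => x Wx.
      by rewrite innerC dv_v // innerC.
    + exact: vDD.
    + exact: is_derive_kscalel (vD _ Wy).
    + exact: zDD.
    + exact: is_derive_kscalel (zD _ Wy).
  have dvk : kscale (dv y k) l = - T y (kscale (dz y k) l).
    by rewrite shapes_kscale // (Tdz Wy) kscaleNl opprK.
  have dvh : dv y h = - T y (dz y h) by rewrite (Tdz Wy) opprK.
  have e : inner (dv y h) (kscale (dv y k) l) = inner (dz y h) (kscale (dz y k) l).
    by rewrite dvk dvh innerNl innerNr opprK Tiso.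
  by rewrite /N innerDl (Tsym Wy) Tvl // innerNr; lra.
have Nz : inner (N h k) (z y) = 0.
  have D1 : inner (ddv y h k) (z y) + inner (dv y h) (dz y k) = 0.
    apply: (@derive_inner_cst _ _ _ _ (fun x => dv x h) z 0) (vDD h k Wy) (zD k Wy).
    apply: filterS (near_W Wy) => x Wx.
    have := frame_dv_z (hypersurface_frame Wx) h kone.
    by rewrite !kscale1 => ->; rewrite innerC; exact: vdz.
  have D2 : inner (ddz y h k) (v y) + inner (dz y h) (dv y k) = 0.
    apply: (@derive_inner_cst _ _ _ _ (fun x => dz x h) v 0) (zDD h k Wy) (vD k Wy).
    by apply: filterS (near_W Wy) => x Wx; rewrite innerC; exact: vdz.
  have Tz1 : T y (z y) = - v y by have := Tz Wy kone; rewrite !kscale1.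
  rewrite /N innerDl (Tsym Wy) Tz1 innerNr.
  by have := zdv h k; rewrite (innerC (dz y k)); lra.
(* By symmetry, T N paired with the frame dz, z l, v is minus N paired with dv, v l, z, and these
   three products vanish. *)
have TN0 : T y (N h k) = 0.
  apply: inner_eq0P; have [a [l [s XE]]] := frame_span dim_m F (hypersurface_free Wy)
    (T y (N h k)).
  rewrite {2}XE (Tsym Wy) !(TD Wy) (TZ Wy) (Tdz Wy) (Tz Wy) (Tv Wy).
  by rewrite !innerDr innerZr !innerNr Ndv Nv Nz !oppr0 mulr0 !addr0.
by rewrite -[LHS](shapes_involutive _ Wy) TN0 (T0 Wy).
Qed.

Let phi y h l (s : R) : V := dz y h + kscale (z y) l + s *: v y.
Let psi y h l (s : R) : V := dv y h + kscale (v y) l + s *: z y.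

Let Tphi y h l s : W y -> T y (phi y h l s) = - psi y h l s.
Proof.
move=> Wy; rewrite /phi /psi !(TD Wy) (TZ Wy) (Tdz Wy) (Tz Wy) (Tv Wy).
by rewrite scalerN !opprD.
Qed.

Let phiD y k h l s : W y -> is_derive y k (fun x => phi x h l s)
  (ddz y h k + kscale (dz y k) l + s *: dv y k).
Proof.
move=> Wy; apply: is_deriveD; last exact: (is_deriveZ s (vD k Wy)).
apply: is_deriveD; first exact: zDD.
exact: is_derive_kscalel (zD _ Wy).
Qed.

Let psiD y k h l s : W y -> is_derive y k (fun x => psi x h l s)
  (ddv y h k + kscale (dv y k) l + s *: dz y k).
Proof.
move=> Wy; apply: is_deriveD; last exact: (is_deriveZ s (zD k Wy)).
apply: is_deriveD; first exact: vDD.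
exact: is_derive_kscalel (vD _ Wy).
Qed.

(** Write u as [phi y] with coefficients h, l, s, and let the same coefficients move with the frame:
    T x (phi x) = - psi x. The increment of <T x u, w> is then minus the increment of phi paired
    with T x w, minus that of psi paired with w. In the limit this is - <T phi' + psi', w>, which is
    zero by [shape_parallel]. *)
Lemma shapes_derive y k u w : W y -> is_derive y k (fun x => inner (T x u) w) 0.
Proof.
move=> Wy; have F := hypersurface_frame Wy.
have FF : Filter ((0 : R)^') by exact: dnbhs_filter.
have cst_cvg (a : V) : (fun _ : R => a) @ (0 : R)^' --> a by exact: cvg_cst.
have nW : \forall e \near (0 : R)^', W (e *: k + y).
  have c : e *: k + y @[e --> (0 : R)^'] --> y.
    apply: cvg_trans (derivable_line_continuous (@derivable_id R E y k)).
    by apply: cvg_app; exact: nbhs_dnbhs.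
  exact: (c W (near_W Wy)).
have lim0 (f : E -> V) df : is_derive y k f df ->
    (f (e *: k + y) - f y) @[e --> (0 : R)^'] --> (0 : V).
  move=> [fd _]; rewrite -(subrr (f y)); apply: cvgB; last exact: cvg_cst.
  apply: cvg_trans (derivable_line_continuous fd).
  by apply: cvg_app; exact: nbhs_dnbhs.
have diffE u0 w0 h l s : u0 = phi y h l s -> \forall e \near (0 : R)^',
    inner (T (e *: k + y) u0) w0 - inner (T y u0) w0 =
    - inner (phi (e *: k + y) h l s - phi y h l s) (T (e *: k + y) w0) -
    inner (psi (e *: k + y) h l s - psi y h l s) w0.
  move=> ->; near=> e; have We : W (e *: k + y) by near: e.
  set x := e *: k + y in We *.
  rewrite -(Tsym We) (TD We) (TN We) (Tphi h l s We) (Tphi h l s Wy).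
  by rewrite /psi !(innerDl, innerNl); ring.
(* The limit of the quotient involves T x at the fixed vector phi', so weak continuity is needed
   first; the same increment formula and the bound |T x w0| <= |w0| provide it. *)
have weak u0 w0 : inner (T (e *: k + y) u0) w0 @[e --> (0 : R)^'] --> inner (T y u0) w0.
  have [h [l [s u0E]]] := frame_span dim_m F (hypersurface_free Wy) u0.
  suff : (inner (T (e *: k + y) u0) w0 - inner (T y u0) w0) @[e --> (0 : R)^'] --> (0 : R).
    move=> H; have C0 : (fun _ : R => inner (T y u0) w0) @ (0 : R)^' --> inner (T y u0) w0.
      exact: cvg_cst.
    have := cvgD (FF := FF) H C0; rewrite add0r => c; apply: (cvg_near_eq _ c).
    by near=> e; rewrite fctE subrK.
  have D := diffE u0 w0 h l s u0E.
  have a0 := lim0 _ _ (phiD k h l s Wy); have b0 := lim0 _ _ (psiD k h l s Wy).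
  have bd : \forall e \near (0 : R)^', inner (T (e *: k + y) w0) (T (e *: k + y) w0) <= inner w0 w0.
    by apply: filterS nW => e We; exact: (Tc We).
  have c1 := cvg_inner_bounded (FF := FF) a0 bd.
  have c2 : inner (psi (e *: k + y) h l s - psi y h l s) w0 @[e --> (0 : R)^'] --> (0 : R).
    by have := cvg_inner (FF := FF) b0 (cst_cvg w0); rewrite inner0l.
  have := cvgB (FF := FF) (cvgN (FF := FF) c1) c2; rewrite oppr0 addr0 => c.
  apply: (cvg_near_eq _ c).
  by apply: filterS D => e ->.
have [h [l [s uE]]] := frame_span dim_m F (hypersurface_free Wy) u.
apply/is_deriveP.
have /is_deriveP p1 := phiD k h l s Wy; have /is_deriveP p2 := psiD k h l s Wy.
set d1 := (ddz _ _ _ + _ + _) in p1; set d2 := (ddv _ _ _ + _ + _) in p2.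
have d12 : inner d1 (T y w) + inner d2 w = 0.
  rewrite -(Tsym Wy) -innerDl /d1 /d2 !(TD Wy) (TZ Wy) shapes_kscale // Tdv // (Tdz Wy).
  rewrite kscaleNl scalerN addrACA [X in X + _]addrACA [_ + ddv _ _ _]addrC shape_parallel //.
  by rewrite addNr addNr !addr0 inner0l.
pose q e := e^-1 *: (phi (e *: k + y) h l s - phi y h l s).
have q0 : (q e - d1) @[e --> (0 : R)^'] --> (0 : V).
  by rewrite -(subrr d1); exact: (cvgB (FF := FF) p1 (cst_cvg d1)).
have bd : \forall e \near (0 : R)^', inner (T (e *: k + y) w) (T (e *: k + y) w) <= inner w w.
  by apply: filterS nW => e We; exact: (Tc We).
have c1 := cvg_inner_bounded (FF := FF) q0 bd.
have c2 := weak w d1.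
have c3 : inner (e^-1 *: (psi (e *: k + y) h l s - psi y h l s)) w @[e --> (0 : R)^'] --> inner d2 w.
  exact: (cvg_inner (FF := FF) p2 (cst_cvg w)).
have := cvgN (FF := FF) (cvgD (FF := FF) (cvgD (FF := FF) c1 c2) c3).
rewrite add0r (innerC _ d1) d12 oppr0 => c; apply: (cvg_near_eq _ c).
apply: filterS (diffE u w h l s uE) => e; rewrite !fctE => ->.
rewrite (innerDl (q e)) (innerNl d1) (innerC _ d1) subrK (innerZl e^-1) (innerZl e^-1).
by rewrite -opprD [RHS]mulrN mulrDr.
Unshelve. all: by end_near. Qed.

End Shapes.

Lemma local_quadric y0 : W y0 -> exists T, kinvolution T /\
  \forall y \near y0, T (z y) = - v y.
Proof.
move=> Wy0; have [T TS] := exists_shapes.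
exists (T y0); split.
  split; [by case: (TS y0 Wy0)|by case: (TS y0 Wy0)| |].
    by move=> X; exact: shapes_involutive.
  by move=> X l; exact: shapes_kscale.
have /nbhs_ballP[r /= r0 rW] : nbhs y0 W by exact: open_nbhs_nbhs.
apply/nbhs_ballP; exists r => //= y yr.
have Wy : W y by exact: rW.
(* With y frozen, <T x (z y), w> has zero derivative along the segment from y0 to y, which stays in
   the ball. *)
have -> : T y0 (z y) = T y (z y).
  apply: inner_inj => w; apply/esym/eqP; rewrite -subr_eq0; apply/eqP.
  have [|t _] := @mvt_line _ _ (fun x => inner (T x (z y)) w) (fun _ => 0) y0 (y - y0) 1 ltr01.
    move=> t /andP[t0 t1]; apply: shapes_derive => //; apply: rW.
    rewrite -ball_normE /ball_ /= opprD addrCA subrr addr0 normrN normrZ ger0_norm //.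
    apply: le_lt_trans (ler_piMl _ t1) _; first exact: normr_ge0.
    by move: yr; rewrite -ball_normE /ball_ /= distrC.
  by rewrite scale1r subrK mul0r.
have [_ _ _ Tz _] := TS y Wy.
by have := Tz kone; rewrite !kscale1.
Qed.

End Hypersurface.

(** * Lifts of immersions to the sphere *)

Section Lifts.
Context {R : realType} {K : scalars} {n m : nat} {M : manifold R m}.
Local Notation KK := 'rV[R]_(kdim K).
Local Notation V := 'M[R]_(n.+1, kdim K).
Local Notation E := 'rV[R]_m.
Implicit Types (a b : chart R M m) (x : M).

Lemma chart_near a x : atlas a -> cdom a x ->
  [/\ cinv a (cmap a x) = x, \forall y \near cmap a x, cimg a y,
      cinv a y @[y --> cmap a x] --> x &
      \forall y \near cmap a x, cdom a (cinv a y) /\ cmap a (cinv a y) = y].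
Proof.
move=> Aa ax; have [/(_ a Aa)[dao imo inv mapc invc] _ _] := atlasP M.
have imx : cimg a (cmap a x) by exists x.
have nim : \forall y \near cmap a x, cimg a y by exact: open_nbhs_nbhs.
split=> //; first exact: inv.
  by rewrite -[X in _ --> X](inv x ax); exact: invc.
by apply: filterS nim => _ [x' ax' <-]; rewrite inv.
Qed.

Lemma transition_near a b x : atlas a -> atlas b -> cdom a x -> cdom b x ->
  let tau := cmap b \o cinv a in
  [/\ differentiable tau (cmap a x), tau (cmap a x) = cmap b x &
      \forall y \near cmap a x, cinv b (tau y) = cinv a y].
Proof.
move=> Aa Ab ax bx tau; have [ainv _ ac _] := chart_near Aa ax.
have [/(_ b Ab)[dbo _ binv _ _] _ trans] := atlasP M.
split.
- apply: (smooth_differentiable (trans a b Aa Ab)).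
  by exists x.
- by rewrite /tau /= ainv.
have : \forall y \near cmap a x, cdom b (cinv a y).
  by apply: ac; exact: open_nbhs_nbhs.
by apply: filterS => y; exact: binv.
Qed.

(** Apart from lifting F nearby, only differentiability at one point is asked; this covers lifts of
    the parallel maps and is enough to compare first derivatives. *)
Definition lift_at (F : M -> KP R K n) a (y : E) (g : E -> V) : Prop :=
  (\forall u \near y, inner (g u) (g u) = 1 /\ F (cinv a u) = hp (g u)) /\
  differentiable g y.

(** The two lifts differ by the chart transition [tau] and by the phase of one against the other.
    The derivative of the phase is vertical, and h' is the image of h under the differential of
    [tau]. First-order conditions known for one chart and lift thereby pass to any other. *)
Lemma lift_compare (F : M -> KP R K n) a b x (g g' : E -> V) :
  atlas a -> atlas b -> cdom a x -> cdom b x ->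
  lift_at F a (cmap a x) g -> lift_at F b (cmap b x) g' ->
  exists2 l : KK, inner l l = 1 & g (cmap a x) = kscale (g' (cmap b x)) l /\
    forall h, exists h' k, (h' = 0 -> h = 0) /\
      'D_h g (cmap a x) = kscale ('D_h' g' (cmap b x)) l + kscale (g (cmap a x)) k.
Proof.
move=> Aa Ab ax bx [gF gd] [gF' gd'].
have [td tx tinv] := transition_near Aa Ab ax bx.
have [sd sx _] := transition_near Ab Aa bx ax.
have [_ _ _ anear] := chart_near Aa ax.
set tau := cmap b \o cinv a in td tx tinv *; set sigma := cmap a \o cinv b in sd sx.
set ya := cmap a x in gF gd td tx tinv sx anear *; set yb := cmap b x in gF' gd' tx sd sx *.
pose G := g' \o tau; pose l u := kdot (G u) (g u).
have gd'' : differentiable g' (tau ya) by rewrite tx.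
have Gd : differentiable G ya by exact: differentiable_comp.
have near_lift : \forall u \near ya, g u = kscale (G u) (l u) /\ inner (l u) (l u) = 1.
  have : \forall u \near ya, inner (G u) (G u) = 1 /\ F (cinv b (tau u)) = hp (G u).
    have tc : tau u @[u --> ya] --> yb by rewrite -tx; exact: differentiable_continuous.
    exact: (tc _ gF').
  move=> GF; near=> u.
  have [g1 gE] : inner (g u) (g u) = 1 /\ F (cinv a u) = hp (g u) by near: u.
  have [G1 GE] : inner (G u) (G u) = 1 /\ F (cinv b (tau u)) = hp (G u) by near: u.
  have ti : cinv b (tau u) = cinv a u by near: u.
  have : hp (G u) = hp (g u) by rewrite -GE -gE ti.
  move=> /(hp_eq G1 g1)[k k1 gk].
  by rewrite /l gk kdot_kscaler kdot_self G1 scale1r kmul1r.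
have [gya l1] := nbhs_singleton near_lift.
exists (l ya) => //; split; first by rewrite gya /G /= tx.
move=> h; pose h' := 'D_h tau ya.
have Dg : is_derive ya h g ('D_h g ya) by apply/derivableP/diff_derivable.
have DG : is_derive ya h G ('D_h' g' yb).
  split; first exact: diff_derivable.
  by rewrite deriveE // diff_comp //= tx /h' !deriveE.
have := is_derive_kscale DG (is_derive_kdot DG Dg); set k := kdot _ _ + _ => D.
have {}D : is_derive ya h g (kscale ('D_h' g' yb) (l ya) + kscale (G ya) k).
  by apply: near_eq_is_derive D; near=> u; apply/esym;
    have [] : g u = kscale (G u) (l u) /\ inner (l u) (l u) = 1 by near: u.
exists h', (kmul (kconj (l ya)) k); split; last first.
  rewrite (is_derive_unique Dg D) gya; congr (_ + _).
  by rewrite kscaleA -kmulA kmul_conj l1 scale1r kmul1r.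
move=> h0.
(* The opposite transition inverts [tau] near the point, so by the chain rule the differential of
   [tau] is injective. *)
have st : is_derive ya h (sigma \o tau) h.
  apply: near_eq_is_derive (is_derive_id ya h); near=> u.
  have ti : cinv b (tau u) = cinv a u by near: u.
  have [_ ai] : cdom a (cinv a u) /\ cmap a (cinv a u) = u by near: u.
  by rewrite /sigma /= ti ai.
have sd' : differentiable sigma (tau ya) by rewrite tx.
have hE := @derive_val _ _ _ _ _ _ _ st.
have stE := deriveE h (differentiable_comp td sd').
have tE : 'd tau ya h = 0 by rewrite -(deriveE h td).
have dE := congr1 (fun f : E -> E => f h) (diff_comp td sd').
have dE0 (w : E) : w = 0 -> 'd sigma (tau ya) w = 0 by move=> ->; exact: linear0.
exact: (etrans (esym hE) (etrans stE (etrans dE (dE0 _ tE)))).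
Unshelve. all: by end_near. Qed.

Lemma local_lift_at (F : M -> KP R K n) x a W (g : E -> sphere R K n) :
  local_lift F x a W g -> forall y, W y -> lift_at F a y (fun u => val (g u)).
Proof.
move=> [_ [Wo _ gF gs]] y Wy; split; last exact: smooth_differentiable gs Wy.
have : \forall u \near y, W u by exact: open_nbhs_nbhs.
by apply: filterS => u Wu; rewrite sphereP gF // hp_val.
Qed.

Lemma fibre_cancel (z w : V) (l k k' : KK) : inner l l = 1 ->
  kscale w l + kscale (kscale z l) k' = kscale (kscale z l) k -> exists j, w = kscale z j.
Proof.
move=> l1 D; exists (kmul (kmul l (k - k')) (kconj l)).
have e : kscale w l = kscale (kscale z l) (k - k').
  by rewrite kscaleDr kscaleNr -D addrK.
have <- : kscale (kscale w l) (kconj l) = w by exact: kscaleK.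
by rewrite e !kscaleA kmulA.
Qed.

(** [immersion] supplies one suitable chart and lift at x; the comparison of lifts makes injectivity
    available for the lift at hand. *)
Lemma immersion_free (F : M -> KP R K n) a x (g : E -> V) : immersion F ->
  atlas a -> cdom a x -> lift_at F a (cmap a x) g ->
  fibre_free (g (cmap a x)) (fun h => 'D_h g (cmap a x)).
Proof.
move=> Fi Aa ax ga h k.
have [b [W [g' [lift' inj]]]] := Fi x.
have [[Ab bx Wx] _] := lift'.
have ga' := local_lift_at lift' Wx.
have [l l1 [gE dE]] := lift_compare Aa Ab ax bx ga ga'.
have [h' [k' [h0 ->]]] := dE h; rewrite gE => D.
apply/h0/inj; apply/hproj_eq0; first exact: sphereP.
exact: (fibre_cancel l1 D).
Qed.

Lemma unit_normal_orthogonal (F : M -> KP R K n) a x (g : E -> V) v0 :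
  atlas a -> cdom a x -> lift_at F a (cmap a x) g -> horizontal (g (cmap a x)) v0 ->
  is_unit_normal F x (tv (g (cmap a x)) v0) ->
  inner v0 v0 = 1 /\ forall h, inner v0 ('D_h g (cmap a x)) = 0.
Proof.
move=> Aa ax ga gv [b [W [g' [lift' [zv [zvE zv1 zv2 orth]]]]]].
have [[Ab bx Wx] _] := lift'.
have ga' := local_lift_at lift' Wx.
have [l l1 [gE dE]] := lift_compare Aa Ab ax bx ga ga'.
have g1 := (nbhs_singleton ga.1).1.
have [z1 zh] := hbundleP zv.
rewrite -tv_val zv1 in zvE; rewrite zv1 in z1 zh.
have [l' l1' [gE' vE]] := (tv_eq z1 zh g1 gv).1 zvE.
have ll : l' = l.
  have := congr1 (kdot (val (g' (cmap b x)))) gE.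
  by rewrite gE' !kdot_kscaler kdot_self sphereP scale1r !kmul1r.
split; first by rewrite vE inner_kscaler l1' mul1r; exact/enorm1P.
move=> h; have [h' [k [_ ->]]] := dE h.
rewrite innerDr (horizontal_inner k gv) addr0 vE ll inner_kscaler l1 mul1r.
exact: orth.
Qed.

End Lifts.

(** * From the focal radius to a quadric *)

Section Focal.
Context {R : realType} {K : scalars} {n m : nat} {M : manifold R m}.
Local Notation V := 'M[R]_(n.+1, kdim K).
Local Notation E := 'rV[R]_m.
Hypothesis dim_m : (m + kdim K + 1 = n.+1 * kdim K)%N.
Implicit Types (F : M -> KP R K n) (a b : chart R M m) (x : M).

(** Quantifying over all unit lifts makes the condition independent of charts and of lifts of F, and
    open in x. *)
Definition in_quadric F x (T : V -> V) : Prop := \forall x' \near x,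
  forall z, inner z z = 1 -> hp z = F x' -> inner (T z) z = 0.

Lemma unit_normal_foot F x z v : inner z z = 1 -> horizontal z v ->
  is_unit_normal F x (tv z v) -> F x = hp z.
Proof.
move=> z1 zv [a [W [g [lift' [w [wE w1 w2 _]]]]]].
have [[Aa ax Wx] [_ _ gF _]] := lift'.
have [ax' _ _ _] := chart_near Aa ax.
have := gF _ Wx; rewrite ax' => ->; rewrite -hp_val.
have [u1 uh] := hbundleP w; rewrite -tv_val w1 in wE; rewrite w1 in u1 uh.
by have [l l1 [-> _]] := (tv_eq u1 uh z1 zv).1 wE; rewrite hp_kscale.
Qed.

Lemma quadric_near F a x (g : E -> V) (T : V -> V) :
  (forall X l, T (kscale X l) = kscale (T X) l) ->
  atlas a -> cdom a x -> lift_at F a (cmap a x) g ->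
  (\forall y \near cmap a x, inner (T (g y)) (g y) = 0) -> in_quadric F x T.
Proof.
move=> TK Aa ax [gF _] gT.
have [/(_ a Aa)[dao _ inv mapc _] _ _] := atlasP M.
have H : \forall x' \near x, [/\ inner (g (cmap a x')) (g (cmap a x')) = 1,
    F (cinv a (cmap a x')) = hp (g (cmap a x')) &
    inner (T (g (cmap a x'))) (g (cmap a x')) = 0].
  apply: (mapc x ax (fun y => [/\ inner (g y) (g y) = 1, F (cinv a y) = hp (g y) &
    inner (T (g y)) (g y) = 0])).
  by apply: filterS2 gF gT => y [].
have dx : \forall x' \near x, cdom a x' by exact: open_nbhs_nbhs.
apply: filterS2 H dx => x' [g1 Fx' Tg] ax' z z1 zF.
move: Fx'; rewrite inv // -zF => /esym /(hp_eq g1 z1)[l l1 ->].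
by rewrite TK inner_kscaler Tg mulr0.
Qed.

Lemma focal_quadric F nu x : unit_normal_field F nu ->
  (forall t, `|t| < pi / 4 -> immersion (normal_exp nu t)) ->
  exists2 T, kinvolution T & in_quadric F x T.
Proof.
move=> [/(_ x)[a [W [G [[Aa ax Wx] [Wo Wa GE Gs]]]]] nuN] imm.
pose z y := (val (G y)).1; pose v y := (val (G y)).2.
have fstl : linear (fst : V * V -> V) by [].
have sndl : linear (snd : V * V -> V) by [].
have fstc : continuous (fst : V * V -> V) by move=> p; exact: cvg_fst.
have sndc : continuous (snd : V * V -> V) by move=> p; exact: cvg_snd.
have [dz [ddz zC]] : exists dz ddz, second_order W z dz ddz.
  by do 2 eexists; exact: (smooth_second_order fstl fstc Wo Gs).
have [dv [ddv vC]] : exists dv ddv, second_order W v dv ddv.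
  by do 2 eexists; exact: (smooth_second_order sndl sndc Wo Gs).
have z1 y : inner (z y) (z y) = 1 by have [] := hbundleP (G y).
have zv y : horizontal (z y) (v y) by have [] := hbundleP (G y).
have nuE y : W y -> nu (cinv a y) = tv (z y) (v y).
  by move=> Wy; rewrite GE // tv_val.
have [_ _ inva _ _] : is_chart a by have [H _ _] := atlasP M; exact: H.
have cm y : W y -> cdom a (cinv a y) /\ cmap a (cinv a y) = y.
  by move=> /Wa[x' ax' <-]; rewrite inva.
have FE y : W y -> F (cinv a y) = hp (z y).
  by move=> Wy; apply: (unit_normal_foot (z1 y) (zv y)); rewrite -nuE.
have nearW y : W y -> \forall u \near y, W u by move=> Wy; exact: open_nbhs_nbhs.
have zdiff y : W y -> differentiable z y.
  move=> Wy; apply: (@differentiable_comp _ _ _ _ (fun y => val (G y)) fst).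
    exact: smooth_differentiable Gs Wy.
  exact: (@linear_differentiable _ _ _ fst).
have vdiff y : W y -> differentiable v y.
  move=> Wy; apply: (@differentiable_comp _ _ _ _ (fun y => val (G y)) snd).
    exact: smooth_differentiable Gs Wy.
  exact: (@linear_differentiable _ _ _ snd).
have zD y h : W y -> is_derive y h z (dz y h) by case: zC => H _ _ _; exact: H.
have vD y h : W y -> is_derive y h v (dv y h) by case: vC => H _ _ _; exact: H.
have zlift y : W y -> lift_at F a (cmap a (cinv a y)) z.
  move=> Wy; have [_ ->] := cm y Wy; split; last exact: zdiff.
  by apply: filterS (nearW y Wy) => u Wu; split; [exact: z1|exact: FE].
have normal y : W y -> inner (v y) (v y) = 1 /\ forall h, inner (v y) (dz y h) = 0.
  move=> Wy; have [ay cy] := cm y Wy.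
  have [| |v1 vd] := @unit_normal_orthogonal _ _ _ _ _ F a (cinv a y) z (v y) Aa ay (zlift y Wy).
  - by rewrite cy; exact: zv.
  - by rewrite cy -nuE //; exact: nuN.
  split => // h; have := vd h; rewrite cy.
  by rewrite (@derive_val _ _ _ _ _ _ _ (zD y h Wy)).
have nofocal y : W y -> forall t, `|t| < pi / 4 -> forall h l,
    cos t *: dz y h + sin t *: dv y h = kscale (cos t *: z y + sin t *: v y) l -> h = 0.
  move=> Wy t t4 h l; have [ay cy] := cm y Wy.
  (* This is a lift of Phi_t, by the formula for [exp_map] at a unit normal. *)
  pose gt u := cos t *: z u + sin t *: v u.
  have gtD : is_derive y h gt (cos t *: dz y h + sin t *: dv y h).
    exact: (is_deriveD (is_deriveZ (cos t) (zD y h Wy)) (is_deriveZ (sin t) (vD y h Wy))).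
  have gtl : lift_at (normal_exp nu t) a (cmap a (cinv a y)) gt.
    rewrite cy; split; last first.
      by apply: differentiableD; apply: differentiableZ; [exact: zdiff|exact: vdiff].
    apply: filterS (nearW y Wy) => u Wu; have [v1 _] := normal u Wu; split.
      by apply: great_unit => //; exact: horizontal_orth.
    by rewrite /normal_exp nuE // exp_map_tscale.
  have := immersion_free (imm t t4) Aa ay gtl; rewrite cy => free.
  by rewrite -(@derive_val _ _ _ _ _ _ _ gtD); exact: free.
have [T [TI Tz]] := @local_quadric _ _ _ _ dim_m W z v dz dv ddz ddv Wo zC vC
  (fun y _ => z1 y) (fun y Wy => (normal y Wy).1) (fun y _ => (horizontalP _ _).1 (zv y))
  (fun y h Wy => (normal y Wy).2 h) nofocal (cmap a x) Wx.
exists T => //; have [_ _ _ TK] := TI.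
have ax' : cinv a (cmap a x) = x by exact: inva.
have lx := zlift (cmap a x) Wx; rewrite ax' in lx.
apply: (quadric_near TK Aa ax lx).
apply: filterS2 Tz (nearW _ Wx) => y -> Wy.
by rewrite innerNl innerC horizontal_orth ?oppr0.
Qed.

End Focal.

(** * Quadrics of K-linear involutions and their uniqueness *)

Section Quadric.
Context {R : realType} {K : scalars} {n : nat}.
Local Notation V := 'M[R]_(n.+1, kdim K).
Variable T : V -> V.
Hypothesis TI : kinvolution T.

Let Tl : linear T. Proof. by case: TI. Qed.
Let Tsym u w : inner (T u) w = inner u (T w). Proof. by case: TI. Qed.
Let T2 u : T (T u) = u. Proof. by case: TI. Qed.
Let TK u l : T (kscale u l) = kscale (T u) l. Proof. by case: TI. Qed.

Lemma kinvolutionD u w : T (u + w) = T u + T w.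
Proof. exact: linear_add. Qed.

Lemma kinvolutionZ (a : R) u : T (a *: u) = a *: T u.
Proof. exact: linear_scale. Qed.

Lemma kinvolutionN u : T (- u) = - T u.
Proof. exact: linear_opp. Qed.

Lemma kinvolution_inner u w : inner (T u) (T w) = inner u w.
Proof. by rewrite Tsym T2. Qed.

(** By symmetry and K-linearity <T z, z l> is unchanged when l is conjugated, so only Re l
    contributes, and <T z, z> = 0. *)
Lemma kinvolution_horizontal z : inner (T z) z = 0 -> horizontal z (T z).
Proof.
move=> Tz; have H l : inner (T z) (kscale z l) = 0.
  have : inner (T z) (kscale z l) = - inner (T z) (kscale z l).
    rewrite {1}Tsym TK [LHS]innerC inner_kscale_adj kconj_inner1 kscaleDr kscaleNr.
    by rewrite kscaleZr kscale1 innerDr innerNr innerZr Tz mulr0 add0r.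
  by move=> e; lra.
by move=> j; exact: H.
Qed.

(** T z is half the gradient of <T z, z>, so it is the normal inside the quadric; the frame lemmas
    thus apply without a normal field on the hypersurface. *)
Lemma quadric_normal_frame (m : nat) (z : V) (dz : 'rV[R]_m -> V) :
  inner z z = 1 -> inner (T z) z = 0 -> linear dz -> (forall h, inner z (dz h) = 0) ->
  (forall h, inner (T z) (dz h) = 0) ->
  normal_frame z (T z) dz (fun h => T (dz h)).
Proof.
move=> z1 Tz dzl zdz Tdz; have zh := kinvolution_horizontal Tz.
split; first by split; [|rewrite kinvolution_inner|exact/horizontalP].
split=> //.
- by move=> a u w; rewrite dzl Tl.
- by move=> h; rewrite kinvolution_inner.
- move=> h l; rewrite Tsym TK [inner (T z) _]innerC inner_kscale_adj kconj_inner1.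
  rewrite kscaleDr kscaleNr kscaleZr kscale1 innerDr innerNr innerZr (innerC _ (T z)).
  by rewrite Tdz mulr0 add0r addrN.
- by move=> h k; rewrite innerC Tsym.
Qed.

(** z and T z are orthonormal, so neither their sum nor their difference vanishes. *)
Lemma kinvolution_eigenvectors z : inner z z = 1 -> inner (T z) z = 0 ->
  exists a b, [/\ a != 0, T a = a, b != 0 & T b = - b].
Proof.
move=> z1 Tz; exists (z + T z), (z - T z); split.
- rewrite -inner_eq0 !innerE kinvolution_inner z1 Tz (innerC z) Tz; lra.
- by rewrite kinvolutionD T2 addrC.
- rewrite -inner_eq0 !innerE kinvolution_inner z1 Tz (innerC z) Tz; lra.
- by rewrite kinvolutionD kinvolutionN T2 opprB.
Qed.

End Quadric.

Section NormalLine.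
Context {R : realType} {K : scalars} {n m : nat}.
Local Notation V := 'M[R]_(n.+1, kdim K).
Hypothesis dim_m : (m + kdim K + 1 = n.+1 * kdim K)%N.

(** The remainder of w after subtracting its v-component is orthogonal to each of the three parts of
    the frame. *)
Lemma normal_line (z v w : V) (dz dv : 'rV[R]_m -> V) : normal_frame z v dz dv ->
  fibre_free z dz -> horizontal z w -> (forall h, inner w (dz h) = 0) ->
  w = inner w v *: v.
Proof.
move=> F free wz wdz; have [[z1 v1 zv] [_ _ D _ _]] := F.
apply/eqP; rewrite -subr_eq0 -inner_eq0; apply/eqP; set u := w - _.
have [h [l [s uE]]] := frame_span dim_m F free u.
have uv : inner u v = 0 by rewrite /u innerDl innerNl innerZl v1 mulr1 subrr.
have udz : inner u (dz h) = 0.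
  by have [_ vdz _] := D h; rewrite /u innerDl innerNl innerZl wdz vdz mulr0 subr0.
have uz : inner u (kscale z l) = 0.
  by rewrite /u innerDl innerNl innerZl !horizontal_inner ?mulr0 ?subr0 //; exact/horizontalP.
by rewrite {2}uE !innerDr innerZr udz uz uv mulr0 !addr0.
Qed.

End NormalLine.

Section ImmersedQuadric.
Context {R : realType} {K : scalars} {n m : nat} {M : manifold R m}.
Local Notation V := 'M[R]_(n.+1, kdim K).
Local Notation E := 'rV[R]_m.
Hypothesis dim_m : (m + kdim K + 1 = n.+1 * kdim K)%N.
Implicit Types (F : M -> KP R K n) (a b : chart R M m) (x : M) (W : set E) (g : E -> V).

Definition immersed_lift F a W g : Prop :=
  [/\ open W, forall y, W y -> F (cinv a y) = hp (g y),
      forall y, W y -> inner (g y) (g y) = 1, forall y, W y -> differentiable g y &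
      forall y, W y -> fibre_free (g y) (fun h => 'D_h g y)].

Lemma immersion_lift F x : immersion F -> exists a W g,
  [/\ atlas a, cdom a x, W (cmap a x), immersed_lift F a W g &
      forall y, W y -> cinv a u @[u --> y] --> cinv a y].
Proof.
move=> Fi; have [a [W [g [lift' _]]]] := Fi x.
have [[Aa ax Wx] [Wo Wa gF gs]] := lift'.
exists a, W, (fun y => val (g y)).
have [_ _ inva _ invc] : is_chart a by have [H _ _] := atlasP M; exact: H.
split=> //; last by move=> y /Wa; exact: invc.
split=> //.
- by move=> y Wy; rewrite gF // hp_val.
- by move=> y Wy; exact: sphereP.
- by move=> y Wy; exact: smooth_differentiable gs Wy.
move=> y Wy; have [x' ax' yE] := Wa y Wy.
have := local_lift_at lift' Wy; rewrite -yE => ga.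
exact: immersion_free ga.
Qed.

Lemma lift_derive a W g F y h : immersed_lift F a W g -> W y ->
  is_derive y h g ('D_h g y) /\ linear (fun h => 'D_h g y).
Proof.
move=> [_ _ _ gd _] Wy; split; first exact/derivableP/diff_derivable/gd.
by move=> c u w; rewrite !deriveE ?linearP //; exact: gd.
Qed.

Lemma immersed_quadric_frame F a W g T y : kinvolution T -> immersed_lift F a W g ->
  W y -> (\forall u \near y, inner (T (g u)) (g u) = 0) ->
  normal_frame (g y) (T (g y)) (fun h => 'D_h g y) (fun h => T ('D_h g y)).
Proof.
move=> TI gl Wy Tg; have [Wo gF g1 gd gfree] := gl.
have [Tl Tsym _ _] := TI.
have [_ dl] := lift_derive 0 gl Wy.
apply: (quadric_normal_frame TI) => //; first exact: g1.
- exact: nbhs_singleton Tg.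
- move=> h; have [D _] := lift_derive h gl Wy.
  have nW : \forall u \near y, inner (g u) (g u) = 1.
    by apply: filterS (open_nbhs_nbhs (conj Wo Wy)) => u; exact: g1.
  by have := derive_inner_cst nW D D; rewrite innerC => e; lra.
move=> h; have [D _] := lift_derive h gl Wy.
have DT := is_derive_linear Tl (linear_mx_continuous Tl) D.
have := derive_inner_cst Tg DT D.
by rewrite /= Tsym innerC => e; lra.
Qed.

(** Along the lift both T g and T' g are the unit normal, so T' g = e T g with e = 1 or -1, and e is
    constant nearby by continuity. Differentiating gives T' = e T on tangent vectors; K-linearity
    and T^2 = T'^2 = 1 settle the fibre and normal parts. *)
Lemma quadric_unique F x T T' : immersion F -> kinvolution T -> kinvolution T' ->
  in_quadric F x T -> in_quadric F x T' ->
  (forall X, T' X = T X) \/ (forall X, T' X = - T X).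
Proof.
move=> Fi TI TI' FT FT'; have [a [W [g [Aa ax Wx gl ac]]]] := immersion_lift x Fi.
have [Wo gF g1 gd gfree] := gl; set y0 := cmap a x in Wx.
have ax' : cinv a y0 = x.
  by have [H _ _] := atlasP M; have [_ _ + _ _] := H a Aa; apply.
have quad S : in_quadric F x S -> \forall y \near y0, inner (S (g y)) (g y) = 0.
  move=> FS; have ac0 : cinv a u @[u --> y0] --> x by rewrite -[X in _ --> X]ax'; exact: ac.
  have H : \forall y \near y0, forall z, inner z z = 1 -> hp z = F (cinv a y) ->
      inner (S z) z = 0 by exact: (ac0 _ FS).
  have nW : \forall y \near y0, W y by exact: open_nbhs_nbhs.
  apply: filterS2 H nW => y H Wy.
  by apply: H; [exact: g1|rewrite gF].
have q := quad _ FT; have q' := quad _ FT'.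
have [Tl Tsym T2 TK] := TI; have [Tl' Tsym' T2' TK'] := TI'.
have nW : \forall y \near y0, W y by exact: open_nbhs_nbhs.
pose e y := inner (T' (g y)) (T (g y)).
have T'E : \forall y \near y0, T' (g y) = e y *: T (g y) /\ e y ^+ 2 = 1.
  have qi := nbhs_interior q; have qi' := nbhs_interior q'.
  apply: filterS3 nW qi qi' => y Wy qy qy'.
  have F1 := immersed_quadric_frame TI gl Wy qy.
  have F2 := immersed_quadric_frame TI' gl Wy qy'.
  have E1 : T' (g y) = e y *: T (g y).
    apply: (normal_line dim_m F1 (gfree y Wy)).
      exact: kinvolution_horizontal (nbhs_singleton qy').
    by case: F2 => _ [_ _ D _ _] h; have [] := D h.
  split=> //; have := kinvolution_inner TI' (g y) (g y).
  by rewrite E1 !innerE (kinvolution_inner TI) g1 // mulr1 expr2.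
have gc : g u @[u --> y0] --> g y0 by exact: differentiable_continuous (gd y0 Wx).
have ec : e u @[u --> y0] --> e y0.
  have c : T (g u) @[u --> y0] --> T (g y0).
    exact: (cvg_comp _ _ gc (linear_mx_continuous Tl (x := g y0))).
  have c' : T' (g u) @[u --> y0] --> T' (g y0).
    exact: (cvg_comp _ _ gc (linear_mx_continuous Tl' (x := g y0))).
  exact: cvg_inner c' c.
have [_ e0] := nbhs_singleton T'E.
have ecst : \forall y \near y0, T' (g y) = e y0 *: T (g y).
  (* Opposite signs differ by 2, so values closer than 1 coincide. *)
  have /cvgrPdist_lt/(_ 1 ltr01) eclose := ec.
  apply: filterS2 T'E eclose => y [-> ey] close; congr (_ *: _).
  move: ey e0 close => /eqP + /eqP; rewrite !sqrf_eq1.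
  move=> /orP[/eqP ->|/eqP ->] /orP[/eqP ->|/eqP ->] //.
    by rewrite -opprD normrN ger0_norm; lra.
  by rewrite opprK ger0_norm; lra.
have [D _] := lift_derive 0 gl Wx.
have TX X : T' X = e y0 *: T X.
  have F1 := immersed_quadric_frame TI gl Wx q.
  have [h [l [s ->]]] := frame_span dim_m F1 (gfree y0 Wx) X.
  have Dh := (lift_derive h gl Wx).1.
  have TDh := is_derive_linear Tl (linear_mx_continuous Tl) Dh.
  have TDh' := is_derive_linear Tl' (linear_mx_continuous Tl') Dh.
  have dE : T' ('D_h g y0) = e y0 *: T ('D_h g y0).
    apply: is_derive_unique TDh' _.
    apply: near_eq_is_derive (is_deriveZ (e y0) TDh).
    by apply: filterS ecst => y /= ->.
  have gE := nbhs_singleton ecst.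
  have TgE : T (g y0) = e y0 *: T' (g y0) by rewrite gE scalerA -expr2 e0 scale1r.
  rewrite !(kinvolutionD TI) !(kinvolutionD TI') !(kinvolutionZ TI) !(kinvolutionZ TI').
  have T'Tg : T' (T (g y0)) = e y0 *: g y0 by rewrite TgE (kinvolutionZ TI') T2'.
  rewrite dE TK TK' T'Tg gE T2 kscaleZl !scalerDr !scalerA.
  by rewrite (mulrC s).
move: e0 => /eqP; rewrite sqrf_eq1 => /orP[/eqP e1|/eqP e1]; [left|right] => X.
  by rewrite TX e1 scale1r.
by rewrite TX e1 scaleN1r.
Qed.

End ImmersedQuadric.

(** * Openness of the image in the quadric *)

Section IsolatedZero.
Context {R : realType} {m : nat} {W : normedModType R}.
Local Notation E := 'rV[R]_m.

(** P is a single radius for spheres and a half-line for balls. *)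
Lemma norm_level_compact (y0 : E) (P : set R) (r : R) : closed P ->
  (forall s, P s -> s <= r) -> compact [set y : E | P `|y - y0|].
Proof.
move=> Pc Pr; apply: bounded_closed_compact.
  exists (`|y0| + r); split; first exact: num_real.
  move=> b b1 y /= /Pr yr; apply: le_trans (ltW b1).
  by rewrite -[y in leLHS](subrK y0) addrC (le_trans (ler_normD _ _)) // lerD2l.
have -> : [set y : E | P `|y - y0|] = (fun y : E => `|y - y0|) @^-1` P by [].
apply: closed_comp => // y _.
have c1 : (fun u : E => u) @ y --> y by exact: cvg_id.
have c2 : (fun _ : E => y0) @ y --> y0 by exact: cst_continuous.
exact: (cvg_norm (cvgB (FF := nbhs_filter y) c1 c2)).
Qed.

(** By compactness of the unit sphere an injective differential satisfies c |h| <= |dH h| with c >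
    0, while the remainder of the first-order expansion is at most (c / 2) |h| near y0. *)
Lemma isolated_zero (H : E -> W) (y0 : E) : differentiable H y0 ->
  (forall h, 'd H y0 h = 0 -> h = 0) -> \forall y \near y0, H y = H y0 -> y = y0.
Proof.
move=> Hd dH0; have /diff_locallyP[dc /eqaddoP ho] := Hd.
have [c c0 cH] : exists2 c : R, 0 < c & forall h, c * `|h| <= `|'d H y0 h|.
  have [A0|A0] := pselect (exists h : E, `|h| = 1).
    have Ac : compact [set h : E | [set 1] `|h - 0|].
      have le1 s : [set (1 : R)] s -> s <= 1 by move=> ->.
      have c1 : closed [set (1 : R)] by exact: closed_eq.
      exact: norm_level_compact c1 le1.
    have A1 : [set h : E | [set 1] `|h - 0|] !=set0.
      by have [h h1] := A0; exists h; rewrite /= subr0.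
    have [|h0 + hmin] := @EVT_min_rV R m (fun h => `|'d H y0 h|) _ A1 Ac.
      by apply: continuous_subspaceT => h; exact: (cvg_norm (dc h)).
    rewrite inE /= subr0 => h01; exists `|'d H y0 h0|.
      rewrite normr_gt0; apply/eqP => /dH0 h00; move: h01; rewrite h00 normr0 => /eqP.
      by rewrite eq_sym oner_eq0.
    move=> h; have [->|hn0] := eqVneq h 0; first by rewrite normr0 mulr0.
    have hn : 0 < `|h| by rewrite normr_gt0.
    have h1 : `| `|h|^-1 *: h| = 1.
      by rewrite normrZ ger0_norm ?invr_ge0 // mulVf // lt0r_neq0.
    have := hmin (`|h|^-1 *: h); rewrite inE /= subr0 h1 => /(_ erefl).
    by rewrite linearZ normrZ ger0_norm ?invr_ge0 // mulrC ler_pdivlMr.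
  (* Without unit vectors the space is zero and any constant works. *)
  exists 1 => // h; have [->|hn0] := eqVneq h 0; first by rewrite normr0 mulr0.
  exfalso; apply: A0; exists (`|h|^-1 *: h).
  by rewrite normrZ ger0_norm ?invr_ge0 // mulVf // normr_eq0.
have c2 : 0 < c / 2 by rewrite divr_gt0.
have near0 : \forall h \near (0 : E), `|H (h + y0) - (H y0 + 'd H y0 h)| <= c / 2 * `|h|.
  exact: ho (c / 2) c2.
have : \forall y \near y0, `|H y - (H y0 + 'd H y0 (y - y0))| <= c / 2 * `|y - y0|.
  move: near0; rewrite (near_shift y0) => near0; apply: filterS near0 => y; rewrite /=.
  by rewrite sub0r subrK.
apply: filterS => y Hy yE; apply/eqP; rewrite -subr_eq0 -normr_le0.
move: Hy; rewrite yE opprD addrA subrr sub0r normrN => Hy.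
have := le_trans (cH (y - y0)) Hy; have := normr_ge0 (y - y0); nra.
Qed.

End IsolatedZero.

Section OpenImage.
Context {R : realType} {K : scalars} {n m : nat} {M : manifold R m}.
Local Notation KK := 'rV[R]_(kdim K).
Local Notation V := 'M[R]_(n.+1, kdim K).
Local Notation E := 'rV[R]_m.
Hypothesis dim_m : (m + kdim K + 1 = n.+1 * kdim K)%N.

Lemma enormD (p q : nat) (x y : 'M[R]_(p, q)) : enorm (x + y) <= enorm x + enorm y.
Proof.
rewrite -ler_sqr ?nnegrE ?addr_ge0 ?enorm_ge0 // enorm_sqr sqrrD !enorm_sqr.
rewrite !innerE (innerC y x); have := le_inner_enorm x y.
by move=> H; rewrite mulr2n; lra.
Qed.

Lemma enorm_kdot_le (z w : V) : enorm (kdot z w) <= enorm z * enorm w.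
Proof. by rewrite /enorm -sqrtrM ?inner_ge0 //; apply: ler_wsqrtr; exact: kdot_le. Qed.

Lemma enorm_continuous (p q : nat) (T : Type) (F : set_system T) {FF : Filter F}
  (f : T -> 'M[R]_(p, q)) a : f @ F --> a -> enorm (f t) @[t --> F] --> enorm a.
Proof.
by move=> fa; exact: (cvg_comp _ _ (cvg_inner fa fa) (@sqrt_continuous R _)).
Qed.

Lemma kdot_pythagoras (z w : V) : inner z z = 1 ->
  inner w w = inner (hproj z w) (hproj z w) + inner (kdot z w) (kdot z w).
Proof.
move=> z1; have h := horizontal_hproj w z1.
have : w = hproj z w + kscale z (kdot z w) by rewrite hprojE subrK.
move: (hproj z w) h (kdot z w) => a za k wE; rewrite {1 2}wE !innerDl !innerDr.
rewrite (innerC (kscale z k) a) (horizontal_inner _ za) inner_kscalel z1 mul1r.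
by rewrite addr0 add0r.
Qed.

Lemma hproj_continuous (z : V) : continuous (hproj z).
Proof.
have l : linear (hproj z) by move=> a u w; rewrite hprojD hprojZ.
by move=> w; exact: linear_mx_continuous.
Qed.

(* At an interior maximum y of |<g y, w>|, the horizontal component of the aligned
   vector w is orthogonal to dg, hence a multiple s T(g y) of the normal; the
   equation <T w, w> = 0 then forces s = 0. *)
Lemma critical_fibre (F : M -> KP R K n) a W (g : E -> V) T y w : kinvolution T ->
  immersed_lift F a W g -> W y -> (\forall u \near y, inner (T (g u)) (g u) = 0) ->
  inner w w = 1 -> inner (T w) w = 0 -> 0 < enorm (kdot (g y) w) ->
  (forall h, inner w (kscale ('D_h g y) (kdot (g y) w)) = 0) -> hp w = hp (g y).
Proof.
move=> TI gl Wy Tg w1 Tw d0 wdg; have [Wo gF g1 gd gfree] := gl.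
have [Tl Tsym T2 TK] := TI.
have Fr := immersed_quadric_frame TI gl Wy Tg.
have [[z1 v1 zv] [dzl _ D _ _]] := Fr.
have [l l1 lE] := kmul_enorm (kdot (g y) w).
set d := enorm _ in d0 lE.
pose w' := kscale w l; have w'1 : inner w' w' = 1 by rewrite inner_kscaler l1 mul1r.
have kw' : kdot (g y) w' = d *: kone by rewrite kdot_kscaler.
pose u := w' - d *: g y.
have uz : horizontal (g y) u.
  by apply/horizontalP; rewrite kdotDr kdotNr kdotZr kw' kdot_self z1 scale1r subrr.
have dE : kdot (g y) w = d *: kconj l.
  by rewrite -[LHS]kmulr1 -[kone](scale1r) -l1 -kmul_conj -kmulA lE kmulZl kmul1r.
have udz h : inner u ('D_h g y) = 0.
  have [zdz _ _] := D h.
  rewrite innerDl innerNl innerZl zdz mulr0 subr0 /w' inner_kscale_adj.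
  have := wdg h; rewrite dE kscaleZr innerZr => /eqP.
  by rewrite mulf_eq0 gt_eqF //= => /eqP.
have uE := normal_line dim_m Fr (gfree y Wy) uz udz.
set s := inner u _ in uE.
have w'E : w' = d *: g y + s *: T (g y) by rewrite -uE /u addrC subrK.
have Tw' : inner (T w') w' = 0 by rewrite /w' TK inner_kscaler Tw mulr0.
have s0 : s = 0.
  move: Tw'; rewrite w'E (kinvolutionD TI) !(kinvolutionZ TI) T2 !innerE v1 z1.
  have zTz := nbhs_singleton Tg; rewrite (innerC (g y) (T (g y))) zTz.
  rewrite !mulr0 !mulr1 addr0 add0r => e.
  have /eqP : d * s = 0 by lra.
  by rewrite mulf_eq0 gt_eqF //= => /eqP.
have d1 : d = 1.
  have := w'1; rewrite w'E s0 scale0r addr0 innerZl innerZr z1 mulr1 => /eqP.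
  rewrite -expr2 sqrf_eq1 => /orP[/eqP //|/eqP e]; move: d0; rewrite e; lra.
have w'g : w' = g y by rewrite w'E s0 d1 scale0r addr0 scale1r.
by rewrite -w'g /w' hp_kscale.
Qed.

Lemma interior_max (a : R -> R) (da : R) (del : R) : 0 < del ->
  (forall t, `|t| < del -> derivable a t 1) -> is_derive (0 : R) (1 : R) a da ->
  (forall t, `|t| < del -> a t <= a 0) -> da = 0.
Proof.
move=> del0 ad a0 amax.
have itv t : (t \in `]- del, del[) = (`|t| < del) by rewrite in_itv /= ltr_norml.
have c0 : (0 : R) \in `]- del, del[ by rewrite itv normr0.
have ab : - del <= del by lra.
apply: is_derive_unique a0 _.
apply: (derive1_at_max ab) => // t; rewrite itv; [exact: ad|exact: amax].
Qed.

(** The squared modulus is differentiated, as the modulus need not be differentiable where it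
    vanishes. The strict inequality on y1 leaves room for a segment through y1 in every direction
    h. *)
Lemma maximum_critical (g : E -> V) (W : set E) y0 y1 r w :
  (forall y, `|y - y0| <= r -> W y) -> (forall y h, W y -> is_derive y h g ('D_h g y)) ->
  `|y1 - y0| < r ->
  (forall y, `|y - y0| <= r -> enorm (kdot (g y) w) <= enorm (kdot (g y1) w)) ->
  forall h, inner w (kscale ('D_h g y1) (kdot (g y1) w)) = 0.
Proof.
move=> rW gD y1r gmax h.
pose f y := inner (kdot (g y) w) (kdot (g y) w).
have fD y k : W y -> is_derive y k f
    (2 * inner (kdot ('D_k g y) w) (kdot (g y) w)).
  move=> Wy; have D := is_derive_kdot (gD y k Wy) (is_derive_cst w y k).
  apply: (is_derive_eq (is_derive_inner D D)).
  have -> : kdot (g y) (0 : V) = 0 by have := kdotZr 0 (g y) 0; rewrite !scale0r.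
  by rewrite addr0 [X in _ + X]innerC; ring.
pose del := (r - `|y1 - y0|) / (`|h| + 1).
have h1 : 0 < `|h| + 1 by have := normr_ge0 h; lra.
have del0 : 0 < del by rewrite divr_gt0 // subr_gt0.
have seg t : `|t| < del -> `|t *: h + y1 - y0| <= r.
  rewrite /del ltr_pdivlMr // => tr; rewrite -addrA.
  apply: le_trans (ler_normD _ _) _; rewrite normrZ.
  have := normr_ge0 t; lra.
have LD t : `|t| < del -> is_derive t (1 : R) (fun s => f (s *: h + y1))
    (2 * inner (kdot ('D_h g (t *: h + y1)) w) (kdot (g (t *: h + y1)) w)).
  by move=> /seg/rW Wt; apply: is_derive_line; exact: fD.
have c0 : `|0 : R| < del by rewrite normr0.
have := LD 0 c0; rewrite scale0r add0r => L0.
have := interior_max del0 _ L0 _.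
have -> : inner w (kscale ('D_h g y1) (kdot (g y1) w)) =
    inner (kdot ('D_h g y1) w) (kdot (g y1) w) by rewrite -inner_kdot innerC.
move=> H; suff : 2 * inner (kdot ('D_h g y1) w) (kdot (g y1) w) = 0 by lra.
apply: H; first by move=> t /LD D; exact: ex_derive.
move=> t /seg tr; rewrite scale0r add0r /f -!enorm_sqr ler_sqr ?nnegrE ?enorm_ge0 //.
exact: gmax.
Qed.

(** For w in the quadric, |<g y, w>| is maximized over a closed ball around y0. On the boundary |<g
    y, g y0>| stays below some eta < 1, so for w close to the fibre of z0 the maximum is interior,
    and [critical_fibre] places it on the fibre of w. *)
Lemma open_image (F : M -> KP R K n) x T z0 : immersion F -> kinvolution T ->
  (forall x', in_quadric F x' T) -> inner z0 z0 = 1 -> hp z0 = F x ->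
  exists2 e, 0 < e & forall w, inner w w = 1 -> inner (T w) w = 0 ->
    1 - e < enorm (kdot z0 w) -> exists x', F x' = hp w.
Proof.
move=> Fi TI FT z01 z0F; have [a [W [g [Aa ax Wx gl ac]]]] := immersion_lift x Fi.
have [Wo gF g1 gd gfree] := gl; set y0 := cmap a x in Wx.
have ax' : cinv a y0 = x.
  by have [H _ _] := atlasP M; have [_ _ + _ _] := H a Aa; apply.
have [l l1 gy0] : exists2 l : KK, inner l l = 1 & g y0 = kscale z0 l.
  by apply/hp_eq => //; [exact: g1|rewrite z0F -gF // ax'].
have gD y h : W y -> is_derive y h g ('D_h g y).
  by move=> Wy; have [] := lift_derive h gl Wy.
have quad y : W y -> \forall u \near y, inner (T (g u)) (g u) = 0.
  move=> Wy; have H : \forall u \near y, forall z, inner z z = 1 -> hp z = F (cinv a u) ->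
      inner (T z) z = 0 by exact: (ac y Wy _ (FT _)).
  have nW : \forall u \near y, W u by exact: open_nbhs_nbhs.
  by apply: filterS2 H nW => u H Wu; apply: H; [exact: g1|rewrite gF].
have [_ dl] := lift_derive 0 gl Wx.
(* H vanishes exactly when g y lies on the fibre of g y0. As its differential at y0 is injective, no
   other point near y0 has the same image. *)
pose H y := hproj (g y0) (g y).
have hl : linear (hproj (g y0)) by move=> c u w; rewrite hprojD hprojZ.
have gy01 : inner (g y0) (g y0) = 1 by exact: g1.
have Hd : differentiable H y0.
  pose L : {linear V -> V} := HB.pack (hproj (g y0)) (GRing.isLinear.Build _ _ _ _ _ hl).
  apply: (@differentiable_comp _ _ _ _ g L); first exact: gd.
  by apply: linear_differentiable; exact: hproj_continuous.
have HD h : 'd H y0 h = hproj (g y0) ('D_h g y0).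
  rewrite -deriveE //; have D := is_derive_linear hl (@hproj_continuous (g y0)) (gD y0 h Wx).
  exact: (@derive_val _ _ _ _ _ _ _ D).
have iso := isolated_zero Hd.
have {iso} : \forall y \near y0, H y = H y0 -> y = y0.
  apply: iso => h; rewrite HD => /(hproj_eq0 _ gy01)[k]; exact: gfree.
move=> iso; have nW : \forall y \near y0, W y by exact: open_nbhs_nbhs.
have /nbhs_ballP[r' /= r'0 r'P] : \forall y \near y0, W y /\ (H y = H y0 -> y = y0).
  by apply: filterS2 nW iso => y.
pose r := r' / 2; have r0 : 0 < r by rewrite divr_gt0.
have rP y : `|y - y0| <= r -> W y /\ (H y = H y0 -> y = y0).
  move=> yr; apply: r'P; rewrite -ball_normE /ball_ /= distrC.
  by apply: le_lt_trans yr _; rewrite /r; lra.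
have kc y w : W y -> enorm (kdot (g u) w) @[u --> y] --> enorm (kdot (g y) w).
  move=> Wy; have wc : (fun _ : E => w) @ y --> w by exact: cst_continuous.
  have gc : g u @[u --> y] --> g y by exact: differentiable_continuous (gd y Wy).
  have kk := cvg_kdot (FF := nbhs_filter y) gc wc.
  exact: (enorm_continuous (FF := nbhs_filter y) kk).
have within (P : set R) w : (forall s, P s -> s <= r) ->
    {within [set y | P `|y - y0|], continuous (fun y => enorm (kdot (g y) w))}.
  move=> Pr; apply: continuous_in_subspaceT => y; rewrite inE /= => /Pr yr.
  by apply: kc; have [] := rP y yr.
have Pr1 s : [set r] s -> s <= r by move=> ->.
have cP1 : closed [set r] by exact: closed_eq.
have Pr2 s : [set s | s <= r] s -> s <= r by [].
have cP2 : closed [set s : R | s <= r] by exact: closed_le.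
have [eta [eta0 eta1 etaP]] : exists eta, [/\ 0 <= eta, eta < 1 &
    forall y, `|y - y0| = r -> enorm (kdot (g y) (g y0)) <= eta].
  have [S0|S0] := pselect ([set y | [set r] `|y - y0|] !=set0); last first.
    by exists 0; split => // y yr; exfalso; apply: S0; exists y.
  have [y' + y'max] := EVT_max_rV S0 (norm_level_compact cP1 Pr1) (within [set r] (g y0) Pr1).
  rewrite inE /= => y'r.
  exists (enorm (kdot (g y') (g y0))); split; first exact: enorm_ge0.
    have y'r' : `|y' - y0| <= r by rewrite y'r.
    have [Wy' Hy'] := rP y' y'r'.
    rewrite -(expr_lt1 (ltn0Sn 1) (enorm_ge0 _)) enorm_sqr kdotC inner_kconj.
    have := kdot_pythagoras (g y') gy01; rewrite (g1 y' Wy') -/(H y') => e.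
    suff : 0 < inner (H y') (H y') by lra.
    rewrite lt_def inner_ge0 andbT inner_eq0; apply/eqP => Hy0.
    have Hg : H y0 = 0.
      by rewrite /H hprojE kdot_self gy01 scale1r kscale1 subrr.
    have y'y0 := Hy' (etrans Hy0 (esym Hg)).
    by move: y'r; rewrite y'y0 subrr normr0 => e'; move: r0; rewrite -e' ltxx.
  by move=> y yr; apply: y'max; rewrite inE.
(* The condition d > 1 - del^2 / 2 gives |w - g y0|^2 = 2 - 2 d < del^2, so the boundary values are
   at most eta + del = 1 - del, which is less than 1 - del^2 / 2 and hence less than d. *)
pose del := (1 - eta) / 2; have del0 : 0 < del by rewrite divr_gt0 // subr_gt0.
have del1 : del <= 1 / 2 by rewrite /del; lra.
have e0 : 0 < del ^+ 2 / 2 by rewrite divr_gt0 // exprn_gt0.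
exists (del ^+ 2 / 2) => // w0 w01 Tw0 w0e.
have [_ _ _ TK] := TI.
have [k k1 kE] := kmul_enorm (kdot (g y0) w0).
pose w := kscale w0 k.
have w1 : inner w w = 1 by rewrite inner_kscaler k1 mul1r.
have Tw : inner (T w) w = 0 by rewrite /w TK inner_kscaler Tw0 mulr0.
have <- : hp w = hp w0 by exact: hp_kscale.
set d := enorm (kdot (g y0) w0) in kE.
have kw : kdot (g y0) w = d *: kone by rewrite kdot_kscaler.
have d0 : 0 <= d by exact: enorm_ge0.
have ekw : enorm (kdot (g y0) w) = d.
  by rewrite kw enormZ enorm_kone mulr1 ger0_norm.
have dgt : 1 - del ^+ 2 / 2 < d.
  by rewrite /d gy0 -[w0]kscale1 enorm_kdot_kscale // inner_kone.
have close : enorm (w - g y0) <= del.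
  rewrite -ler_sqr ?nnegrE ?enorm_ge0 ?(ltW del0) // enorm_sqr !innerE w1 gy01.
  have wg : inner w (g y0) = d.
    by rewrite -[g y0]kscale1 -inner_kdot kw innerZr inner_kone mulr1.
  by rewrite (innerC (g y0) w) wg; lra.
have small y : `|y - y0| = r -> enorm (kdot (g y) w) < enorm (kdot (g y0) w).
  move=> yr; have [Wy _] : W y /\ (H y = H y0 -> y = y0) by apply: rP; rewrite yr.
  have -> : kdot (g y) w = kdot (g y) (g y0) + kdot (g y) (w - g y0).
    by rewrite -kdotDr addrC subrK.
  have b1 := enormD (kdot (g y) (g y0)) (kdot (g y) (w - g y0)).
  have b2 := enorm_kdot_le (g y) (w - g y0).
  rewrite ((enorm1P (g y)).2 (g1 y Wy)) mul1r in b2.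
  have b3 := etaP y yr; rewrite ekw.
  have dd : del ^+ 2 <= del by rewrite expr2 -[leRHS]mulr1 ler_wpM2l // ?(ltW del0) //; lra.
  by move: b1 b2 b3 close dgt dd; rewrite /del; lra.
have y0r : [set y | [set s | s <= r] `|y - y0|] y0.
  by rewrite /= subrr normr0 ltW.
have [y1 + y1max] := EVT_max_rV (ex_intro _ y0 y0r)
  (norm_level_compact cP2 Pr2) (within [set s | s <= r] w Pr2).
rewrite inE /= => y1r.
have y1max' y : `|y - y0| <= r -> enorm (kdot (g y) w) <= enorm (kdot (g y1) w).
  by move=> yr; apply: y1max; rewrite inE.
have y0max := y1max' y0 y0r.
have y1lt : `|y1 - y0| < r.
  rewrite lt_def y1r andbT; apply/eqP => e.
  by have := small y1 (esym e); rewrite ltNge y0max.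
have [Wy1 _] := rP y1 y1r.
exists (cinv a y1); rewrite gF //; apply/esym.
apply: (critical_fibre TI gl Wy1 (quad y1 Wy1) w1 Tw).
  apply: lt_le_trans y0max; rewrite ekw; apply: le_lt_trans dgt.
  have : del ^+ 2 <= 1 by rewrite expr_le1 // ?ltW //; lra.
  by lra.
apply: (maximum_critical (W := W) (y0 := y0) (r := r)) => //.
by move=> y yr; have [] := rP y yr.
Qed.

End OpenImage.

(** * Local congruence *)

Section UnitaryIsometry.
Context {R : realType} {K : scalars} {n : nat}.
Local Notation V := 'M[R]_(n.+1, kdim K).

Definition unitary_map (B : V -> V) (p : KP R K n) : KP R K n := hp (B (val (repr p))).

Variable B : V -> V.
Hypothesis BU : unitary B.

Lemma unitary_inner z w : inner (B z) (B w) = inner z w.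
Proof.
case: BU => Bdot _ _.
by rewrite -[B z]kscale1 innerC -inner_kdot Bdot inner_kdot kscale1 innerC.
Qed.

Lemma unitary_map_hp z : inner z z = 1 -> unitary_map B (hp z) = hp (B z).
Proof.
move=> z1; case: BU => _ BK _; rewrite /unitary_map; set w := val _.
have w1 : inner w w = 1 by exact: sphereP.
have : hp w = hp z by rewrite hp_val /hopf reprK.
move=> /(hp_eq w1 z1)[l l1 ->].
by rewrite BK hp_kscale ?unitary_inner.
Qed.

Lemma unitary_isometry : Defs.isometry (unitary_map B).
Proof.
case: BU => Bdot _ Bsurj; split=> [p q|q].
  have [z z1 <-] := hp_surj p; have [w w1 <-] := hp_surj q.
  by rewrite !unitary_map_hp // !dist_hp ?unitary_inner // Bdot.
have [w w1 <-] := hp_surj q; have [z zE] := Bsurj w.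
have z1 : inner z z = 1 by rewrite -unitary_inner zE.
by exists (hp z); rewrite unitary_map_hp // zE.
Qed.

End UnitaryIsometry.

Section OpenCap.
Context {R : realType} {K : scalars} {n : nat}.
Local Notation V := 'M[R]_(n.+1, kdim K).

(** The quotient topology tests the preimage in the sphere. As |<u, w>| does not depend on the lift
    w, that preimage is the trace of an open subset of K^(n+1). *)
Lemma open_cap (u : V) (e : R) : open [set p : KP R K n |
  exists w, [/\ inner w w = 1, hp w = p & e < enorm (kdot u w)]].
Proof.
rewrite /open /= /quotient_open.
have Wo : open [set w : V | e < enorm (kdot u w)].
  have -> : [set w : V | e < enorm (kdot u w)] =
    (fun w => enorm (kdot u w)) @^-1` [set s | e < s] by [].
  apply: open_comp; last exact: open_gt.
  move=> w _.
  have c1 : (fun _ : V => u) @ w --> u by exact: cst_continuous.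
  have c2 : (fun x : V => x) @ w --> w by exact: cvg_id.
  have kk := cvg_kdot (FF := nbhs_filter w) c1 c2.
  exact: (enorm_continuous (FF := nbhs_filter w) kk).
exists [set w : V | e < enorm (kdot u w)] => //.
apply/seteqP; split => z /=; first by move=> ez; exists (val z); rewrite sphereP hp_val.
move=> [w [w1 wE ew]]; move: wE; rewrite -[X in hp w = X]/(hopf z) -hp_val.
move=> /(hp_eq w1 (sphereP z))[l l1 zE].
have -> : set_val z = kscale w l by rewrite -zE.
by rewrite -[u]kscale1 enorm_kdot_kscale // inner_kone.
Qed.

End OpenCap.

(** * From points to the whole hypersurface *)

Section Cover.
Context {R : realType} {K : scalars} {n m : nat}.
Local Notation KK := 'rV[R]_(kdim K).
Local Notation V := 'M[R]_(n.+1, kdim K).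
Local Notation E := 'rV[R]_m.
Hypothesis dim_m : (m + kdim K + 1 = n.+1 * kdim K)%N.

Lemma focal_radius_immersion (M : manifold R m) (nu : M -> TKP R K n) r :
  focal_radius nu = r%:E -> forall t, `|t| < r -> immersion (normal_exp nu t).
Proof.
move=> fr t tr; have /ereal_sup_gt[_ [s [_ imm] <-]] : (`|t|%:E < focal_radius nu)%E.
  by rewrite fr lte_fin.
by rewrite lte_fin => ts; exact: imm.
Qed.

(** Orthogonality to tangent and fibre directions is m + [kdim K] real equations in a space of one
    dimension more. *)
Lemma exists_unit_normal (M : manifold R m) (F : M -> KP R K n) x :
  immersion F -> exists N, is_unit_normal F x N.
Proof.
move=> Fi; have [a [W [g [lift' _]]]] := Fi x.
have [[Aa ax Wx] [Wo Wa gF gs]] := lift'.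
pose y := cmap a x; pose D h := 'D_h (fun y => val (g y)) y.
have gd := smooth_differentiable gs Wx.
have Dl : linear D by move=> c u w; rewrite /D !deriveE ?linearP.
pose f (v : V) : 'rV[R]_m * KK := (\row_i inner v (D (delta_mx 0 i)), kdot (val (g y)) v).
have fl : linear f.
  move=> c u w; apply: injective_projections => /=; last by rewrite kdotDr kdotZr.
  by apply/rowP => i; rewrite !mxE innerDl innerZl.
have dimlt : (dim ('rV[R]_m * KK)%type < dim V)%N.
  have -> : dim ('rV[R]_m * KK)%type = (dim 'rV[R]_m + dim KK)%N by [].
  rewrite !dim_matrix !mul1r.
  have -> : n.+1 * kdim K = (m + kdim K + 1)%N by rewrite dim_m.
  by rewrite addn1.
have [v v0 fv] := linear_kernel fl dimlt.
have vD h : inner v (D h) = 0.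
  have D0 := linear_zero Dl.
  have -> : D h = \sum_i h 0 i *: D (delta_mx 0 i).
    rewrite {1}(row_sum_delta h); elim/big_rec2: _ => // i u w _ <-.
    exact: Dl.
  rewrite innerC inner_sum big1 // => i _; rewrite innerZl innerC.
  by have /= /rowP/(_ i) := congr1 fst fv; rewrite !mxE => ->; rewrite mulr0.
have vh : horizontal (val (g y)) ((enorm v)^-1 *: v).
  apply/horizontalP; rewrite kdotZr.
  by have := congr1 snd fv => /= ->; rewrite scaler0.
exists (tvec (to_horizontal (sphereP (g y)) vh)), a, W, g; split => //.
exists (to_horizontal (sphereP (g y)) vh); split => //=.
  by apply/enorm1P; exact: inner_normalize.
by move=> h; rewrite innerZl; have := vD h; rewrite /D => ->; rewrite mulr0.
Qed.

(** The local inverse is continuous at f x, as its smoothness in charts shows, so it pulls A back to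
    a neighbourhood. *)
Lemma local_diffeo_open (M N : manifold R m) (f : M -> N) x (A : set M) :
  local_diffeo f -> nbhs x A -> nbhs (f x) (f @` A).
Proof.
move=> fd xA; have [U [g [[Uo Ux fUo gf] [_ gs]]]] := fd x.
have fx : (f @` U) (f x) by exists x.
have [a [b [W [[Aa Ab ax Wx] [Wo Wa Wb smo]]]]] := gs (f x) fx.
have [_ ano ac anear] := chart_near Aa ax.
have [dao _ inva mapc _] : is_chart a by have [H _ _] := atlasP N; exact: H.
have [dbo _ invb _ invbc] : is_chart b by have [H _ _] := atlasP M; exact: H.
have gc : g q @[q --> f x] --> x.
  have bx : cdom b x by have := Wb _ Wx; rewrite inva // gf.
  have c1 : cmap a q @[q --> f x] --> cmap a (f x) by exact: mapc.
  have c2 := differentiable_continuous (smooth_differentiable smo Wx).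
  have c3 : cinv b u @[u --> cmap b x] --> x.
    by have [_ _ c _] := chart_near Ab bx.
  have e : cmap b (g (cinv a (cmap a (f x)))) = cmap b x by rewrite inva // gf.
  rewrite /prop_for /continuous_at e in c2.
  have c := cvg_comp _ _ (cvg_comp _ _ c1 c2) c3.
  apply: cvg_near_eq c.
  have n1 : \forall q \near f x, cdom a q by exact: open_nbhs_nbhs.
  have n2 : \forall q \near f x, W (cmap a q).
    by apply: c1; exact: open_nbhs_nbhs.
  apply: filterS2 n1 n2 => q aq Wq /=; have := Wb _ Wq; rewrite inva // => bgq.
  exact: invb.
have n1 : \forall q \near f x, (f @` U) q by exact: open_nbhs_nbhs.
have n2 : \forall q \near f x, A (g q) by exact: gc.
by apply: filterS2 n1 n2 => q [u Uu <-]; rewrite gf // => Au; exists u.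
Qed.

Lemma cover_quadric (M M' : manifold R m) (F : M -> KP R K n) (pr : M' -> M) x' T :
  local_diffeo pr -> in_quadric (F \o pr) x' T -> in_quadric F (pr x') T.
Proof.
move=> prd FT; apply: filterS (local_diffeo_open prd FT) => x [u uT <-] z z1 zF.
exact: uT.
Qed.

Lemma focal_radius_quadric (M : manifold R m) (F : M -> KP R K n) : immersion F ->
  has_focal_radius F (pi / 4)%:E ->
  forall x, exists2 T, kinvolution T & in_quadric F x T.
Proof.
move=> Fi [[nu nuN fr] x|[_ [M' [pr [nu [[prd nuN cov] fr]]]]] x].
  exact: (focal_quadric dim_m x nuN (focal_radius_immersion fr)).
(* A unit normal at x selects a point of the cover above x, where the two-sided case applies. *)
have [N FN] := exists_unit_normal x Fi.
have [x' [[<- _] _]] := cov x N FN.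
have [T TI FT] := focal_quadric dim_m x' nuN (focal_radius_immersion fr).
by exists T => //; exact: cover_quadric FT.
Qed.

(** The points where T works form an open set. It is also closed: near any point some involution S
    works, and if T works at one of these nearby points, then S is T or - T, with the same
    quadric. *)
Lemma global_quadric (M : manifold R m) (F : M -> KP R K n) x0 T : immersion F ->
  connected [set: M] -> kinvolution T ->
  (forall x, exists2 T, kinvolution T & in_quadric F x T) ->
  in_quadric F x0 T -> forall x, in_quadric F x T.
Proof.
move=> Fi Mc TI FT FT0.
have same x S : kinvolution S -> in_quadric F x T -> in_quadric F x S ->
    forall y, in_quadric F y S -> in_quadric F y T.
  move=> SI xT xS y; apply: filterS => y' yS z z1 zF.
  have := yS z z1 zF; have [->|->] := quadric_unique dim_m Fi TI SI xT xS; first by [].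
  by rewrite innerNl => /eqP; rewrite oppr_eq0 => /eqP.
have Ao : open [set x | in_quadric F x T].
  by rewrite openE => x /= xT; exact: nbhs_interior xT.
have Ac : closed [set x | in_quadric F x T].
  rewrite -openC openE => x /= xT; have [S SI xS] := FT x.
  have := nbhs_interior xS; apply: filterS => y yS yT.
  exact/xT/(same y S SI yT yS x xS).
have AT := Mc [set x | in_quadric F x T].
move=> x; suff : [set x | in_quadric F x T] x by [].
rewrite AT //; first by exists x0.
  by exists [set x | in_quadric F x T]; rewrite ?setTI.
by exists [set x | in_quadric F x T]; rewrite ?setTI.
Qed.

End Cover.

Section Congruence.
Context {R : realType} {K : scalars} {n m : nat}.
Local Notation V := 'M[R]_(n.+1, kdim K).
Hypothesis dim_m : (m + kdim K + 1 = n.+1 * kdim K)%N.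

(** One unitary map serves all points, with all of M as neighbourhood. B carries the quadric to |u|
    = |v|, which gives one inclusion; O is a union of caps around the image points, small enough for
    [open_image] to give the other. *)
Lemma quadric_congruent (M : manifold R m) (F : M -> KP R K n) (T B : V -> V) k :
  immersion F -> kinvolution T -> (forall x, in_quadric F x T) -> unitary B ->
  (forall z, inner (T z) z = inner (upart k (B z)) (upart k (B z)) -
                             inner (vpart k (B z)) (vpart k (B z))) ->
  locally_congruent F (clifford R K n k).
Proof.
move=> Fi TI FT BU TB; have [Bdot _ Bsurj] := BU.
have clB z : inner z z = 1 -> clifford R K n k (hp (B z)) <-> inner (T z) z = 0.
  have BzP := unitary_inner BU z z.
  move=> z1; rewrite clifford_hp ?BzP // TB; split=> [->|/eqP]; first exact: subrr.
  by rewrite subr_eq0 => /eqP.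
have cap x : exists O, [/\ open O, O (unitary_map B (F x)) &
    clifford R K n k `&` O `<=` unitary_map B @` (F @` setT)].
  have [z z1 zF] := hp_surj (F x).
  have [e e0 Fe] := open_image dim_m Fi TI FT z1 zF.
  exists [set p | exists w, [/\ inner w w = 1, hp w = p & 1 - e < enorm (kdot (B z) w)]].
  split; first exact: open_cap.
    exists (B z); rewrite -zF unitary_map_hp // (unitary_inner BU); split => //.
    by rewrite Bdot kdot_self z1 scale1r enorm_kone gtrBl.
  move=> p [Cp [w [w1 wp]]]; have [u uw] := Bsurj w.
  have u1 : inner u u = 1 by rewrite -(unitary_inner BU) uw.
  rewrite -uw Bdot => /(Fe u u1)[|x' Fx']; first by apply/(clB _ u1); rewrite uw wp.
  by exists (hp u); [exists x'|rewrite unitary_map_hp // uw].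
pose O x := sval (cid (cap x)).
have OP x : [/\ open (O x), O x (unitary_map B (F x)) &
  clifford R K n k `&` O x `<=` unitary_map B @` (F @` setT)] := svalP (cid (cap x)).
move=> x0; exists setT, (unitary_map B), (\bigcup_x O x); split.
- exact: filterT.
- exact: unitary_isometry.
- by apply: bigcup_open => x _; case: (OP x).
- apply/seteqP; split=> [_ [_ [x _ <-] <-]|p [Cp [x _ Op]]]; last by case: (OP x) => _ _; apply.
  split; last by exists x => //; case: (OP x).
  have [z z1 zF] := hp_surj (F x); rewrite -zF unitary_map_hp //; apply/clB => //.
  exact: (nbhs_singleton (FT x)).
Qed.

End Congruence.

Theorem theorem5p3 (R : realType) (K : scalars) (n : nat) (hn : (0 < n)%N)
    (Sigma : manifold R (kdim K * n).-1)
    (Sigma_closed : closed_manifold Sigma)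
    (Sigma_connected : connected [set: Sigma])
    (F : Sigma -> KP R K n) (F_immersion : immersion F)
    (F_focal : has_focal_radius F (pi / 4)%:E) :
  exists k : nat,
    [/\ (k < n)%N,
        locally_congruent F (clifford R K n k),
        clifford R K n k = tube (pi / 4) (projective_subspace R K n k) &
        totally_geodesic (projective_subspace R K n k)].
Proof.
suff [k kn Fk] : exists2 k, (k < n)%N & locally_congruent F (clifford R K n k).
  by exists k; split => //; [exact: clifford_tube|exact: totally_geodesic_projective].
have dim_m : ((kdim K * n).-1 + kdim K + 1 = n.+1 * kdim K)%N.
  have k0 : (0 < kdim K)%N by case: (K).
  rewrite mulSn [RHS]addnC addnAC addn1 prednK ?muln_gt0 ?k0 //.
  by rewrite mulnC.
(* An empty Sigma counts as connected; congruence is then vacuous and k = 0 is admissible. *)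
have [[x0 _]|S0] := pselect (exists x : Sigma, True); last first.
  by exists 0%N => // x; case: S0; exists x.
have FT := focal_radius_quadric dim_m F_immersion F_focal.
have [T TI FTx0] := FT x0.
have FTx := global_quadric dim_m F_immersion Sigma_connected TI FT FTx0.
have [z z1 zF] := hp_surj (F x0).
have [a [b [a0 Ta b0 Tb]]] := kinvolution_eigenvectors TI z1 (nbhs_singleton FTx0 z z1 zF).
have [Tl Tsym T2 TK] := TI.
have [B [k [kn BU TB]]] := diagonalize Tl TK Tsym T2 a0 Ta b0 Tb.
by exists k => //; exact: (quadric_congruent dim_m F_immersion TI FTx BU TB).
Qed.
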